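(* Consider the TSMDP algorithm run on $m_{\theta^\star}$ with prior $\pi$ and start state $s_0$, fix $\epsilon'\ge0$, and suppose Assumptions (A1)–(A5) below hold. Let $0<\delta\le1$. Then there exists $T_1>0$ such that with probability at least $1-2\delta$, for all $T\ge T_1$, \[ T\mu^\star-\sum_{t=1}^T r(S_t,A_t)=O\!\left(\sqrt{\frac{T}{\bar\tau_{c^\star}}\log\!\left(\frac{\log T}{\delta}\right)}\right). \]
   Context: Setting. $\mathcal{S},\mathcal{A}$ finite state/action sets, $r:\mathcal{S}\times\mathcal{A}\to\mathbb{R}$ a known reward. $\Theta$ a parameter set, each $\theta$ giving transition kernel $p_\theta(s_1,a,s_2)$ and MDP $m_\theta$; true unknown parameter $\theta^\star$. $\mathcal{C}$ is a fixed finite set of stationary policies $c:\mathcal{S}\to\mathcal{A}$ containing an average-reward optimal policy for each $\theta$. $H_{t,\theta,c}(s)=\mathbb{E}_{\theta,c}[\sum_{i=0}^tR_i\mid S_0=s]$ (limits $\lim_tH_{t,\theta,c}/t$ assumed to exist); $c^{\mathsf{OPT}}(\theta)=\arg\max_{c\in\mathcal{C}}\lim_tH_{t,\theta,c}/t$ (fixed tie-breaking), $\mu^{\mathsf{OPT}}(\theta)$ the corresponding maximum, $c^\star=c^{\mathsf{OPT}}(\theta^\star)$, $\mu^\star=\mu^{\mathsf{OPT}}(\theta^\star)$. TSMDP: with prior $\pi$ on $\Theta$ and start state $s_0$, $\pi_0=\pi$, $S_0=s_0$; epochs end at successive returns to $s_0$ ($t_0=0$, $t_k=\min\{t>t_{k-1}:S_t=s_0\}$).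 At the start of each epoch $k$, $\theta_k$ is sampled from the current posterior and $C_k=c^{\mathsf{OPT}}(\theta_k)$ is used during the whole epoch: in state $S_t$ play $A_t=C_k(S_t)$, collect $r(S_t,A_t)$, move to $S_{t+1}\sim p_{\theta^\star}(S_t,A_t,\cdot)$, and update $\pi_{t+1}(d\theta)\propto p_\theta(S_t,A_t,S_{t+1})\pi_t(d\theta)$. Notation. $\pi^{(c)}_s$, $\pi^{(c)}_{(s_1,s_2)}$: stationary probabilities of $s$ and of the pair ($s_1$ followed by $s_2$) under $c$ in $m_{\theta^\star}$; $\bar\tau_c$: expected return time to $s_0$ from $s_0$ under $c$ in $m_{\theta^\star}$. $D_c(\theta^\star\|\theta)=\sum_{s_1}\pi^{(c)}_{s_1}\mathrm{KL}(p_{\theta^\star}(s_1,c(s_1),\cdot)\|p_\theta(s_1,c(s_1),\cdot))$. $S_c=\{\theta:c^{\mathsf{OPT}}(\theta)=c\}$. $N_c(k)$ = number of the first $k$ epochs using policy $c$; $J_{(s_1,s_2)}(k,c)$ = number of transitions $s_1\to s_2$ during the first $k$ epochs in which $c$ was used; $\pi_{t_k}$ = posterior at time $t_k$. Assumptions. (A1) $s_0$ is recurrent for $m_{\theta^\star}$ under each $c^{\mathsf{OPT}}(\theta)$, $\theta$ in the support of $\pi$. (A2) $\exists\Gamma<\infty$: $|\log(p_{\theta^\star}(s_1,a,s_2)/p_\theta(s_1,a,s_2))|\le\Gamma$ for all $s_1,a,s_2$ and $\theta$ with $\pi(\theta)>0$. (A3) $c^\star$ is the unique average-reward optimal policy for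 $m_{\theta^\star}$. (A4) For any $e_1,e_2\ge0$ there is $p^\star(e_1,e_2)>0$ with $\pi_{t_k}(S_{c^\star})\ge p^\star$ whenever $|J_{(s_1,s_2)}(k_c,c)/k_c-\bar\tau_c\pi^{(c)}_{(s_1,s_2)}|\le\sqrt{e_1\log(e_2\log k_c)/k_c}$ for all $s_1,s_2$, $c\in\mathcal{C}$, $k_c\ge1$, $k=\sum_ck_c$ (with $k_c=N_c(k)$). (A5)(A) $\exists a_1>0,a_2\ge0$: $\pi(\{\theta:\sum_ck_c\bar\tau_cD_c(\theta^\star\|\theta)\le1\})\ge a_1k^{-a_2}$ for all nonnegative integers $k_c$, $k=\sum_ck_c$. (A5)(B) $\exists a_3>0,a_4>0$: the same set has mass $\ge a_3k^{-a_4}$ whenever additionally $k_{c^\star}\ge k-3\log^2k$. *)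

(* Defs.v *)
From HB Require Import structures.
From mathcomp Require Import all_boot all_order all_algebra.
From mathcomp Require Import all_classical all_reals all_analysis.
Set Implicit Arguments. Unset Strict Implicit. Unset Printing Implicit Defensive.
Import Order.TTheory GRing.Theory Num.Theory.
Import numFieldNormedType.Exports.
Local Open Scope classical_set_scope.
Local Open Scope ring_scope.

Section MDP.
Variables (R : realType) (St Ac : finType).

Definition policy := {ffun St -> Ac}.
Definition tkernel := St -> Ac -> St -> R.

Definition is_kernel (q : tkernel) :=
  forall s a, (forall s', 0 <= q s a s') /\ \sum_(s' : St) q s a s' = 1.

Fixpoint mdist (q : tkernel) (c : policy) (s : St) (i : nat) : St -> R :=
  match i with
  | 0 => fun s' => (s' == s)%:R
  | i'.+1 => fun s2 => \sum_(s1 : St) mdist q c s i' s1 * q s1 (c s1) s2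
  end.

Definition Hsum (q : tkernel) (r : St -> Ac -> R) (c : policy) (s : St) (t : nat) : R :=
  \sum_(i < t.+1) \sum_(s' : St) mdist q c s i s' * r s' (c s').

Definition avg_seq q r c s : nat -> R := fun t => Hsum q r c s t / t%:R.

(* average reward lim_t H_t(s0)/t (value of the limit, assumed to exist) *)
Definition gain q r c s : R := limn (avg_seq q r c s).

(* taboo q c s0 n s = P(S_1,...,S_n <> s0, S_{n+1} = s | S_0 = s0) *)
Fixpoint taboo (q : tkernel) (c : policy) (s0 : St) (n : nat) : St -> R :=
  match n with
  | 0 => fun s2 => q s0 (c s0) s2
  | n'.+1 => fun s2 => \sum_(s1 : St | s1 != s0) taboo q c s0 n' s1 * q s1 (c s1) s2
  end.

Definition first_return q c s0 (n : nat) : R :=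
  if n is n'.+1 then taboo q c s0 n' s0 else 0.

Definition recurrent q c s0 : Prop :=
  limn (fun n => \sum_(1 <= k < n) first_return q c s0 k) = 1.

Definition mean_return q c s0 : R :=
  limn (fun n => \sum_(1 <= k < n) k%:R * first_return q c s0 k).

Definition stat q c s0 (s : St) : R :=
  limn (fun T => (\sum_(t < T) mdist q c s0 t s) / T%:R).

Definition stat_pair q c s0 (s1 s2 : St) : R := stat q c s0 s1 * q s1 (c s1) s2.

Definition KL (p p' : St -> R) : R :=
  \sum_(s : St) (if p s == 0 then 0 else p s * ln (p s / p' s)).

Definition Dc (qs q : tkernel) (c : policy) s0 : R :=
  \sum_(s1 : St) stat qs c s0 s1 * KL (qs s1 (c s1)) (q s1 (c s1)).

End MDP.

Section TSMDP.
Variables (R : realType) (St Ac : finType).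
Variables (dT : measure_display) (Theta : measurableType dT).
Variable (pi : probability Theta R).
Variable (p : Theta -> tkernel R St Ac).

(* likelihood of the first t transitions of a path (ss = states,      *)
(* cs = policies in use, action at time i is cs i (ss i))            *)
Definition lik (ss : nat -> St) (cs : nat -> policy St Ac) (t : nat) (th : Theta) : R :=
  \prod_(i < t) p th (ss i) (cs i (ss i)) (ss i.+1).

Definition post (ss : nat -> St) (cs : nat -> policy St Ac) (t : nat) (A : set Theta) : R :=
  fine (\int[pi]_(th in A) (lik ss cs t th)%:E)%E
  / fine (\int[pi]_(th in setT) (lik ss cs t th)%:E)%E.

Definition isStart (ss : nat -> St) (s0 : St) (t : nat) : bool := (t == 0)%N || (ss t == s0).

(* probability, under TSMDP, that the first n steps follow (ss, cs):   *)
(* S_0..S_n = ss 0..ss n and C used at times 0..n-1 = cs 0..cs (n-1). *)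
(* At an epoch start, a policy c is chosen with probability equal to   *)
(* the posterior mass of S_c = cOPT^{-1}(c) (theta_k ~ pi_t, C = cOPT(theta_k)); *)
(* otherwise the current policy is kept.                               *)
Definition path_prob (thstar : Theta) (s0 : St) (cOPT : Theta -> policy St Ac)
    (ss : nat -> St) (cs : nat -> policy St Ac) (n : nat) : R :=
  (ss 0%N == s0)%:R *
  \prod_(t < n)
     ((if isStart ss s0 t then post ss cs t (cOPT @^-1` [set cs t])
       else (cs t == cs t.-1)%:R)
      * p thstar (ss t) (cs t (ss t)) (ss t.+1)).

(* number of epochs started before T using c  (N_c(k), k = #epochs before T) *)
Definition Nc (ss : nat -> St) (cs : nat -> policy St Ac) (s0 : St) (T : nat)
    (c : policy St Ac) : nat :=
  \sum_(t < T | isStart ss s0 t && (cs t == c)) 1.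

Definition Jc (ss : nat -> St) (cs : nat -> policy St Ac) (T : nat)
    (c : policy St Ac) (s1 s2 : St) : nat :=
  \sum_(t < T | [&& cs t == c, ss t == s1 & ss t.+1 == s2]) 1.

End TSMDP.

Definition prior_ball (R : realType) (St Ac : finType) (dT : measure_display)
    (Theta : measurableType dT) (p : Theta -> tkernel R St Ac) (thstar : Theta)
    (s0 : St) (Cset : {set policy St Ac}) (kc : policy St Ac -> nat) : set Theta :=
  [set th | \sum_(c in Cset) (kc c)%:R * mean_return (p thstar) c s0
                               * Dc (p thstar) (p th) c s0 <= 1].

(* Main.v *)
(* Every policy [c] that can be selected has a recurrent start state, so its
   Poisson equation has a bounded solution, and the counts of visits,
   transitions and rewards collected while [c] is in use are, up to a bounded
   term, martingales with bounded increments. A mixture of exponential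
   supermartingales and Ville's inequality bound each of them by [K sqrt (n log
   log n)] with a deterministic [K], up to a random multiple of [1 + sqrt n]; the
   same holds for the numbers of selections, compensated by the posterior
   probabilities.

   By (A4) the posterior probability of the optimal policy [c*] stays above a
   random positive constant, so [c*] is used during a positive fraction of the
   epochs. If [th] selects [c <> c*], then [th] is far from [th*] along [c] or
   along [c*], since otherwise the gains at [th] would rank [c*] above [c]. With
   the lower bound on the evidence given by (A5)(A), the posterior probability of
   selecting [c] is at most [exp (- xi min (N_c*, N_c) + O (sqrt (T log log T)))],
   so [N_c] cannot exceed [O (sqrt (T log log T))] for long. Hence almost surely
   the regret is eventually at most [C sqrt (T log log T)], with [C] deterministic,
   and [T1] is obtained by continuity of the probability. *)

(* The constant of the conclusion is chosen before [delta], so nothing random may enter it. Hence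
   the two-part error terms: the random coefficient multiplies only [1 + sqrt n], which one more
   [lilrate n] eventually absorbs because [loglog] is unbounded; [delta] then influences [T1] alone.
   Epochs have random lengths and policies change at random times. Working with single transitions
   copes with this: the Poisson solution of a cost with zero total over a cycle vanishes at [s0],
   the only state where the policy may change, so every completed epoch telescopes to 0, and each
   martingale runs on a clock that counts the steps of one policy. A parameter selecting a
   suboptimal [c] may be indistinguishable from the true one along one of [c] and [c*], and it is
   not known which. Both counts must therefore be large before the posterior becomes small, and the
   linear growth of the count of [c*] has to be established before any bound on that of [c]. *)
Require Import Defs.
From HB Require Import structures.
From mathcomp Require Import all_boot all_order all_algebra.
From mathcomp Require Import all_classical all_reals all_analysis.
From mathcomp Require Import measurable_realfun ring lra.
Set Implicit Arguments. Unset Strict Implicit. Unset Printing Implicit Defensive.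
Import Order.TTheory GRing.Theory Num.Theory.
Import numFieldNormedType.Exports.
Local Open Scope classical_set_scope.
Local Open Scope ring_scope.

(** * Iterated-logarithm rates *)

Section Growth.
Context {R : realType}.
Implicit Types x y : R.

(* Comparable to [ln (ln x)] at infinity, but nondecreasing and at least 1 on all
   of [0, +oo[; the factor 2 absorbs the base of the dyadic blocks in [lil_upper]. *)
Definition loglog x : R := 1 + ln (1 + 2 * ln (1 + x)).
Definition lilrate x : R := Num.sqrt (x * loglog x).

Lemma ln1p_ge0 x : 0 <= x -> 0 <= ln (1 + x).
Proof. by move=> x0; apply: ln_ge0; lra. Qed.

Lemma loglog_ge1 x : 0 <= x -> 1 <= loglog x.
Proof.
move=> x0; have := ln1p_ge0 x0 => h.
by rewrite lerDl; apply: ln1p_ge0; lra.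
Qed.

Lemma le_loglog x y : 0 <= x -> x <= y -> loglog x <= loglog y.
Proof.
move=> x0 xy; rewrite lerD2l ler_ln ?posrE.
- by rewrite lerD2l ler_pM2l// ler_ln ?posrE; lra.
- by have := ln1p_ge0 x0; lra.
- by have := @ln1p_ge0 y; lra.
Qed.

Lemma lilrate_ge0 x : 0 <= lilrate x.
Proof. exact: sqrtr_ge0. Qed.

Lemma le_lilrate x y : 0 <= x -> x <= y -> lilrate x <= lilrate y.
Proof.
move=> x0 xy; rewrite ler_wsqrtr// ler_pM//.
- by have := loglog_ge1 x0; lra.
- exact: le_loglog.
Qed.

Lemma sqrt_le_lilrate x : 0 <= x -> Num.sqrt x <= lilrate x.
Proof.
by move=> x0; rewrite ler_wsqrtr// ler_peMr// loglog_ge1.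
Qed.

(** Apply [1 + x * y <= (1 + x) * (1 + y)] under each of the two logarithms; the outer [1 +] lets a
    product dominate the resulting sum. *)
Lemma loglogM x y : 0 <= x -> 0 <= y -> loglog (x * y) <= loglog x * loglog y.
Proof.
move=> x0 y0; have hx := ln1p_ge0 x0; have hy := ln1p_ge0 y0.
have xy0 : 0 <= x * y by exact: mulr_ge0.
have h1 : ln (1 + x * y) <= ln (1 + x) + ln (1 + y).
  rewrite -lnM ?posrE; [|lra|lra].
  by rewrite ler_ln ?posrE; nra.
have hxy := ln1p_ge0 xy0.
have h2 : ln (1 + 2 * ln (1 + x * y)) <=
   ln (1 + 2 * ln (1 + x)) + ln (1 + 2 * ln (1 + y)).
  rewrite -lnM ?posrE; [|lra|lra].
  by rewrite ler_ln ?posrE; nra.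
rewrite /loglog.
have : 0 <= ln (1 + 2 * ln (1 + x)) by apply: ln1p_ge0; lra.
have : 0 <= ln (1 + 2 * ln (1 + y)) by apply: ln1p_ge0; lra.
nra.
Qed.

(** Converts a rate in steps into one in epochs: a clock at most [b * n] costs only the fixed factor
    [lilrate b]. *)
Lemma lilrateM x y : 0 <= x -> 0 <= y -> lilrate (x * y) <= lilrate x * lilrate y.
Proof.
move=> x0 y0; have lx := loglog_ge1 x0; have ly := loglog_ge1 y0.
rewrite /lilrate -sqrtrM; last by apply: mulr_ge0 => //; lra.
rewrite ler_wsqrtr//.
have -> : x * loglog x * (y * loglog y) = (x * y) * (loglog x * loglog y) by ring.
by rewrite ler_wpM2l ?mulr_ge0// loglogM.
Qed.

Lemma ln_le_sqrt x : 0 <= x -> ln (1 + x) <= 2 * Num.sqrt x.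
Proof.
move=> x0; set s := Num.sqrt x.
have s0 : 0 <= s by exact: sqrtr_ge0.
have xE : x = s ^+ 2 by rewrite sqr_sqrtr.
have : ln (1 + x) <= ln ((1 + s) ^+ 2).
  by rewrite ler_ln ?posrE; nra.
rewrite lnXn; last by lra.
have : ln (1 + s) <= s by apply: le_ln1Dx; lra.
lra.
Qed.

Lemma loglog_le_sqrt x : 0 <= x -> loglog x <= 1 + 4 * Num.sqrt x.
Proof.
move=> x0; have h := ln_le_sqrt x0; have h0 := ln1p_ge0 x0.
rewrite lerD2l; have : ln (1 + 2 * ln (1 + x)) <= 2 * ln (1 + x).
  by apply: le_ln1Dx; lra.
lra.
Qed.

Lemma amgm (a b e : R) : 0 < e -> a * b <= e / 2 * a ^+ 2 + b ^+ 2 / (2 * e).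
Proof.
move=> e0; rewrite -subr_ge0.
have -> : e / 2 * a ^+ 2 + b ^+ 2 / (2 * e) - a * b = (e * a - b) ^+ 2 / (2 * e).
  by field; lra.
by rewrite divr_ge0 ?sqr_ge0//; lra.
Qed.

(** Two uses of [amgm]: one splits [sqrt x * sqrt (loglog x)], the other removes the remaining
    multiple of [sqrt x]. Each may cost [e / 2 * x]. *)
Lemma err_sublinear (K C e : R) : 0 <= K -> 0 <= C -> 0 < e ->
  exists B, 0 <= B /\ forall x, 0 <= x ->
    K * lilrate x + C * (1 + Num.sqrt x) <= e * x + B.
Proof.
move=> K0 C0 e0.
pose a := e / (K + 1).
have a0 : 0 < a by rewrite divr_gt0//; lra.
have Ka : K * a <= e.
  by rewrite /a mulrCA ler_piMr ?(ltW e0)// ler_pdivrMr; lra.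
(* Total coefficient of [sqrt x] left by the first splitting. *)
pose D := 2 * K / a + C.
have D0 : 0 <= D by rewrite addr_ge0// divr_ge0 ?(ltW a0)//; lra.
have a'0 : 0 < a^-1 by rewrite invr_gt0.
exists (K / (2 * a) + C + D ^+ 2 / (2 * e)); split.
  by rewrite !addr_ge0// divr_ge0 ?sqr_ge0//; lra.
move=> x x0; set s := Num.sqrt x.
have s0 : 0 <= s by exact: sqrtr_ge0.
have xE : x = s ^+ 2 by rewrite sqr_sqrtr.
have l0 := loglog_ge1 x0.
have hg : lilrate x <= a / 2 * x + (1 + 4 * s) / (2 * a).
  have := @amgm s (Num.sqrt (loglog x)) a a0.
  rewrite -sqrtrM// -/(lilrate x) -xE sqr_sqrtr; last by lra.
  move=> h; apply: (le_trans h); rewrite lerD2l ler_pM2r ?invr_gt0; last by lra.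
  exact: loglog_le_sqrt.
have h2 := amgm s D e0.
have := ler_wpM2l K0 hg.
have -> : K * (a / 2 * x + (1 + 4 * s) / (2 * a)) =
   K * a * x / 2 + K / (2 * a) + (2 * K / a) * s by field; lra.
have : K * a * x <= e * x by rewrite ler_wpM2r.
rewrite /D in h2 *; rewrite -xE in h2.
set u := 2 * K / a in h2 *; set v := K / (2 * a); set w := (u + C) ^+ 2 / _ in h2 *.
nra.
Qed.

Lemma loglog_unbounded (M : R) : exists n0 : nat, (0 < n0)%N /\
  forall n : nat, (n0 <= n)%N -> M <= loglog n%:R.
Proof.
pose y := expR (expR M); have y0 : 0 < y by exact: expR_gt0.
exists (Num.truncn y).+1; split=> // n hn.
have yn : y <= n%:R.
  apply: (@le_trans _ _ (Num.truncn y).+1%:R); last by rewrite ler_nat.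
  by apply: ltW; rewrite truncnS_gt.
have h1 : expR M <= ln (1 + n%:R).
  by rewrite -ler_expR lnK ?posrE -?/y; lra.
have h2 : M <= ln (1 + 2 * ln (1 + n%:R)).
  by have := expR_gt0 M => h3; rewrite -ler_expR lnK ?posrE; lra.
by rewrite /loglog; lra.
Qed.

(** The coefficient [C], random in the application, disappears here: [sqrt (loglog n)] exceeds
    [2 * C] from some [n0] on, at the price of one unit in front of [lilrate]. *)
Lemma err_le_lilrate (K C : R) : 0 <= C -> exists n0 : nat, (0 < n0)%N /\
  forall n : nat, (n0 <= n)%N ->
  K * lilrate n%:R + C * (1 + Num.sqrt n%:R) <= (K + 1) * lilrate n%:R.
Proof.
move=> C0; have [n0 [n0p h]] := loglog_unbounded ((2 * C) ^+ 2).
exists n0; split=> // n hn.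
rewrite mulrDl mul1r lerD2l /lilrate.
have n1 : (1 <= n)%N by exact: leq_trans hn.
have h1 : 1 <= Num.sqrt n%:R :> R.
  by rewrite -[leLHS]sqrtr1 ler_wsqrtr// ler1n.
have h2 : 2 * C <= Num.sqrt (loglog n%:R).
  rewrite -[leLHS]ger0_norm ?mulr_ge0// -sqrtr_sqr ler_wsqrtr//.
  exact: h.
rewrite sqrtrM//; nra.
Qed.

(** From [1 - y <= expR (- y)] and [(1 + y + 2 y^2) (1 - y) = 1 + y^2 (1 - 2 y)]. *)
Lemma expR_le_quad (y : R) : y <= 2^-1 -> expR y <= 1 + y + 2 * y ^+ 2.
Proof.
move=> hy; have h1 : 1 - y <= expR (- y) by exact: expR_ge1Dx.
have h0 : 0 < 1 - y by lra.
have h2 : expR y <= (1 - y)^-1.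
  by rewrite -[expR y]invrK -expRN lef_pV2 ?posrE// expR_gt0.
apply: (le_trans h2); rewrite -[leLHS]mul1r ler_pdivrMr//; nra.
Qed.

Lemma ln2_ge_half : 2^-1 <= ln 2 :> R.
Proof.
rewrite -[leLHS]expRK ler_ln ?posrE ?expR_gt0//.
by have := @expR_le_quad 2^-1; lra.
Qed.

Lemma ln1n_le (n : nat) : (2 <= n)%N -> ln (1 + n%:R) <= 2 * ln n%:R :> R.
Proof.
move=> n2; have n2' : (2 : R) <= n%:R by rewrite ler_nat.
rewrite (_ : 2 * _ = ln (n%:R ^+ 2)); last by rewrite lnXn ?mulr_natl//; lra.
by rewrite ler_ln ?posrE; nra.
Qed.

(** Brings [loglog] to the shape of the bound in (A4), with [e2 = 6 * expR 1]: the leading 1 becomes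
    the factor [expR 1], and [1 + 4 ln n <= 6 ln n] because [ln n >= 1 / 2]. *)
Lemma loglog_le_ln_ln (n : nat) : (2 <= n)%N ->
  loglog n%:R <= ln (6 * expR 1 * ln n%:R) :> R.
Proof.
move=> n2; have n2' : (2 : R) <= n%:R by rewrite ler_nat.
have h1 := ln1n_le n2.
have h2 : 2^-1 <= ln n%:R :> R.
  by apply: (le_trans ln2_ge_half); rewrite ler_ln ?posrE//; lra.
have e0 := expR_gt0 (1 : R).
have -> : 6 * expR 1 * ln n%:R = expR 1 * (6 * ln n%:R) :> R by ring.
rewrite lnM ?posrE//; last by lra.
rewrite expRK /loglog lerD2l ler_ln ?posrE; try lra.
by have := @ln1p_ge0 n%:R; lra.
Qed.

Lemma loglog_le_lnln : exists n0 : nat, (0 < n0)%N /\ forall n : nat, (n0 <= n)%N ->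
  loglog n%:R <= 6 * ln (ln n%:R) :> R.
Proof.
(* Beyond this point the iterated logarithm is at least 1 and absorbs the additive constants. *)
pose y : R := expR (expR 1).
have y0 : 0 < y by exact: expR_gt0.
exists (maxn 2 (Num.truncn y).+1); split; first by rewrite leq_max.
move=> n; rewrite geq_max => /andP[n2 hn].
have n2' : (2 : R) <= n%:R by rewrite ler_nat.
have yn : y <= n%:R.
  apply: (@le_trans _ _ (Num.truncn y).+1%:R); last by rewrite ler_nat.
  by apply: ltW; rewrite truncnS_gt.
have e1 : 1 < expR 1 :> R by rewrite expR_gt1.
have h1 : expR 1 <= ln n%:R :> R by rewrite -[leLHS]expRK ler_ln ?posrE -?/y ?expR_gt0//; lra.
have h2 : 1 <= ln (ln n%:R) :> R.
  by rewrite -[leLHS]expRK ler_ln ?posrE ?expR_gt0//; lra.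
have h3 : ln (1 + n%:R) <= 2 * ln n%:R :> R.
  rewrite (_ : 2 * _ = ln (n%:R ^+ 2)); last by rewrite lnXn ?mulr_natl//; lra.
  by rewrite ler_ln ?posrE; nra.
have h4 : ln (1 + 2 * ln (1 + n%:R)) <= ln (8 * ln n%:R) :> R.
  by rewrite ler_ln ?posrE; have := ln1p_ge0 (_ : 0 <= n%:R :> R); lra.
have h5 : ln (8 * ln n%:R) = 3 * ln 2 + ln (ln n%:R) :> R.
  rewrite lnM ?posrE; [|lra|lra]; congr (_ + _).
  by rewrite (_ : 8 = 2 ^+ 3) ?lnXn ?mulr_natl//; lra.
have h6 : ln 2 <= 1 :> R by have := @le_ln1Dx R 1; rewrite (_ : 1 + 1 = 2); lra.
by rewrite /loglog; lra.
Qed.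

End Growth.

(** * Return cycles of a finite chain *)

Section Limits.
Context {R : realType}.

Lemma cvgn_rate (a : nat -> R) (l C : R) :
  (forall n, (0 < n)%N -> `|a n - l| <= C / n%:R) -> a @ \oo --> l.
Proof.
move=> h; apply/cvgrPdist_le => e e0.
exists (Num.truncn (`|C| / e)).+1 => // n /= hn.
have n0 : (0 < n)%N by exact: leq_trans hn.
have n0' : 0 < n%:R :> R by rewrite ltr0n.
rewrite distrC; apply: (le_trans (h n n0)).
rewrite ler_pdivrMr//; apply: (le_trans (ler_norm C)).
rewrite -ler_pdivrMl// mulrC; apply: ltW.
by apply: (lt_le_trans (truncnS_gt _)); rewrite ler_nat.
Qed.

Lemma lim_near (a : nat -> R) (l B C : R) : cvgn a ->
  (forall n, (0 < n)%N -> `|a n - l| <= B + C / n%:R) -> `|limn a - l| <= B.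
Proof.
move=> ca h; have hC : (fun n : nat => B + `|C| / n%:R) @ \oo --> B.
  by apply: (@cvgn_rate _ _ `|C|) => n _; rewrite addrAC subrr add0r ger0_norm// divr_ge0.
have h1 : (fun n => `|a n - l|) @ \oo --> `|limn a - l|.
  by apply: cvg_norm; apply: cvgB => //; exact: cvg_cst.
rewrite -(cvg_lim _ h1)// -[leRHS](cvg_lim _ hC)//.
apply: ler_lim; [by apply: cvgP h1|by apply: cvgP hC|].
near=> n.
have n0 : (0 < n)%N by near: n; exists 1%N.
apply: (le_trans (h n n0)); rewrite lerD2l ler_wpM2r ?invr_ge0// ler_norm //.
Unshelve. all: by end_near. Qed.

End Limits.

(** * The chain of one policy, killed at its return to the start state *)

Section Chain.
Context {R : realType} {St Ac : finType}.
Variables (q : tkernel R St Ac) (c : policy St Ac) (s0 : St).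
Hypothesis qker : is_kernel q.
Local Notation K s s' := (q s (c s) s').

Lemma ker_ge0 s s' : 0 <= K s s'.
Proof. by case: (qker s (c s)). Qed.

Lemma ker_sum1 s : \sum_s' K s s' = 1.
Proof. by case: (qker s (c s)). Qed.

Lemma mdist_ge0 s n s' : 0 <= Defs.mdist q c s n s'.
Proof.
elim: n s' => [|n IH] s' /=; first exact: ler0n.
by apply: sumr_ge0 => s1 _; rewrite mulr_ge0// ker_ge0.
Qed.

Lemma mdist_sum1 s n : \sum_s' Defs.mdist q c s n s' = 1.
Proof.
elim: n => [|n IH] /=.
  rewrite (bigD1 s)//= eqxx big1 ?addr0// => s' /negPf h; by rewrite h.
rewrite exchange_big /= -[RHS]IH; apply: eq_bigr => s1 _.
by rewrite -mulr_sumr ker_sum1 mulr1.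
Qed.

Lemma taboo_ge0 n s : 0 <= taboo q c s0 n s.
Proof.
elim: n s => [|n IH] s /=; first exact: ker_ge0.
by apply: sumr_ge0 => s1 _; rewrite mulr_ge0// ker_ge0.
Qed.

(** Probability that the first [n.+1] steps avoid [s0]; the shift is inherited from [taboo]. *)
Definition survival n : R := \sum_(s | s != s0) taboo q c s0 n s.

Lemma survival_ge0 n : 0 <= survival n.
Proof. by apply: sumr_ge0 => s _; exact: taboo_ge0. Qed.

Lemma survival0 : taboo q c s0 0 s0 + survival 0 = 1.
Proof. by rewrite /survival -(ker_sum1 s0) [RHS](bigD1 s0). Qed.

Lemma survivalS n : taboo q c s0 n.+1 s0 + survival n.+1 = survival n.
Proof.
have -> : taboo q c s0 n.+1 s0 + survival n.+1 = \sum_s taboo q c s0 n.+1 s.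
  by rewrite [RHS](bigD1 s0).
rewrite /= exchange_big /=; apply: eq_bigr => s _.
by rewrite -mulr_sumr ker_sum1 mulr1.
Qed.

Lemma survival_noninc n m : survival (n + m) <= survival n.
Proof.
elim: m => [|m IH]; first by rewrite addn0.
apply: le_trans IH; rewrite addnS -(survivalS (n + m)) lerDr; exact: taboo_ge0.
Qed.

Lemma first_return_sum n :
  \sum_(1 <= k < n.+2) first_return q c s0 k = 1 - survival n.
Proof.
elim: n => [|n IH].
  by rewrite big_nat1 -survival0 addrK.
by rewrite big_nat_recr//= IH -(survivalS n) /=; ring.
Qed.

Lemma first_return_ge0 n : 0 <= first_return q c s0 n.
Proof. by case: n => //= n; exact: taboo_ge0. Qed.

Lemma taboo_path n s : 0 < taboo q c s0 n s -> exists y : nat -> St,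
  [/\ y 0%N = s0, y n.+1 = s, forall t, (t <= n)%N -> 0 < K (y t) (y t.+1) &
    forall t, (0 < t <= n)%N -> y t != s0].
Proof.
elim: n s => [|n IH] s /= h.
  exists (fun t => if t == 0%N then s0 else s); split=> //.
    by move=> t; rewrite leqn0 => /eqP ->.
  by move=> t /andP[t0 t1]; rewrite leqn0 in t1; rewrite (eqP t1) in t0.
have [s1 s1s0 hs1] : exists2 s1, s1 != s0 & 0 < taboo q c s0 n s1 * K s1 s.
  apply: contrapT => hn; move: h; rewrite ltNge => /negP; apply.
  apply: sumr_le0 => s1 hs1; rewrite leNgt; apply/negP => h; apply: hn.
  by exists s1.
have t1 : 0 < taboo q c s0 n s1.
  by rewrite lt_def taboo_ge0 andbT; apply/eqP => h0; rewrite h0 mul0r ltxx in hs1.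
have [y [y0 yn yp ys]] := IH _ t1.
exists (fun t => if (t <= n.+1)%N then y t else s); split => //=.
- by rewrite ltnn.
- move=> t tn; rewrite tn ltnS; have [tn1|tn1] := leqP t n.
    exact: yp.
  have -> : t = n.+1 by apply/eqP; rewrite eqn_leq tn.
  by rewrite yn; move: hs1; rewrite pmulr_rgt0.
- move=> t /andP[ht0 tn]; rewrite tn; have [tn1|tn1] := leqP t n.
    by apply: ys; rewrite ht0.
  by have -> : t = n.+1; [apply/eqP; rewrite eqn_leq tn|rewrite yn].
Qed.

Hypothesis Hrec : recurrent q c s0.

(** [recurrent] only gives the value of a [limn]. If [survival] stayed above [e], the partial sums
    would be monotone and bounded by [1 - e], hence convergent to a limit below 1. *)
Lemma survival_small e : 0 < e -> exists n, survival n < e.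
Proof.
move=> e0; apply: contrapT => hn.
have h n : e <= survival n by rewrite leNgt; apply/negP => h; apply: hn; exists n.
have hb n : \sum_(1 <= k < n) first_return q c s0 k <= 1 - e.
  case: n => [|[|n]]; last by rewrite first_return_sum lerD2l lerN2.
  - by rewrite big_geq// subr_ge0; apply: le_trans (h 0%N) _;
      rewrite -survival0 lerDr taboo_ge0.
  - by rewrite big_geq// subr_ge0; apply: le_trans (h 0%N) _;
      rewrite -survival0 lerDr taboo_ge0.
have cv : cvgn (fun n => \sum_(1 <= k < n) first_return q c s0 k).
  apply: nondecreasing_is_cvgn.
    apply/nondecreasing_seqP => n; case: n => [|n]; first by rewrite !big_geq.
    by rewrite [leRHS]big_nat_recr//= lerDl; exact: (first_return_ge0 n.+1).
  by exists (1 - e) => _ [n _ <-].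
have : limn (fun n => \sum_(1 <= k < n) first_return q c s0 k) <= 1 - e.
  by apply: limr_le => //; apply: nearW.
by rewrite (Hrec : _ = 1); lra.
Qed.

(** Without a positive first-return probability [survival] would remain 1. The path found here is
    the cycle that later prolongs histories. *)
Lemma return_path : exists n (y : nat -> St),
  [/\ y 0%N = s0, y n.+1 = s0, forall t, (t <= n)%N -> 0 < K (y t) (y t.+1) &
    forall t, (0 < t <= n)%N -> y t != s0].
Proof.
apply: contrapT => hn.
have h n : taboo q c s0 n s0 = 0.
  apply/eqP; rewrite eq_le taboo_ge0 andbT leNgt; apply/negP => h; apply: hn.
  by exists n; exact: taboo_path.
have hs n : survival n = 1.
  elim: n => [|n IH]; first by rewrite -survival0 h add0r.
  by have := survivalS n; rewrite h add0r IH.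
by have [n] := survival_small ltr01; rewrite hs ltxx.
Qed.

Definition reach s : bool := (s == s0) || `[< exists n, 0 < taboo q c s0 n s >].

Lemma reach0 : reach s0.
Proof. by rewrite /reach eqxx. Qed.

Lemma taboo_reach n s : 0 < taboo q c s0 n s -> reach s.
Proof. by move=> h; apply/orP; right; apply/asboolP; exists n. Qed.

Lemma reach_closed s s' : reach s -> 0 < K s s' -> reach s'.
Proof.
have [-> _ h|ss0] := eqVneq s s0; first exact: (@taboo_reach 0).
rewrite {1}/reach (negPf ss0) /= => /asboolP[n hn] h.
apply: (@taboo_reach n.+1) => /=; rewrite (bigD1 s)//=.
rewrite ltr_pwDl ?mulr_gt0//.
by apply: sumr_ge0 => s1 _; rewrite mulr_ge0 ?taboo_ge0 ?ker_ge0.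
Qed.

(** The taboo mass carried by a closed set avoiding [s0] cannot decrease, yet it lies below
    [survival], which tends to 0. *)
Lemma closed_unreachable (U : pred St) s : (forall x, U x -> x != s0) ->
  (forall x y, U x -> 0 < K x y -> U y) -> U s -> reach s -> False.
Proof.
move=> U0 Uc Us; rewrite /reach (negPf (U0 _ Us)) /= => /asboolP[n hn].
pose m k := \sum_(x | U x) taboo q c s0 k x.
have mS k : m k <= m k.+1.
  rewrite [leRHS]/m /= exchange_big /= [leRHS](bigID U)/=.
  have -> : m k = \sum_(x | (x != s0) && U x) taboo q c s0 k x.
    by apply: eq_bigl => x; case Ux : (U x); rewrite ?andbF// (U0 _ Ux).
  rewrite -[leLHS]addr0 lerD//; last first.
    by apply: sumr_ge0 => x _; apply: sumr_ge0 => y _; rewrite mulr_ge0 ?taboo_ge0 ?ker_ge0.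
  apply: ler_sum => x /andP[_ Ux]; rewrite -mulr_sumr.
  suff -> : \sum_(y | U y) K x y = 1 by rewrite mulr1.
  rewrite -(ker_sum1 x) [RHS](bigID U)/= [X in _ + X]big1 ?addr0// => y Uy.
  apply/eqP; rewrite eq_le ker_ge0 andbT leNgt; apply/negP => h.
  by rewrite (Uc _ _ Ux h) in Uy.
have mn k : m n <= m (n + k)%N.
  by elim: k => [|k IH]; [rewrite addn0|rewrite addnS; exact: le_trans IH (mS _)].
have ms k : m k <= survival k.
  rewrite /survival [leRHS](bigID U)/=.
  have -> : m k = \sum_(x | (x != s0) && U x) taboo q c s0 k x.
    by apply: eq_bigl => x; case Ux : (U x); rewrite ?andbF// (U0 _ Ux).
  by rewrite lerDl; apply: sumr_ge0 => x _; exact: taboo_ge0.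
have m0 : 0 < m n.
  rewrite /m (bigD1 s)//= ltr_pwDl//.
  by apply: sumr_ge0 => x _; exact: taboo_ge0.
have [k hk] := survival_small m0.
have := ms (n + k)%N; have := mn k; have := survival_noninc k n.
rewrite addnC; lra.
Qed.

(* The kernel killed at [s0]; its rows outside the reachable set are put to 0
   so that [1 - Qm] is invertible. *)
Definition Qm s s' : R := if reach s && (s' != s0) then K s s' else 0.

Lemma Qm_ge0 s s' : 0 <= Qm s s'.
Proof. by rewrite /Qm; case: ifP => // _; exact: ker_ge0. Qed.

(* Maximum principle: the set where a positive maximum is attained would be
   closed and would never meet [s0]. *)
Lemma subharmonic_le0 (u : St -> R) :
  (forall s, u s <= \sum_s' Qm s s' * u s') -> forall s, u s <= 0.
Proof.
move=> hu; set m := u [arg max_(x > s0) u x]%O.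
have um s : u s <= m by rewrite /m; case: arg_maxP => // i _ /(_ s); apply.
suff m0 : m <= 0 by move=> s; exact: le_trans m0.
rewrite leNgt; apply/negP => m0.
have step s : u s = m -> reach s /\ (forall s', 0 < K s s' -> s' != s0 /\ u s' = m).
  move=> us.
  have rs : reach s.
    apply/negPn/negP => /negPf rs; have := hu s.
    by rewrite big1 ?us; [lra|move=> s' _; rewrite /Qm rs mul0r].
  split=> // s' hs'.
  have hz : \sum_x K s x * (m - (x != s0)%:R * u x) = 0.
    apply/eqP; rewrite eq_le; apply/andP; split; last first.
      apply: sumr_ge0 => x _; rewrite mulr_ge0 ?ker_ge0// subr_ge0.
      by case: (x != s0); rewrite ?mul1r// mul0r ltW.
    under eq_bigr do rewrite mulrBr.
    rewrite sumrB -mulr_suml ker_sum1 mul1r subr_le0 -{1}us.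
    apply: (le_trans (hu s)); apply: ler_sum => x _.
    by rewrite /Qm rs /=; case: (x != s0); rewrite ?mul1r// !mul0r mulr0.
  have := @psumr_eq0P _ _ predT (fun x => K s x * (m - (x != s0)%:R * u x)).
  move=> /(_ _ hz s' isT); rewrite /= => hh.
  have {hh} : K s s' * (m - (s' != s0)%:R * u s') = 0.
    apply: hh => x _; rewrite mulr_ge0 ?ker_ge0// subr_ge0.
    by case: (x != s0); rewrite ?mul1r// mul0r ltW.
  move/eqP; rewrite mulf_eq0 gt_eqF//=.
  case: (s' != s0); rewrite ?mul1r ?mul0r subr_eq0 => /eqP h //.
  by rewrite h ltxx in m0.
pose U := [pred s | (s != s0) && (u s == m)].
have [s us] : exists s, u s = m by exists [arg max_(x > s0) u x]%O.
have [rs hs] := step _ us.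
have [s' hs'] : exists s', 0 < K s s'.
  apply: contrapT => hn; have := ker_sum1 s; rewrite big1 => [/esym/eqP|x _].
    by rewrite oner_eq0.
  by apply/eqP; rewrite eq_le ker_ge0 andbT leNgt; apply/negP => h; apply: hn; exists x.
have [s'0 us'] := hs _ hs'.
apply: (@closed_unreachable U s').
- by move=> x /andP[].
- move=> x y /andP[_ /eqP ux] hxy; have [_ /(_ _ hxy)[y0 uy]] := step _ ux.
  by rewrite /= y0 uy eqxx.
- by rewrite /= s'0 us' eqxx.
- exact: reach_closed hs'.
Qed.

Lemma harmonic_eq0 (u : St -> R) :
  (forall s, u s = \sum_s' Qm s s' * u s') -> forall s, u s = 0.
Proof.
move=> hu s; apply/eqP; rewrite eq_le; apply/andP; split.
  by apply: subharmonic_le0 => x; rewrite -hu.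
rewrite -oppr_le0; apply: (@subharmonic_le0 (fun x => - u x)) => x.
by rewrite {1}hu -sumrN; apply: ler_sum => y _; rewrite mulrN.
Qed.

Definition Dmx : 'M[R]_#|St| :=
  \matrix_(i, j) ((i == j)%:R - Qm (enum_val i) (enum_val j)).

(** A vector in the kernel is a function harmonic for [Qm], hence zero; transposing turns the right
    kernel into the left kernel handled by [kermx]. *)
Lemma Dmx_unit : Dmx \in unitmx.
Proof.
rewrite -unitmx_tr -row_free_unit -kermx_eq0; apply/rowV0P => v /sub_kermxP hv.
have hu s : v ord0 (enum_rank s) = \sum_s' Qm s s' * v ord0 (enum_rank s').
  have := congr1 (fun A : 'rV_#|St| => A ord0 (enum_rank s)) hv.
  rewrite !mxE.
  under eq_bigr do rewrite !mxE mulrBr.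
  rewrite sumrB (bigD1 (enum_rank s))//= eqxx mulr1 big1 ?addr0; last first.
    by move=> i /negPf hi; rewrite eq_sym hi mulr0.
  move=> /eqP; rewrite subr_eq0 => /eqP ->.
  rewrite [LHS](reindex (@enum_rank St))/=; last first.
    by exists enum_val => x _; rewrite ?enum_rankK ?enum_valK.
  by apply: eq_bigr => x _; rewrite !enum_rankK mulrC.
apply/rowP => i; rewrite mxE -(enum_valK i).
exact: (harmonic_eq0 hu).
Qed.

(** Inverse of [1 - Qm], the Green function of the killed chain: the expected number of visits to
    [s'] before the return to [s0], for a reachable start [s]. Accordingly [solve f s] is the
    expected [f]-cost before that return, and [visits] counts over one cycle, initial state
    included. *)
Definition green s s' : R := (invmx Dmx) (enum_rank s) (enum_rank s').
Definition solve (f : St -> R) s : R := \sum_s' green s s' * f s'.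
Definition visits s : R := green s0 s.
Definition cycle_len : R := \sum_s visits s.

Lemma solveE f s : solve f s = f s + \sum_s' Qm s s' * solve f s'.
Proof.
pose F : 'cV[R]_#|St| := \col_i f (enum_val i).
have E x : solve f x = (invmx Dmx *m F) (enum_rank x) ord0.
  rewrite mxE /solve (reindex (@enum_rank St))/=; last first.
    by exists enum_val => y _; rewrite ?enum_rankK ?enum_valK.
  by apply: eq_bigr => y _; rewrite mxE enum_rankK.
have := congr1 (fun A : 'cV_#|St| => A (enum_rank s) ord0) (mulKVmx Dmx_unit F).
rewrite mxE [RHS]mxE enum_rankK.
under eq_bigr do rewrite mxE mulrBl.
rewrite sumrB (bigD1 (enum_rank s))//= eqxx mul1r big1 ?addr0; last first.
  by move=> i /negPf hi; rewrite eq_sym hi mul0r.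
rewrite -E => <-.
rewrite [X in _ - X + _](reindex (@enum_rank St))/=; last first.
  by exists enum_val => y _; rewrite ?enum_rankK ?enum_valK.
rewrite -addrA -[LHS]addr0; congr (_ + _); apply/esym/eqP.
rewrite addrC subr_eq0; apply/eqP; apply: eq_bigr => x _.
by rewrite !enum_rankK E.
Qed.

Lemma solve_ge0 f : (forall s, 0 <= f s) -> forall s, 0 <= solve f s.
Proof.
move=> f0 s; rewrite -oppr_le0; apply: (@subharmonic_le0 (fun x => - solve f x)) => x.
rewrite {1}solveE opprD -sumrN; under [leRHS]eq_bigr do rewrite mulrN.
by rewrite gerDr oppr_le0.
Qed.

Lemma solve_start f : solve f s0 = \sum_s visits s * f s.
Proof. by []. Qed.

Lemma solve_delta a : solve (fun s => (s == a)%:R) s0 = visits a.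
Proof.
rewrite solve_start (bigD1 a)//= eqxx mulr1 big1 ?addr0// => s /negPf ->.
by rewrite mulr0.
Qed.

Lemma visits_ge0 s : 0 <= visits s.
Proof. by rewrite -solve_delta; apply: solve_ge0 => x; exact: ler0n. Qed.

(** [Qm] never enters [s0], so the expected number of visits to [s0], restricted to the other
    states, is subharmonic and vanishes; only the initial visit counts. *)
Lemma visits_start : visits s0 = 1.
Proof.
rewrite -solve_delta solveE eqxx big1 ?addr0// => s _.
set u := solve _.
have u0 x : 0 <= u x by apply: solve_ge0 => ?; exact: ler0n.
rewrite /Qm; case: ifP => [/andP[_ ss0]|_]; last by rewrite mul0r.
have : (fun x => (x != s0)%:R * u x) s <= 0.
  apply: (@subharmonic_le0 (fun x => (x != s0)%:R * u x)) => x; have [->|xs0] := eqVneq x s0; rewrite ?mul0r.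
    by apply: sumr_ge0 => y _; rewrite !mulr_ge0 ?Qm_ge0.
  rewrite mul1r {1}/u solveE (negPf xs0) add0r; apply: ler_sum => y _.
  by rewrite /Qm; case: (y != s0); rewrite ?mul1r// andbF !mul0r.
rewrite /= ss0 mul1r => h.
by have -> : u s = 0; [apply/eqP; rewrite eq_le h u0|rewrite mulr0].
Qed.

(* The [f]-cost still expected before the return to [s0], on the event that the
   first [n.+1] steps avoided [s0]. *)
Definition pending f n : R := \sum_(s | s != s0) taboo q c s0 n s * solve f s.

Lemma solve_pending f : solve f s0 = f s0 + pending f 0.
Proof.
rewrite {1}solveE; congr (_ + _); rewrite /pending [LHS](bigID (fun s => s != s0))/=.
rewrite [X in _ + X]big1 ?addr0; last first.
  by move=> s /negPn/eqP ->; rewrite /Qm eqxx andbF mul0r.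
by apply: eq_bigr => s hs; rewrite /Qm reach0 hs.
Qed.

Lemma pendingS f n :
  pending f n = \sum_(s | s != s0) taboo q c s0 n s * f s + pending f n.+1.
Proof.
rewrite /pending /=.
under [X in _ = _ + X]eq_bigr do rewrite mulr_suml.
rewrite exchange_big /= -big_split /=; apply: eq_bigr => s hs.
rewrite solveE mulrDr; congr (_ + _).
have [h|h] := eqVneq (taboo q c s0 n s) 0.
  by rewrite h mul0r big1// => s' _; rewrite !mul0r.
have rs : reach s by apply: (@taboo_reach n); rewrite lt_def h taboo_ge0.
rewrite mulr_sumr [LHS](bigID (fun s' => s' != s0))/= [X in _ + X]big1 ?addr0.
  by apply: eq_bigr => s' hs'; rewrite /Qm rs hs' mulrA.
by move=> s' /negPn/eqP ->; rewrite /Qm eqxx andbF mul0r mulr0.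
Qed.

Lemma pending_ge0 f n : (forall s, 0 <= f s) -> 0 <= pending f n.
Proof.
by move=> f0; apply: sumr_ge0 => s _; rewrite mulr_ge0 ?taboo_ge0 ?solve_ge0.
Qed.

(** The [pending] costs for the indicator of [s] never exceed [visits s], and at a time when [s]
    carries taboo mass they include that mass. *)
Lemma visits_gt0 s : reach s -> 0 < visits s.
Proof.
have [->|ss0] := eqVneq s s0; first by rewrite visits_start ltr01.
rewrite /reach (negPf ss0) /= => /asboolP[n hn].
have d0 x : 0 <= (x == s)%:R :> R by exact: ler0n.
have h k : pending (fun x => (x == s)%:R) k <= visits s.
  elim: k => [|k IH].
    rewrite -solve_delta solve_pending.
    by apply: ler_wpDl.
  apply: le_trans IH; rewrite [leRHS]pendingS lerDr.
  by apply: sumr_ge0 => x _; rewrite mulr_ge0 ?taboo_ge0.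
apply: lt_le_trans (h n); rewrite pendingS ltr_pwDl ?pending_ge0//.
rewrite (bigD1 s)//= eqxx mulr1 ltr_pwDl//.
by apply: sumr_ge0 => x _; rewrite mulr_ge0 ?taboo_ge0.
Qed.

Lemma cycle_len_ge1 : 1 <= cycle_len.
Proof.
rewrite /cycle_len (bigD1 s0)//= visits_start lerDl.
by apply: sumr_ge0 => s _; exact: visits_ge0.
Qed.

Lemma cycle_lenE : cycle_len = solve (fun=> 1) s0.
Proof. by rewrite solve_start; apply: eq_bigr => s _; rewrite mulr1. Qed.

End Chain.

(** * Long-run averages expressed through return cycles *)

Section ChainLimits.
Context {R : realType} {St Ac : finType}.
Variables (q : tkernel R St Ac) (c : policy St Ac) (s0 : St).
Hypothesis qker : is_kernel q.
Hypothesis Hrec : recurrent q c s0.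
Local Notation K s s' := (q s (c s) s').
Local Notation tau := (cycle_len q c s0).
Local Notation v := (visits q c s0).
Local Notation sol := (solve q c s0).
Local Notation rch := (reach q c s0).

Lemma cycle_len_gt0 : 0 < tau.
Proof. exact: lt_le_trans ltr01 (cycle_len_ge1 qker Hrec). Qed.

(** Summation by parts: [tau] is one plus the sum of the survival probabilities, and the two
    subtracted terms are what truncation leaves out. *)
Lemma return_time_sum n : \sum_(1 <= k < n.+2) k%:R * first_return q c s0 k =
  tau - pending q c s0 (fun=> 1) n - n.+1%:R * survival q c s0 n.
Proof.
have pS k : pending q c s0 (fun=> 1) k =
    survival q c s0 k + pending q c s0 (fun=> 1) k.+1.
  rewrite (pendingS qker Hrec); congr (_ + _).
  by apply: eq_bigr => s _; rewrite mulr1.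
elim: n => [|n IH].
  rewrite big_nat1 !mul1r (cycle_lenE q c s0) (solve_pending qker Hrec) /=.
  by rewrite addrK -(survival0 c s0 qker) addrK.
rewrite big_nat_recr//= IH (pS n) -(survivalS c s0 qker n).
rewrite -[\sum_(s1 | s1 != s0) taboo q c s0 n s1 * _]/(taboo q c s0 n.+1 s0) -!natr1; ring.
Qed.

(** [pending] is at most [X] times [survival], which is its own decrement, so it decays
    geometrically. The cubic bound, read off from [y ^ 3 / 6 <= expR y], beats the factor [n.+1] of
    [return_time_sum]. *)
Lemma pending_decay : exists C, forall n, (0 < n)%N ->
  0 <= pending q c s0 (fun=> 1) n <= C / n%:R ^+ 3.
Proof.
pose V n := pending q c s0 (fun=> 1 : R) n.
have one0 (s : St) : 0 <= 1 :> R by exact: ler01.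
have V0 n : 0 <= V n by exact: (pending_ge0 qker Hrec n one0).
have pS k : V k = survival q c s0 k + V k.+1.
  rewrite /V (pendingS qker Hrec); congr (_ + _).
  by apply: eq_bigr => s _; rewrite mulr1.
pose X := \sum_s sol (fun=> 1) s.
have sX s : sol (fun=> 1) s <= X.
  rewrite /X (bigD1 s)//= lerDl; apply: sumr_ge0 => x _.
  exact: (solve_ge0 qker Hrec one0).
have X0 : 0 < X.
  by apply: lt_le_trans (sX s0); rewrite -cycle_lenE cycle_len_gt0.
have VX n : V n <= X * survival q c s0 n.
  rewrite mulr_sumr; apply: ler_sum => s _.
  by rewrite mulrC ler_wpM2r ?(taboo_ge0 c s0 qker).
have step n : V n.+1 <= V n * expR (- X^-1).
  have h1 : V n / X <= survival q c s0 n by rewrite ler_pdivrMr// mulrC.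
  apply: (@le_trans _ _ (V n * (1 + - X^-1))).
    by clear one0; have := pS n; rewrite mulrDr mulr1 mulrN; lra.
  by rewrite ler_wpM2l// expR_ge1Dx.
have geo n : V n <= V 0%N * expR (- (n%:R / X)).
  elim: n => [|n IH]; first by rewrite mul0r oppr0 expR0 mulr1.
  apply: (le_trans (step n)).
  apply: (@le_trans _ _ (V 0%N * expR (- (n%:R / X)) * expR (- X^-1))).
    by rewrite ler_wpM2r ?expR_ge0.
  by rewrite -mulrA -expRD -natr1 mulrDl mul1r opprD.
exists (V 0%N * (6 * X ^+ 3)) => n n0; rewrite V0 /=.
apply: (le_trans (geo n)); rewrite -mulrA ler_wpM2l//.
have n0' : 0 < n%:R :> R by rewrite ltr0n.
have h := @expR_ge1Dxn R (n%:R / X) 2 (divr_ge0 (ler0n _ _) (ltW X0)).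
have h3 : n%:R ^+ 3 / (6 * X ^+ 3) <= expR (n%:R / X).
  apply: le_trans h; rewrite (_ : 3`!%:R = 6)// expr_div_n.
  have -> : n%:R ^+ 3 / X ^+ 3 / 6 = n%:R ^+ 3 / (6 * X ^+ 3) :> R.
    by field; rewrite gt_eqF.
  by rewrite lerDr.
rewrite expRN -[leRHS]invrK lef_pV2 ?posrE ?expR_gt0//; last first.
  by rewrite invr_gt0 divr_gt0 ?exprn_gt0 ?mulr_gt0// exprn_gt0.
by rewrite invf_div.
Qed.

Lemma mean_returnE : mean_return q c s0 = tau.
Proof.
have [C hC] := pending_decay.
rewrite /mean_return; apply: cvg_lim => //.
rewrite -(cvg_shiftn 2); apply: (@cvgn_rate _ _ _ (3 * C)) => n n0.
rewrite /= addn2 return_time_sum.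
set p := pending _ _ _ _ _; set w := survival _ _ _ _.
have -> : tau - p - n.+1%:R * w - tau = - (p + n.+1%:R * w) by ring.
rewrite normrN {}/p {}/w.
have /andP[p0 pC] := hC n n0.
have s0' := survival_ge0 c s0 qker n.
have n1 : 1 <= n%:R :> R by rewrite ler1n.
(* This lets the decay of [pending] control both error terms. *)
have sp : survival q c s0 n <= pending q c s0 (fun=> 1) n.
  rewrite (pendingS qker Hrec) /survival.
  under [in leRHS]eq_bigr do rewrite mulr1.
  by rewrite lerDl (pending_ge0 qker Hrec)// => s; exact: ler01.
rewrite ger0_norm; last by rewrite addr_ge0// mulr_ge0.
set p := pending _ _ _ _ _ in p0 pC sp *; set w := survival _ _ _ _ in s0' sp *.
have h : p + n.+1%:R * w <= 3 * (n%:R * p) by rewrite -natr1; nra.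
apply: (le_trans h); rewrite -mulrA ler_pM2l//.
have -> : C / n%:R = n%:R ^+ 2 * (C / n%:R ^+ 3).
  by field; rewrite gt_eqF// ltr0n.
apply: (@le_trans _ _ (n%:R ^+ 2 * p)); last by rewrite ler_wpM2l ?sqr_ge0.
by rewrite ler_wpM2r// expr2 ler_peMr// ltW// (lt_le_trans ltr01).
Qed.

(** For a cost with zero total over a cycle [sol f] vanishes at [s0], so killing at [s0] makes no
    difference and the full kernel may replace [Qm]. *)
Lemma poisson (f : St -> R) : \sum_s v s * f s = 0 ->
  forall s, rch s -> sol f s = f s + \sum_s' K s s' * sol f s'.
Proof.
move=> vf s rs; rewrite {1}(solveE qker Hrec); congr (_ + _).
apply: eq_bigr => s' _; rewrite /Qm rs /=.
by have [->|] //= := eqVneq s' s0; rewrite mul0r solve_start vf mulr0.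
Qed.

Lemma mdist_reach (q' : tkernel R St Ac) : is_kernel q' ->
  (forall s s', rch s -> 0 < q' s (c s) s' -> 0 < K s s') ->
  forall t s, 0 < Defs.mdist q' c s0 t s -> rch s.
Proof.
move=> qk' supp; elim => [|t IH] s /=.
  by case: eqVneq => [-> _|]; [exact: reach0|rewrite ltxx].
move=> h; have [s1 h1] : exists s1, 0 < Defs.mdist q' c s0 t s1 * q' s1 (c s1) s.
  apply: contrapT => hn; move: h; rewrite ltNge => /negP; apply.
  apply: sumr_le0 => s1 _; rewrite leNgt; apply/negP => h; apply: hn.
  by exists s1.
have m0 : 0 < Defs.mdist q' c s0 t s1.
  rewrite lt_def mdist_ge0// andbT; apply/eqP => h0.
  by rewrite h0 mul0r ltxx in h1.
have rs1 := IH _ m0.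
by apply: (reach_closed qker rs1); apply: supp => //; move: h1; rewrite pmulr_rgt0.
Qed.

(** The chain moves with [q'], but the Poisson solution of [q] is inserted: the sum telescopes up to
    the one-step error of exchanging the kernels. With [q' = q] this yields occupation frequencies,
    with another kernel the continuity of the gain. *)
Lemma occupation_perturb (q' : tkernel R St Ac) (f : St -> R) (B : R) :
  is_kernel q' ->
  (forall s s', rch s -> 0 < q' s (c s) s' -> 0 < K s s') ->
  \sum_s v s * f s = 0 ->
  (forall s, rch s -> `|\sum_s' (q' s (c s) s' - K s s') * sol f s'| <= B) ->
  forall T, `|\sum_(t < T) \sum_s Defs.mdist q' c s0 t s * f s|
     <= \sum_s `|sol f s| + T%:R * B.
Proof.
move=> qk' supp vf hB T; pose m t s := Defs.mdist q' c s0 t s.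
have m0 t s : 0 <= m t s by exact: mdist_ge0.
have step t : \sum_s m t s * f s = \sum_s m t s * sol f s - \sum_s m t.+1 s * sol f s
     + \sum_s m t s * (\sum_s' (q' s (c s) s' - K s s') * sol f s').
  have -> : \sum_s m t.+1 s * sol f s =
      \sum_s m t s * \sum_s' q' s (c s) s' * sol f s'.
    rewrite /m /=; under eq_bigr do rewrite mulr_suml.
    rewrite exchange_big; apply: eq_bigr => s _; rewrite mulr_sumr.
    by apply: eq_bigr => s' _; rewrite mulrA.
  rewrite -sumrB -big_split /=; apply: eq_bigr => s _.
  have [->|ms] := eqVneq (m t s) 0; first by rewrite !mul0r subr0 addr0.
  have rs : rch s by apply: (mdist_reach qk' supp (t := t)); rewrite lt_def ms m0.
  rewrite {1}(poisson vf rs) -mulrBr -mulrDr; congr (_ * _).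
  by under [X in _ = _ + X]eq_bigr do rewrite mulrBl; rewrite sumrB; ring.
have E : \sum_(t < T) \sum_s m t s * f s = - \sum_s m T s * sol f s +
   \sum_(t < T) \sum_s m t s * (\sum_s' (q' s (c s) s' - K s s') * sol f s').
  elim: T => [|T IH].
    rewrite !big_ord0 addr0 /m /= (bigD1 s0)//= eqxx mul1r solve_start vf.
    by rewrite big1 ?addr0 ?oppr0// => s /negPf ->; rewrite mul0r.
  by rewrite !big_ord_recr/= IH step; ring.
rewrite -/(m _ _) in E *; rewrite E; apply: (le_trans (ler_normD _ _)).
have m1 t s : m t s <= 1.
  rewrite -(mdist_sum1 c qk' s0 t) [leRHS](bigD1 s)//= lerDl.
  by apply: sumr_ge0.
apply: lerD.
  rewrite normrN; apply: (le_trans (ler_norm_sum _ _ _)); apply: ler_sum => s _.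
  by rewrite normrM ger0_norm// ler_piMl.
apply: (le_trans (ler_norm_sum _ _ _)).
apply: (@le_trans _ _ (\sum_(t < T) B)); last first.
  by rewrite sumr_const card_ord mulr_natl.
apply: ler_sum => t _; apply: (le_trans (ler_norm_sum _ _ _)).
rewrite -[leRHS]mul1r -(mdist_sum1 c qk' s0 t) mulr_suml; apply: ler_sum => s _.
rewrite normrM ger0_norm//.
have [h|ms] := eqVneq (m t s) 0; first by rewrite -/(m t s) h !mul0r.
rewrite ler_wpM2l//; apply: hB.
by apply: (mdist_reach qk' supp (t := t)); rewrite lt_def ms m0.
Qed.

Lemma occupation_bound (f : St -> R) : \sum_s v s * f s = 0 ->
  forall T, `|\sum_(t < T) \sum_s Defs.mdist q c s0 t s * f s| <= \sum_s `|sol f s|.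
Proof.
move=> vf T; have := @occupation_perturb q f 0 qker (fun s s' _ h => h) vf.
rewrite -[leRHS]addr0 -[X in _ + X](mulr0 T%:R); apply => s _.
by rewrite big1 ?normr0// => s' _; rewrite subrr mul0r.
Qed.

Lemma statE s : stat q c s0 s = v s / tau.
Proof.
have t0 := cycle_len_gt0.
rewrite /stat; apply: cvg_lim => //.
pose f x : R := (x == s)%:R - v s / tau.
have vf : \sum_x v x * f x = 0.
  under eq_bigr do rewrite mulrBr.
  rewrite sumrB -mulr_suml (bigD1 s)//= eqxx mulr1 big1 ?addr0.
    by rewrite -/tau mulrC divfK ?subrr// gt_eqF.
  by move=> x /negPf ->; rewrite mulr0.
apply: (@cvgn_rate _ _ _ (\sum_x `|sol f x|)) => n n0.
have n0' : 0 < n%:R :> R by rewrite ltr0n.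
have -> : (\sum_(t < n) Defs.mdist q c s0 t s) / n%:R - v s / tau =
    (\sum_(t < n) \sum_x Defs.mdist q c s0 t x * f x) / n%:R.
  have -> : \sum_(t < n) \sum_x Defs.mdist q c s0 t x * f x =
     \sum_(t < n) (Defs.mdist q c s0 t s - v s / tau).
    apply: eq_bigr => t _; under eq_bigr do rewrite mulrBr.
    rewrite sumrB -mulr_suml (mdist_sum1 c qker) mul1r (bigD1 s)//= eqxx mulr1.
    by rewrite big1 ?addr0// => x /negPf ->; rewrite mulr0.
  rewrite sumrB sumr_const card_ord -(mulr_natr (v s / tau)) mulrBl mulfK//.
  by rewrite gt_eqF.
rewrite normrM normfV [X in _ / X]ger0_norm// ler_pM2r ?invr_gt0//.
exact: occupation_bound.
Qed.

Lemma gain_perturb (q' : tkernel R St Ac) (r : St -> Ac -> R) (B : R) :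
  is_kernel q' -> cvgn (avg_seq q' r c s0) ->
  (forall s s', rch s -> 0 < q' s (c s) s' -> 0 < K s s') ->
  let g := (\sum_s v s * r s (c s)) / tau in
  (forall s, rch s ->
    `|\sum_s' (q' s (c s) s' - K s s') * sol (fun x => r x (c x) - g) s'| <= B) ->
  `|gain q' r c s0 - g| <= B.
Proof.
move=> qk' cv supp g hB; have t0 := cycle_len_gt0.
pose f x : R := r x (c x) - g.
have vf : \sum_x v x * f x = 0.
  under eq_bigr do rewrite mulrBr.
  by rewrite sumrB -mulr_suml -/tau /g mulrC divfK ?subrr// gt_eqF.
have B0 : 0 <= B by apply: le_trans (hB s0 (reach0 _ _ _)).
pose U := \sum_s `|sol f s|.
(* [avg_seq] divides [n.+1] rewards by [n]; the surplus term accounts for [B] and the absolute value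
   of [g]. *)
apply: (@lim_near _ _ _ _ (U + B + `|g|)) => // n n0.
have n0' : 0 < n%:R :> R by rewrite ltr0n.
have E : Hsum q' r c s0 n = \sum_(t < n.+1) \sum_s Defs.mdist q' c s0 t s * f s + n.+1%:R * g.
  rewrite mulr_natl -[X in g *+ X]card_ord -sumr_const -big_split /=.
  apply: eq_bigr => t _; rewrite -[X in _ + X]mul1r -(mdist_sum1 c qk' s0 t) mulr_suml.
  by rewrite -big_split; apply: eq_bigr => s _; rewrite /= -mulrDr subrK.
have h := occupation_perturb qk' supp vf hB n.+1.
rewrite /avg_seq E.
set S := \sum_(t < n.+1) _ in h *.
have -> : (S + n.+1%:R * g) / n%:R - g = (S + g) / n%:R.
  by rewrite -natr1; field; rewrite gt_eqF.
rewrite normrM normfV [X in _ / X]ger0_norm// ler_pdivrMr//.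
rewrite mulrDl divfK ?gt_eqF//.
apply: (le_trans (ler_normD _ _)); rewrite -/U -natr1 in h; lra.
Qed.

Lemma gainE (r : St -> Ac -> R) : cvgn (avg_seq q r c s0) ->
  gain q r c s0 = (\sum_s v s * r s (c s)) / tau.
Proof.
move=> cv; apply/eqP; rewrite -subr_eq0 -normr_le0.
apply: gain_perturb => // s _.
by rewrite big1 ?normr0// => s' _; rewrite subrr mul0r.
Qed.

End ChainLimits.

(** * Divergence and continuity of the gain *)

Section Divergence.
Context {R : realType} {St Ac : finType}.

(* [p ln (p / p') = - 2 p ln (b / a) >= 2 a (a - b)] with [a = sqrt p] and
   [b = sqrt p']: the divergence dominates the squared Hellinger distance. *)
Lemma KL_hellinger (p p' : St -> R) : (forall s, 0 <= p s) -> (forall s, 0 <= p' s) ->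
  (forall s, (p s == 0) = (p' s == 0)) -> \sum_s p s = 1 -> \sum_s p' s = 1 ->
  \sum_s (Num.sqrt (p s) - Num.sqrt (p' s)) ^+ 2 <= KL p p'.
Proof.
move=> p0 p'0 h p1 p'1.
(* Adding the zero difference of total masses makes the inequality hold term by term. *)
have -> : KL p p' = KL p p' + (\sum_s p' s - \sum_s p s) by rewrite p1 p'1 subrr addr0.
rewrite /KL -sumrB -big_split /=; apply: ler_sum => s _.
case: eqVneq => [ps|ps].
  have /eqP -> : p' s == 0 by rewrite -h ps.
  by rewrite ps sqrtr0 !subrr expr0n addr0.
have ps' : p' s != 0 by rewrite -h.
have pp : 0 < p s by rewrite lt_def ps p0.
have pp' : 0 < p' s by rewrite lt_def ps' p'0.
set a := Num.sqrt (p s); set b := Num.sqrt (p' s).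
have a0 : 0 < a by rewrite sqrtr_gt0.
have b0 : 0 < b by rewrite sqrtr_gt0.
have aE : p s = a ^+ 2 by rewrite sqr_sqrtr.
have bE : p' s = b ^+ 2 by rewrite sqr_sqrtr.
rewrite aE bE -expr_div_n lnXn ?divr_gt0//.
have hl : ln (b / a) <= b / a - 1.
  have := @le_ln1Dx R (b / a - 1); rewrite (addrC 1) subrK; apply.
  by have := divr_gt0 b0 a0; lra.
have lE : ln (b / a) = - ln (a / b).
  by rewrite -[b / a]invf_div lnV ?posrE ?divr_gt0.
rewrite lE in hl.
have h2 : a ^+ 2 * (- ln (a / b)) <= a ^+ 2 * (b / a - 1) by rewrite ler_wpM2l ?sqr_ge0.
have h3 : a ^+ 2 * (b / a - 1) = a * b - a ^+ 2 by field; rewrite gt_eqF.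
rewrite h3 in h2; rewrite -mulr_natl; nra.
Qed.

Lemma KL_ge0 (p p' : St -> R) : (forall s, 0 <= p s) -> (forall s, 0 <= p' s) ->
  (forall s, (p s == 0) = (p' s == 0)) -> \sum_s p s = 1 -> \sum_s p' s = 1 ->
  0 <= KL p p'.
Proof.
move=> p0 p'0 h p1 p'1; apply: le_trans (KL_hellinger p0 p'0 h p1 p'1).
by apply: sumr_ge0 => s _; exact: sqr_ge0.
Qed.

(** Factor [p - p' = (a - b) (a + b)] with square roots at most 1, then use the Hellinger bound. *)
Lemma KL_pointwise (p p' : St -> R) s : (forall s, 0 <= p s) -> (forall s, 0 <= p' s) ->
  (forall s, (p s == 0) = (p' s == 0)) -> \sum_s p s = 1 -> \sum_s p' s = 1 ->
  (p s - p' s) ^+ 2 <= 4 * KL p p'.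
Proof.
move=> p0 p'0 h p1 p'1; have hh := KL_hellinger p0 p'0 h p1 p'1.
set a := Num.sqrt (p s); set b := Num.sqrt (p' s).
have h1 : (a - b) ^+ 2 <= KL p p'.
  apply: le_trans hh; rewrite (bigD1 s)//= lerDl.
  by apply: sumr_ge0 => x _; exact: sqr_ge0.
have le1 (f : St -> R) x : (forall y, 0 <= f y) -> \sum_y f y = 1 -> Num.sqrt (f x) <= 1.
  move=> f0 f1; rewrite -[leRHS]sqrtr1 ler_wsqrtr// -f1 (bigD1 x)//= lerDl.
  by apply: sumr_ge0.
have a1 : a <= 1 by exact: le1.
have b1 : b <= 1 by exact: le1.
have a0 : 0 <= a by exact: sqrtr_ge0.
have b0 : 0 <= b by exact: sqrtr_ge0.
rewrite -[p s]sqr_sqrtr// -[p' s]sqr_sqrtr// -/a -/b subr_sqr exprMn.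
rewrite mulrC ler_pM ?sqr_ge0//.
have -> : 4 = 2 ^+ 2 :> R by ring.
by rewrite ler_pXn2r ?nnegrE ?addr_ge0//; lra.
Qed.

Variables (q : tkernel R St Ac) (c : policy St Ac) (s0 : St).
Hypothesis qker : is_kernel q.
Hypothesis Hrec : recurrent q c s0.
Local Notation v := (visits q c s0).

(** Expected divergence accumulated over one cycle of [c]. It equals [mean_return * Dc], in a form
    free of limits. *)
Definition cycle_KL (q' : tkernel R St Ac) : R :=
  \sum_s v s * KL (q s (c s)) (q' s (c s)).

Lemma mean_return_Dc q' : mean_return q c s0 * Dc q q' c s0 = cycle_KL q'.
Proof.
rewrite mean_returnE// /Dc mulr_sumr; apply: eq_bigr => s _.
by rewrite statE// mulrA [_ * (_ / _)]mulrC divfK// gt_eqF// cycle_len_gt0.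
Qed.

Lemma cycle_KL_ge0 q' : is_kernel q' ->
  (forall s s', (q s (c s) s' == 0) = (q' s (c s) s' == 0)) -> 0 <= cycle_KL q'.
Proof.
move=> qk' supp; apply: sumr_ge0 => s _; rewrite mulr_ge0 ?visits_ge0//.
apply: KL_ge0 => //; try exact: ker_ge0; exact: ker_sum1.
Qed.

(** Reachable states have [visits] bounded below, so a small divergence per cycle makes every
    relevant row of [q'] close to that of [q]; the gain then moves by at most that distance times
    the size of the Poisson solution of [q]. *)
Lemma gain_continuous (r : St -> Ac -> R) (e : R) : 0 < e ->
  cvgn (avg_seq q r c s0) ->
  exists2 xi, 0 < xi & forall q', is_kernel q' -> cvgn (avg_seq q' r c s0) ->
    (forall s s', (q s (c s) s' == 0) = (q' s (c s) s' == 0)) ->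
    cycle_KL q' < xi -> `|gain q' r c s0 - gain q r c s0| <= e.
Proof.
move=> e0 cv; set g := gain q r c s0.
have gE : g = (\sum_s v s * r s (c s)) / cycle_len q c s0 by exact: gainE.
pose U := \sum_s `|solve q c s0 (fun x => r x (c x) - g) s|.
have U0 : 0 <= U by exact: sumr_ge0.
(* Row distance that a Poisson solution of total size [U] turns into at most [e]. *)
pose e' := e / (1 + U).
have e'0 : 0 < e' by rewrite divr_gt0//; lra.
pose m := \big[Num.min/1]_(s | reach q c s0 s) v s.
have m0 : 0 < m.
  rewrite /m; elim/big_ind : _ => //.
    by move=> x y x0 y0; rewrite lt_min x0 y0.
  by move=> s; exact: visits_gt0.
have mv s : reach q c s0 s -> m <= v s by move=> rs; exact: bigmin_le_cond.
(* The 4 comes from [KL_pointwise], and [m] converts divergence per cycle into divergence per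
   row. *)
exists (e' ^+ 2 / 4 * m); first by rewrite mulr_gt0// divr_gt0// exprn_gt0.
move=> q' qk' cv' supp hE; rewrite gE; apply: (gain_perturb qker Hrec qk' cv').
  move=> s s' _; rewrite !lt_def !ker_ge0// !andbT.
  by rewrite supp.
move=> s rs; rewrite -gE.
have KLs : KL (q s (c s)) (q' s (c s)) <= e' ^+ 2 / 4.
  have KL0 x : 0 <= KL (q x (c x)) (q' x (c x)).
    by apply: KL_ge0 => //; try exact: ker_ge0; exact: ker_sum1.
  have h : v s * KL (q s (c s)) (q' s (c s)) <= cycle_KL q'.
    rewrite /cycle_KL (bigD1 s)//= lerDl; apply: sumr_ge0 => x _.
    by rewrite mulr_ge0 ?visits_ge0.
  rewrite -(ler_pM2r m0); apply: le_trans (ltW hE); apply: le_trans h.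
  by rewrite mulrC ler_wpM2r ?mv.
apply: (@le_trans _ _ (e' * U)); last first.
  by rewrite /e' mulrAC ler_pdivrMr; nra.
rewrite mulr_sumr; apply: (le_trans (ler_norm_sum _ _ _)); apply: ler_sum => s' _.
rewrite normrM ler_wpM2r//.
rewrite -(@ler_pXn2r _ 2)// ?nnegrE ?(ltW e'0)// real_normK ?num_real//.
rewrite -sqrrN opprB; apply: le_trans (KL_pointwise s' _ _ _ _ _) _ => //.
- by move=> x; exact: ker_ge0.
- by move=> x; exact: ker_ge0.
- exact: ker_sum1.
- exact: ker_sum1.
- lra.
Qed.

End Divergence.

(** * Ville's inequality and the law of the iterated logarithm *)

Section Histories.
Context {A B : finType}.
Implicit Types (x : nat -> A) (y : nat -> B).

Definition agree n x y x' y' : Prop :=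
  (forall t, (t <= n)%N -> x t = x' t) /\ (forall t, (t < n)%N -> y t = y' t).

(** Adaptedness: [f] may only look at the states up to time [n] and the policies before [n], exactly
    what the law of the run specifies. With finite alphabets this takes the place of a
    filtration. *)
Definition local {T : Type} n (f : (nat -> A) -> (nat -> B) -> T) : Prop :=
  forall x y x' y', agree n x y x' y' -> f x y = f x' y'.

Definition put {T : Type} (f : nat -> T) n v : nat -> T := fun t => if t == n then v else f t.

Lemma put_at {T : Type} (f : nat -> T) n v : put f n v n = v.
Proof. by rewrite /put eqxx. Qed.

Lemma put_lt {T : Type} (f : nat -> T) n v t : (t < n)%N -> put f n v t = f t.
Proof. by rewrite /put => h; rewrite ltn_eqF. Qed.

Lemma agree_put n x y a b : agree n x y (put x n.+1 a) (put y n b).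
Proof. by split=> t h; rewrite put_lt. Qed.

Lemma agree_sym n x y x' y' : agree n x y x' y' -> agree n x' y' x y.
Proof. by move=> [h1 h2]; split=> t h; rewrite ?h1 ?h2. Qed.

Lemma agree_trans n x y x1 y1 x2 y2 :
  agree n x y x1 y1 -> agree n x1 y1 x2 y2 -> agree n x y x2 y2.
Proof. by move=> [h1 h2] [h3 h4]; split=> t h; rewrite ?h1 ?h2 ?h3 ?h4. Qed.

Lemma agreeW m n x y x' y' : (m <= n)%N -> agree n x y x' y' -> agree m x y x' y'.
Proof.
move=> mn [h1 h2]; split=> t h; [apply: h1|apply: h2].
  exact: leq_trans h mn.
exact: leq_trans h mn.
Qed.

End Histories.

Section Process.
Context {R : realType} {A B : finType} {d : measure_display} {Omega : measurableType d}.
Variables (P : probability Omega R) (X : nat -> Omega -> A) (Y : nat -> Omega -> B).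
Hypothesis Xm : forall t a, measurable [set w | X t w = a].
Hypothesis Ym : forall t b, measurable [set w | Y t w = b].
Local Notation Pr S := (fine (P S)).

Lemma fine_prob_le S S' : measurable S -> measurable S' -> S `<=` S' -> Pr S <= Pr S'.
Proof.
move=> mS mS' h; rewrite fine_le ?fin_num_measure//.
by apply: le_measure => //; rewrite inE.
Qed.

Lemma fine_prob_union (I : finType) S (F : I -> set Omega) : measurable S ->
  (forall i, measurable (F i)) -> (forall w, S w -> exists i, F i w) ->
  Pr S <= \sum_i Pr (F i).
Proof.
move=> mS mF h.
have := @content_sub_fsum _ _ _ P I setT S F finite_finset (fun i _ => mF i) mS.
have hS : S `<=` \bigcup_(i in setT) F i by move=> w /h [i Fi]; exists i.
move=> /(_ hS) hle; rewrite -lee_fin fineK ?fin_num_measure//.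
apply: (le_trans hle); rewrite fsbig_finite//=.
rewrite (eq_bigr (fun i => (Pr (F i))%:E)); last by move=> i _; rewrite fineK ?fin_num_measure.
rewrite sumEFin lee_fin.
rewrite le_eqVlt; apply/orP; left; apply/eqP/perm_big.
apply: uniq_perm; rewrite ?finmap.fset_uniq ?index_enum_uniq// => i.
rewrite mem_index_enum in_fset_set; first by apply: mem_set.
exact: finite_finset.
Qed.

(** A local predicate is decided by one of finitely many finite histories, so its event is a finite
    union of cylinders. *)
Lemma history_measurable n (Q : (nat -> A) -> (nat -> B) -> Prop) : local n Q ->
  measurable [set w | Q (X^~ w) (Y^~ w)].
Proof.
move=> locQ.
pose H := ({ffun 'I_n.+1 -> A} * {ffun 'I_n.+1 -> B})%type.
pose F (h : H) := [set w | forall i : 'I_n.+1, X i w = h.1 i] `&` [set w | forall i : 'I_n.+1, Y i w = h.2 i].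
have mF h : measurable (F h).
  apply: measurableI.
    rewrite [V in measurable V](_ : _ = \bigcap_(i : 'I_n.+1) [set w | X i w = h.1 i]).
      by apply: fin_bigcap_measurable => //; exact: finite_finset.
    by apply/seteqP; split=> w /=; [move=> hw i _|move=> hw i]; apply: hw.
  rewrite [V in measurable V](_ : _ = \bigcap_(i : 'I_n.+1) [set w | Y i w = h.2 i]).
    by apply: fin_bigcap_measurable => //; exact: finite_finset.
  by apply/seteqP; split=> w /=; [move=> hw i _|move=> hw i]; apply: hw.
rewrite [V in measurable V](_ : _ = \bigcup_(h in [set h : H |
    Q (fun t => h.1 (inord t)) (fun t => h.2 (inord t))]) F h).
  by apply: fin_bigcup_measurable => //; exact: finite_finset.
have E w (h : H) : F h w -> Q (X^~ w) (Y^~ w) = Q (fun t => h.1 (inord t)) (fun t => h.2 (inord t)).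
  move=> [h1 h2]; apply: locQ; split=> t ht.
    by rewrite -h1 inordK.
  by rewrite -h2 inordK// ltnW.
apply/seteqP; split=> w /=.
  move=> hQ; pose h : H := ([ffun i => X (nat_of_ord i) w], [ffun i => Y (nat_of_ord i) w]).
  have Fh : F h w by split=> i /=; rewrite ffunE.
  by exists h => //=; rewrite -(E w h Fh).
by move=> [h /= hQ Fh]; rewrite (E w h Fh).
Qed.

Variables (pw : nat -> (nat -> A) -> (nat -> B) -> R)
  (step : nat -> (nat -> A) -> (nat -> B) -> R) (b0 : B).
Hypothesis law : forall n x y,
  P [set w | (forall t, (t <= n)%N -> X t w = x t) /\ (forall t, (t < n)%N -> Y t w = y t)]
  = (pw n x y)%:E.
Hypothesis pw0 : \sum_a pw 0 (fun=> a) (fun=> b0) = 1.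
Hypothesis pw_local : forall n, local n (pw n).
Hypothesis pwS : forall n x y, pw n.+1 x y = pw n x y * step n x y.

Lemma agree_local n (x : nat -> A) (y : nat -> B) :
  local n (fun x' y' => agree n x' y' x y).
Proof.
move=> x1 y1 x2 y2 h; apply/propext; split=> h'.
  exact: agree_trans (agree_sym h) h'.
exact: agree_trans h h'.
Qed.

Lemma ae_of_weight n Q : local n Q -> (forall x y, ~ Q x y -> pw n x y = 0) ->
  \forall w \ae P, Q (X^~ w) (Y^~ w).
Proof.
move=> lQ hQ.
have mS : measurable [set w | ~ Q (X^~ w) (Y^~ w)].
  apply: (@history_measurable n (fun x y => ~ Q x y)) => x y x' y' h.
  by rewrite (lQ x y x' y').
exists [set w | ~ Q (X^~ w) (Y^~ w)]; split => //.
pose H := ({ffun 'I_n.+1 -> A} * {ffun 'I_n.+1 -> B})%type.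
pose ex (h : H) t := h.1 (inord t); pose ey (h : H) t := h.2 (inord t).
pose F (h : H) := [set w | agree n (X^~ w) (Y^~ w) (ex h) (ey h) /\ ~ Q (X^~ w) (Y^~ w)].
have mF h : measurable (F h).
  apply: (@history_measurable n (fun x y => agree n x y (ex h) (ey h) /\ ~ Q x y)).
  move=> x y x' y' hh; rewrite (@agree_local n _ _ x y x' y')//.
  by rewrite (lQ x y x' y').
have F0 h : fine (P (F h)) <= 0.
  have [hq|hq] := pselect (Q (ex h) (ey h)).
    rewrite (_ : F h = set0) ?measure0//.
    by rewrite -subset0 => w [h1 h2]; apply: h2; rewrite (lQ _ _ _ _ h1).
  have <- : fine (P [set w | agree n (X^~ w) (Y^~ w) (ex h) (ey h)]) = 0.
    by rewrite /agree law hQ.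
  apply: fine_prob_le => //; last by move=> w [].
  exact: (history_measurable (@agree_local n _ _)).
have : fine (P [set w | ~ Q (X^~ w) (Y^~ w)]) <= 0.
  apply: le_trans (fine_prob_union (F := F) mS mF _) _.
    move=> w hw; exists ([ffun i => X (nat_of_ord i) w], [ffun i => Y (nat_of_ord i) w]).
    split=> //; split=> t ht; rewrite /ex /ey /= ffunE inordK//.
    exact: ltnW.
  by apply: sumr_le0 => h _.
rewrite -lee_fin fineK ?fin_num_measure// => hle.
by apply/eqP; rewrite eq_le hle measure_ge0.
Qed.

(** A cylinder of positive probability cannot lie in the null complement of [E]. *)
Lemma realize n x y E : 0 < pw n x y -> measurable E -> P E = 1%E ->
  exists2 w, E w & agree n (X^~ w) (Y^~ w) x y.
Proof.
move=> h mE PE; apply: contrapT => hn.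
have mC := history_measurable (@agree_local n x y).
have : (P [set w | agree n (X^~ w) (Y^~ w) x y] <= P (~` E))%E.
  apply: le_measure; rewrite ?inE//; first exact: measurableC.
  by move=> w hw Ew; apply: hn; exists w.
by rewrite probability_setC// PE subee// /agree law lee_fin leNgt h.
Qed.

(** The conditional expectation given a history is a finite sum over the next state and policy. The
    inequality is required on all histories, null ones included, so no conditioning is involved. *)
Definition supermartingale (Z : nat -> (nat -> A) -> (nat -> B) -> R) : Prop :=
  forall n x y, \sum_(ab : A * B) step n (put x n.+1 ab.1) (put y n ab.2) *
     Z n.+1 (put x n.+1 ab.1) (put y n ab.2) <= Z n x y.

Lemma pw_ge0 n x y : 0 <= pw n x y.
Proof. by rewrite -lee_fin -law measure_ge0. Qed.

Definition hit (Z : nat -> (nat -> A) -> (nat -> B) -> R) (a : R) n N (x : nat -> A)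
    (y : nat -> B) : Prop :=
  exists m, [/\ (n <= m)%N, (m <= N)%N & a <= Z m x y].

Lemma hit_local Z a n N : (forall m, local m (Z m)) -> local N (hit Z a n N).
Proof.
move=> lZ x y x' y' h; apply/propext; split=> -[m [nm mN hm]]; exists m; split=> //.
  by rewrite -(lZ m x y x' y')//; apply: agreeW h.
by rewrite (lZ m x y x' y')//; apply: agreeW h.
Qed.

Lemma agree_hit_measurable Z a n m N x y : (forall k, local k (Z k)) ->
  measurable [set w | agree n (X^~ w) (Y^~ w) x y /\ hit Z a m N (X^~ w) (Y^~ w)].
Proof.
move=> lZ; apply: (@history_measurable (maxn n N)
  (fun x' y' => agree n x' y' x y /\ hit Z a m N x' y')) => x1 y1 x2 y2 h.
rewrite (@agree_local n x y x1 y1 x2 y2); last by apply: agreeW h; exact: leq_maxl.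
by rewrite (hit_local a m lZ (agreeW _ h))//; exact: leq_maxr.
Qed.

Section Ville.
Variable Z : nat -> (nat -> A) -> (nat -> B) -> R.
Hypothesis Zlocal : forall n, local n (Z n).
Hypothesis Z0 : forall n x y, 0 <= Z n x y.
Hypothesis Zsuper : supermartingale Z.

(* Backward induction on the horizon, splitting a cylinder by its next step. *)
Lemma ville_cylinder a k n x y : 0 < a ->
  Pr [set w | agree n (X^~ w) (Y^~ w) x y /\ hit Z a n (n + k) (X^~ w) (Y^~ w)] * a
  <= pw n x y * Z n x y.
Proof.
move=> a0; elim: k n x y => [|k IH] n x y.
all: have mC : measurable [set w | agree n (X^~ w) (Y^~ w) x y]
  by exact: (history_measurable (@agree_local n x y)).
all: have [aZ|Za] := leP a (Z n x y).
- apply: (@le_trans _ _ (pw n x y * a)); last by rewrite ler_wpM2l ?pw_ge0.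
  rewrite ler_pM2r// (_ : pw n x y = Pr [set w | agree n (X^~ w) (Y^~ w) x y]).
    apply: fine_prob_le => //; last by move=> w [].
    exact: agree_hit_measurable.
  by rewrite /agree law.
- rewrite (_ : [set w | _] = set0) ?measure0 ?mul0r ?mulr_ge0 ?pw_ge0//.
  rewrite -subset0 => w [hw [m [nm mn hm]]].
  have E : m = n by apply/eqP; rewrite eqn_leq nm -[n]addn0 mn.
  by move: hm; rewrite E (Zlocal hw) leNgt Za.
- apply: (@le_trans _ _ (pw n x y * a)); last by rewrite ler_wpM2l ?pw_ge0.
  rewrite ler_pM2r// (_ : pw n x y = Pr [set w | agree n (X^~ w) (Y^~ w) x y]).
    apply: fine_prob_le => //; last by move=> w [].
    exact: agree_hit_measurable.
  by rewrite /agree law.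
pose F (ab : A * B) := [set w |
   agree n.+1 (X^~ w) (Y^~ w) (put x n.+1 ab.1) (put y n ab.2) /\
   hit Z a n.+1 (n.+1 + k) (X^~ w) (Y^~ w)].
apply: (@le_trans _ _ ((\sum_ab Pr (F ab)) * a)).
  rewrite ler_pM2r//; apply: fine_prob_union.
  - exact: agree_hit_measurable.
  - by move=> ab; exact: agree_hit_measurable.
  - move=> w [hw [m [nm mn hm]]]; exists (X n.+1 w, Y n w); split.
      split=> t /=.
        rewrite leq_eqVlt => /orP[/eqP ->|ht]; first by rewrite put_at.
        by rewrite put_lt//; case: hw => h1 _; apply: h1.
      rewrite ltnS leq_eqVlt => /orP[/eqP ->|ht]; first by rewrite put_at.
      by rewrite put_lt//; case: hw => _ h1; apply: h1.
    exists m; split=> //; last by rewrite addSnnS.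
    rewrite ltn_neqAle nm andbT; apply/eqP => E.
    by move: hm; rewrite -E (Zlocal hw) leNgt Za.
rewrite mulr_suml.
apply: (@le_trans _ _ (\sum_ab pw n x y * (step n (put x n.+1 ab.1) (put y n ab.2) *
     Z n.+1 (put x n.+1 ab.1) (put y n ab.2)))).
  apply: ler_sum => ab _; apply: (le_trans (IH _ _ _)).
  by rewrite pwS mulrA (pw_local (agree_sym (agree_put n x y ab.1 ab.2))).
by rewrite -mulr_sumr ler_wpM2l ?pw_ge0//; exact: Zsuper.
Qed.

Lemma ville a N : 0 < a -> (forall x y, Z 0 x y <= 1) ->
  Pr [set w | hit Z a 0 N (X^~ w) (Y^~ w)] <= a^-1.
Proof.
move=> a0 Z1; rewrite -[leRHS]mul1r ler_pdivlMr//.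
(* At time 0 no policy is recorded yet, so [b0] is a mere filler. *)
pose F (s : A) := [set w | agree 0 (X^~ w) (Y^~ w) (fun=> s) (fun=> b0) /\
   hit Z a 0 (0 + N) (X^~ w) (Y^~ w)].
apply: (@le_trans _ _ ((\sum_s Pr (F s)) * a)).
  rewrite ler_pM2r//; apply: fine_prob_union.
  - exact: (history_measurable (hit_local a 0 Zlocal)).
  - by move=> s; exact: agree_hit_measurable.
  - move=> w hw; exists (X 0 w); split=> //; split=> // t.
    by rewrite leqn0 => /eqP ->.
rewrite mulr_suml -pw0; apply: ler_sum => s _.
apply: (le_trans (ville_cylinder _ _ _ _ a0)).
by rewrite ler_piMr ?pw_ge0.
Qed.

End Ville.

(** One inequality for countably many supermartingales: [ville] is applied to finite mixtures with
    the telescoping weights [1 / ((j + 1) (j + 2))]. The bound [M] is random but common to all [j]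
    and [n]. *)
Lemma ville_family (Z : nat -> nat -> (nat -> A) -> (nat -> B) -> R) :
  (forall j n, local n (Z j n)) -> (forall j n x y, 0 <= Z j n x y) ->
  (forall j, supermartingale (Z j)) -> (forall j x y, Z j 0%N x y <= 1) ->
  \forall w \ae P, exists2 M, 1 <= M & forall j n,
    Z j n (X^~ w) (Y^~ w) <= M * (j.+1%:R * j.+2%:R).
Proof.
move=> Zl Z0 Zs Z1.
pose wt (j : nat) : R := (j.+1%:R * j.+2%:R)^-1.
have wt0 j : 0 < wt j by rewrite invr_gt0 mulr_gt0 ?ltr0n.
have wt1 J : \sum_(j < J) wt j <= 1.
  suff -> : \sum_(j < J) wt j = 1 - J.+1%:R^-1 by rewrite gerDl oppr_le0 invr_ge0.
  elim: J => [|J IH]; first by rewrite big_ord0 invr1 subrr.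
  rewrite big_ord_recr/= IH /wt -[J.+2%:R]natr1.
  have x0 : 0 < J.+1%:R :> R by rewrite ltr0n.
  set x := J.+1%:R in x0 *; field.
  by rewrite !gt_eqF//; lra.
pose Mx J n x y := \sum_(j < J) wt j * Z j n x y.
have Mxl J n : local n (Mx J n).
  by move=> x y x' y' h; apply: eq_bigr => j _; rewrite (Zl j n x y x' y').
have Mx0 J n x y : 0 <= Mx J n x y by apply: sumr_ge0 => j _; rewrite mulr_ge0// ltW.
have Mxs J : supermartingale (Mx J).
  move=> n x y; under eq_bigr do rewrite mulr_sumr.
  rewrite exchange_big; apply: ler_sum => j _ /=.
  under eq_bigr do rewrite mulrCA.
  by rewrite -mulr_sumr ler_pM2l//; exact: Zs.
have Mx1 J x y : Mx J 0%N x y <= 1.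
  by apply: le_trans (wt1 J); apply: ler_sum => j _; rewrite ler_piMr// ltW.
(* The horizon and the number of components share the index [J], so the events increase with [J] and
   the bound passes to their union. *)
pose bad m J := [set w | hit (Mx J) m.+1%:R 0 J (X^~ w) (Y^~ w)].
have mbad m J : measurable (bad m J).
  exact: (history_measurable (hit_local m.+1%:R 0 (Mxl J))).
have Pbad m J : (P (bad m J) <= (m.+1%:R^-1)%:E)%E.
  rewrite -[P _]fineK ?fin_num_measure// lee_fin.
  by apply: ville => //; rewrite ?ltr0n.
have nd m : nondecreasing_seq (bad m).
  apply/nondecreasing_seqP => J; apply/subsetPset => w [t [_ tJ ht]].
  exists t; split => //; first exact: leqW.
  apply: (le_trans ht); rewrite /Mx big_ord_recr/= lerDl mulr_ge0//.
  exact: ltW.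
have mBad m : measurable (\bigcup_J bad m J) by exact: bigcupT_measurable.
have PBad m : (P (\bigcup_J bad m J) <= (m.+1%:R^-1)%:E)%E.
  have cv := @nondecreasing_cvg_mu _ _ _ P _ (mbad m) (mBad m) (nd m).
  rewrite -(cvg_lim _ cv)//; apply: lime_le; first by apply: cvgP cv.
  by apply: nearW => J; exact: Pbad.
exists (\bigcap_m \bigcup_J bad m J); split.
- exact: bigcapT_measurable.
- apply/eqP; rewrite eq_le measure_ge0 andbT.
  apply/lee_addgt0Pr => e e0; rewrite add0e.
  pose m := Num.truncn e^-1.
  apply: (@le_trans _ _ (P (\bigcup_J bad m J))).
    apply: le_measure; rewrite ?inE//; first exact: bigcapT_measurable.
    by apply: bigcap_inf.
  apply: (le_trans (PBad m)); rewrite lee_fin -[leRHS]invrK lef_pV2 ?posrE ?invr_gt0//.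
  by apply: ltW; exact: truncnS_gt.
- move=> w /= hw m _; apply: contrapT => hn; apply: hw.
  exists m.+1%:R; first by rewrite ler1n.
  move=> j n; rewrite -ler_pdivrMr ?mulr_gt0 ?ltr0n//.
  rewrite leNgt; apply/negP => hlt; apply: hn.
  exists (maxn j.+1 n) => //; exists n; split=> //; first exact: leq_maxr.
  apply: (le_trans (ltW hlt)); rewrite /Mx.
  have hj : (j < maxn j.+1 n)%N by rewrite leq_max leqnn.
  rewrite (bigD1 (Ordinal hj))//= [in leLHS]mulrC lerDl.
  by apply: sumr_ge0 => i _; rewrite mulr_ge0// ltW.
Qed.

(* The exponential supermartingale with parameter [lam j] is the one that is sharp
   for [W n] between [2 ^ j] and [2 ^ j.+1]. *)
Lemma lil_upper (S : nat -> (nat -> A) -> (nat -> B) -> R)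
    (W : nat -> (nat -> A) -> (nat -> B) -> nat) (D : R) : 0 < D ->
  (forall n, local n (S n)) -> (forall n, local n (W n)) ->
  (forall x y, S 0%N x y = 0) -> (forall x y, W 0%N x y = 0%N) ->
  (forall l n x y, 0 <= l -> l * D <= 2^-1 ->
    \sum_(ab : A * B) step n (put x n.+1 ab.1) (put y n ab.2) *
      expR (l * (S n.+1 (put x n.+1 ab.1) (put y n ab.2) - S n x y)
            - 2 * (l * D) ^+ 2 *
              ((W n.+1 (put x n.+1 ab.1) (put y n ab.2))%:R - (W n x y)%:R)) <= 1) ->
  \forall w \ae P, exists2 C, 0 <= C & forall n,
    S n (X^~ w) (Y^~ w) <= 6 * D * lilrate (W n (X^~ w) (Y^~ w))%:R
      + C * (1 + Num.sqrt (W n (X^~ w) (Y^~ w))%:R).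
Proof.
move=> D0 Sl Wl S0 W0 Hexp.
(* On block [j], [s j ^+ 2] is the size of the iterated logarithm and [t j ^+ 2 = 2 ^ j] that of the
   clock. The ratio [s j / t j] balances the terms of the exponent, and [s j <= t j] keeps it in the
   range allowed for [l]. *)
pose s (j : nat) : R := Num.sqrt (1 + ln j.+1%:R).
pose t (j : nat) : R := Num.sqrt (2 ^ j)%:R.
have lnS0 (j : nat) : 0 <= ln j.+1%:R :> R by rewrite ln_ge0// ler1n.
have sE j : s j ^+ 2 = 1 + ln j.+1%:R by rewrite sqr_sqrtr// addr_ge0.
have tE j : t j ^+ 2 = (2 ^ j)%:R by rewrite sqr_sqrtr.
have s1 j : 1 <= s j by rewrite -[leLHS]sqrtr1 ler_wsqrtr// lerDl.
have t1 j : 1 <= t j by rewrite -[leLHS]sqrtr1 ler_wsqrtr// ler1n expn_gt0.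
have st j : s j <= t j.
  rewrite ler_wsqrtr//; apply: (@le_trans _ _ j.+1%:R).
    by rewrite -[leRHS]natr1 addrC lerD2r -natr1 addrC le_ln1Dx// (lt_le_trans (ltrN10 _)).
  by rewrite ler_nat; exact: ltn_expl.
pose lam j := s j / (2 * D * t j).
have lam0 j : 0 < lam j.
  by have := s1 j; have := t1 j => h1 h2; rewrite divr_gt0 ?mulr_gt0//; lra.
have lamD j : lam j * D = s j / (2 * t j).
  by have := t1 j => h1; rewrite /lam; field; rewrite !gt_eqF//; lra.
have lamD2 j : lam j * D <= 2^-1.
  have := t1 j => h1; rewrite lamD ler_pdivrMr; last by lra.
  by have := st j; lra.
pose Z j n x y := expR (lam j * S n x y - 2 * (lam j * D) ^+ 2 * (W n x y)%:R).
have Zl j n : local n (Z j n).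
  by move=> x y x' y' h; rewrite /Z (Sl n x y x' y')// (Wl n x y x' y').
have Zs j : supermartingale (Z j).
  move=> n x y.
  have -> : Z j n x y = Z j n x y * 1 by rewrite mulr1.
  apply: le_trans (ler_wpM2l (expR_ge0 _) (Hexp (lam j) n x y (ltW (lam0 j)) (lamD2 j))).
  rewrite mulr_sumr; apply: ler_sum => ab _.
  rewrite mulrCA -expRD le_eqVlt; apply/orP; left; apply/eqP.
  by congr (_ * expR _); ring.
have Z1 j x y : Z j 0%N x y <= 1.
  by rewrite /Z S0 W0 !mulr0 subrr expR0.
have := ville_family Zl (fun j n x y => expR_ge0 _) Zs Z1.
apply: filterS => w [M M1 HM].
have lnM0 : 0 <= ln M by exact: ln_ge0.
exists (6 * D + 2 * D * ln M); first by rewrite addr_ge0 ?mulr_ge0//; lra.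
move=> n; move: (HM^~ n); rewrite /Z.
set Sn := S n _ _; set Wn := W n _ _ => {}HM.
set j := trunc_log 2 Wn.
(* The logarithm of the weight [(j + 1) (j + 2)] costs at most [2 * s j ^+ 2]; with the [s j ^+ 2]
   of the quadratic term this gives the 3 that becomes [6 * D]. *)
have h1 : lam j * Sn <= 2 * (lam j * D) ^+ 2 * Wn%:R + ln M + 2 * s j ^+ 2.
  have := HM j; rewrite -[leRHS]lnK; last first.
    by rewrite posrE !mulr_gt0 ?ltr0n//; lra.
  rewrite ler_expR lnM ?posrE ?mulr_gt0 ?ltr0n//; last by lra.
  rewrite lnM ?posrE ?ltr0n// sE.
  have : ln j.+2%:R <= 1 + ln j.+1%:R :> R.
    have h2 : ln 2 <= 1 :> R by have := @le_ln1Dx R 1; rewrite (_ : 1 + 1 = 2); lra.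
    apply: (@le_trans _ _ (ln (2 * j.+1%:R))).
      rewrite ler_ln ?posrE ?mulr_gt0 ?ltr0n// -natrM ler_nat mul2n -addnn.
      by rewrite addSn !addnS !ltnS leq_addr.
    by rewrite lnM ?posrE ?ltr0n// lerD2r.
  lra.
have W2 : Wn%:R <= 2 * t j ^+ 2.
  rewrite tE -natrM ler_nat -expnS; case: (posnP Wn) => [->//|Wp].
  by apply: ltnW; have /andP[] := @trunc_log_bounds 2 Wn isT Wp.
have := s1 j; have := t1 j; set sj := s j in h1 *; set tj := t j in h1 W2 * => tj1 sj1.
have h2 : (lam j * D) ^+ 2 * Wn%:R <= sj ^+ 2 / 2.
  rewrite lamD -/sj -/tj expr_div_n mulrAC ler_pdivrMr; last by rewrite exprn_gt0//; lra.
  have -> : sj ^+ 2 / 2 * (2 * tj) ^+ 2 = sj ^+ 2 * (2 * tj ^+ 2) by field.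
  by rewrite ler_wpM2l ?sqr_ge0.
have h3 : Sn <= (3 * sj ^+ 2 + ln M) / lam j by rewrite ler_pdivlMr// mulrC; lra.
have h4 : (3 * sj ^+ 2 + ln M) / lam j = 6 * D * (sj * tj) + 2 * D * ln M * (tj / sj).
  by rewrite /lam -/sj -/tj; field; rewrite !gt_eqF//; lra.
have h5 : tj / sj <= tj by rewrite ler_pdivrMr; nra.
have DM : 0 <= 2 * D * ln M by rewrite !mulr_ge0//; lra.
have h6 : Sn <= 6 * D * (sj * tj) + 2 * D * ln M * tj.
  by apply: (le_trans h3); rewrite h4 lerD2l ler_wpM2l.
apply: (le_trans h6).
have l0 := lilrate_ge0 (Wn%:R : R).
(* [trunc_log] is 0 at 0, so an empty clock falls in block 0; there the constant [C] pays for the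
   [6 * D]. *)
case: (posnP Wn) => [Wn0|Wp].
  have -> : sj = 1 by rewrite /sj /s /j Wn0 /= ln1 addr0 sqrtr1.
  have -> : tj = 1 by rewrite /tj /t /j Wn0 /= sqrtr1.
  rewrite {2}Wn0 sqrtr0; nra.
have /andP[jW _] := @trunc_log_bounds 2 Wn isT Wp.
have h7 : tj <= Num.sqrt Wn%:R by rewrite ler_wsqrtr// ler_nat.
have ln2 := @ln2_ge_half R.
have h8 : j%:R <= 2 * ln (1 + Wn%:R) :> R.
  have : j%:R * ln 2 <= ln (1 + Wn%:R) :> R.
    have W0' := ler0n R Wn.
    have pj : 0 < 2 ^+ j :> R by rewrite exprn_gt0.
    have W1 : 0 < 1 + Wn%:R :> R by lra.
    rewrite mulrC mulr_natr -lnXn// ler_ln ?posrE//.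
    by rewrite -natrX; apply: (@le_trans _ _ Wn%:R); [rewrite ler_nat|lra].
  have := ler0n R j; nra.
have h9 : sj ^+ 2 <= loglog Wn%:R.
  rewrite sE /loglog lerD2l ler_ln ?posrE ?ltr0n//; last by have := ler0n R j; lra.
  by rewrite -natr1 addrC lerD2l.
have h10 : sj * tj <= lilrate Wn%:R.
  rewrite /lilrate sqrtrM// mulrC ler_pM//; try lra.
  rewrite -[leLHS]ger0_norm -?sqrtr_sqr ?ler_wsqrtr//; lra.
have s0 : 0 <= Num.sqrt Wn%:R :> R by exact: sqrtr_ge0.
have h11 : 6 * D * (sj * tj) <= 6 * D * lilrate Wn%:R by rewrite ler_wpM2l//; lra.
have h12 : 2 * D * ln M * tj <= 2 * D * ln M * Num.sqrt Wn%:R by rewrite ler_wpM2l.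
have h13 : 0 <= 6 * D * (1 + Num.sqrt Wn%:R) by rewrite !mulr_ge0//; lra.
lra.
Qed.

(** The additive form used for the run: increments [f], and a clock that advances only at the times
    where [a] holds. *)
Lemma lil_sum (f : nat -> (nat -> A) -> (nat -> B) -> R)
    (a : nat -> (nat -> A) -> (nat -> B) -> bool) (D : R) : 0 < D ->
  (forall n, local n.+1 (f n)) -> (forall n, local n.+1 (a n)) ->
  (forall l n x y, 0 <= l -> l * D <= 2^-1 ->
    \sum_(ab : A * B) step n (put x n.+1 ab.1) (put y n ab.2) *
      expR (l * f n (put x n.+1 ab.1) (put y n ab.2)
            - 2 * (l * D) ^+ 2 * (a n (put x n.+1 ab.1) (put y n ab.2))%:R) <= 1) ->
  \forall w \ae P, exists2 C, 0 <= C & forall n,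
    \sum_(t < n) f t (X^~ w) (Y^~ w) <=
      6 * D * lilrate (\sum_(t < n) a t (X^~ w) (Y^~ w))%:R
      + C * (1 + Num.sqrt (\sum_(t < n) a t (X^~ w) (Y^~ w))%:R).
Proof.
move=> D0 fl al Hexp.
have sl (T : Type) (idx : T) op (F : nat -> (nat -> A) -> (nat -> B) -> T) :
    (forall n, local n.+1 (F n)) ->
    forall n, local n (fun x y => \big[op/idx]_(t < n) F t x y).
  move=> hF n x y x' y' h; apply: eq_bigr => t _; apply: hF.
  by apply: agreeW h.
have al' : forall n, local n.+1 (fun x y => nat_of_bool (a n x y)).
  by move=> m x1 y1 x2 y2 hh; rewrite (al m _ _ _ _ hh).
have Hl : forall l n x y, 0 <= l -> l * D <= 2^-1 ->
    \sum_(ab : A * B) step n (put x n.+1 ab.1) (put y n ab.2) *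
      expR (l * (\sum_(t < n.+1) f t (put x n.+1 ab.1) (put y n ab.2) - \sum_(t < n) f t x y)
            - 2 * (l * D) ^+ 2 *
              ((\sum_(t < n.+1) a t (put x n.+1 ab.1) (put y n ab.2))%:R -
               (\sum_(t < n) a t x y)%:R)) <= 1.
  move=> l n x y l0 lD; apply: le_trans (Hexp l n x y l0 lD); apply: ler_sum => ab _.
  have h := agree_put n x y ab.1 ab.2.
  have E1 : \sum_(t < n.+1) f t (put x n.+1 ab.1) (put y n ab.2) - \sum_(t < n) f t x y
      = f n (put x n.+1 ab.1) (put y n ab.2).
    by rewrite big_ord_recr /= -(sl _ _ _ f fl n _ _ _ _ h) addrAC subrr add0r.
  have E2 : (\sum_(t < n.+1) a t (put x n.+1 ab.1) (put y n ab.2))%:R -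
      (\sum_(t < n) a t x y)%:R = (a n (put x n.+1 ab.1) (put y n ab.2))%:R :> R.
    by rewrite big_ord_recr /= natrD -(sl _ _ _ _ al' n _ _ _ _ h) addrAC subrr add0r.
  by rewrite E1 E2.
exact: (lil_upper (S := fun n x y => \sum_(t < n) f t x y)
  (W := fun n x y => (\sum_(t < n) a t x y)%N) D0 (sl _ _ _ f fl) (sl _ _ _ _ al')
  (fun x y => big_ord0 _ _ _ _) (fun x y => big_ord0 _ _ _ _) Hl).
Qed.

End Process.

(** Quadratic bound of the exponential under a nonpositive mean. The total weight may be below 1,
    because the selection weights at an epoch start sum to 0 on a history of zero evidence. *)
Lemma exp_moment {R : realType} (I : finType) (w d : I -> R) (l D : R) :
  (forall i, 0 <= w i) -> \sum_i w i <= 1 -> \sum_i w i * d i <= 0 ->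
  (forall i, `|d i| <= D) -> 0 <= l -> l * D <= 2^-1 ->
  \sum_i w i * expR (l * d i) <= expR (2 * (l * D) ^+ 2).
Proof.
move=> w0 w1 wd dD l0 lD.
apply: (@le_trans _ _ (1 + 2 * (l * D) ^+ 2)); last exact: expR_ge1Dx.
have le1 i : w i * expR (l * d i) <= w i + l * (w i * d i) + w i * (2 * (l * D) ^+ 2).
  have ld : `|l * d i| <= l * D by rewrite normrM ger0_norm// ler_wpM2l.
  have h := @expR_le_quad R (l * d i) (le_trans (ler_norm _) (le_trans ld lD)).
  have h2 : (l * d i) ^+ 2 <= (l * D) ^+ 2.
    rewrite -[leLHS]real_normK ?num_real// ler_pXn2r ?nnegrE//.
    by apply: le_trans ld.
  have := w0 i; nra.
apply: (le_trans (ler_sum _ (fun i _ => le1 i))).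
rewrite !big_split /= -mulr_sumr -mulr_suml.
have D2 : 0 <= (l * D) ^+ 2 by exact: sqr_ge0.
nra.
Qed.

(** * Posterior probabilities and assumption (A4) *)

Section Posterior.
Context {R : realType} {St Ac : finType} {dT : measure_display} {Theta : measurableType dT}.
Variables (pi : probability Theta R) (p : Theta -> tkernel R St Ac) (thstar : Theta).
Variables (s0 : St) (cOPT : Theta -> policy St Ac).
Hypothesis Hker : forall th, is_kernel (p th).
Hypothesis Hpmeas : forall s1 a s2, measurable_fun setT (fun th => p th s1 a s2).
Hypothesis HcOPTm : forall c, measurable (cOPT @^-1` [set c]).
Variables (Gam : R) (N : set Theta).
Hypothesis Gam0 : 0 <= Gam.
Hypothesis Nm : measurable N.
Hypothesis N0 : pi N = 0%E.
Hypothesis HN : forall th, ~ N th -> forall s1 a s2,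
  ((p thstar s1 a s2 == 0) = (p th s1 a s2 == 0)) /\
  (0 < p thstar s1 a s2 -> `|ln (p thstar s1 a s2 / p th s1 a s2)| <= Gam).
Implicit Types (ss : nat -> St) (cs : nat -> policy St Ac) (t T : nat).
Local Notation S c := (cOPT @^-1` [set c]).
Local Notation pr A := (fine (pi A)).

Definition evidence ss cs t (A : set Theta) : R :=
  fine (\int[pi]_(th in A) (lik p ss cs t th)%:E)%E.

Lemma postE ss cs t A : post pi p ss cs t A = evidence ss cs t A / evidence ss cs t setT.
Proof. by []. Qed.

Lemma lik_ge0 ss cs t th : 0 <= lik p ss cs t th.
Proof. by apply: prodr_ge0 => i _; case: (Hker th (ss i) (cs i (ss i))). Qed.

Lemma kernel_le1 th s a s' : p th s a s' <= 1.
Proof.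
have [h0 h1] := Hker th s a.
by rewrite -h1 (bigD1 s')//= lerDl; apply: sumr_ge0.
Qed.

Lemma lik_le1 ss cs t th : lik p ss cs t th <= 1.
Proof.
apply: prodr_ile1 => i _; rewrite kernel_le1 andbT.
by case: (Hker th (ss i) (cs i (ss i))).
Qed.

Lemma lik_measurable ss cs t : measurable_fun setT (lik p ss cs t).
Proof. by apply: measurable_prod => i _; exact: Hpmeas. Qed.

Lemma elik_measurable ss cs t A : measurable A ->
  measurable_fun A (EFin \o lik p ss cs t).
Proof.
move=> mA; apply: (@measurable_funS _ _ _ _ setT) => //.
by apply/measurable_EFinP; exact: lik_measurable.
Qed.

Lemma evidence_fin ss cs t A : measurable A ->
  (evidence ss cs t A)%:E = (\int[pi]_(th in A) (lik p ss cs t th)%:E)%E.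
Proof.
move=> mA; rewrite fineK// ge0_fin_numE; last first.
  by apply: integral_ge0 => th _; rewrite lee_fin lik_ge0.
apply: (@le_lt_trans _ _ (\int[pi]_(th in A) 1%:E)%E); last first.
  by rewrite integral_cst// mul1e (le_lt_trans (probability_le1 pi mA)) ?ltry.
apply: ge0_le_integral => //.
- by move=> th _; rewrite lee_fin lik_ge0.
- exact: elik_measurable.
- by move=> th _; rewrite lee_fin lik_le1.
Qed.

Lemma evidence_ge0 ss cs t A : 0 <= evidence ss cs t A.
Proof. by apply: fine_ge0; apply: integral_ge0 => th _; rewrite lee_fin lik_ge0. Qed.

Lemma prK A : measurable A -> (pr A)%:E = pi A.
Proof. by move=> mA; rewrite fineK// fin_num_measure. Qed.

Lemma pr_le1 A : measurable A -> pr A <= 1.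
Proof. by move=> mA; rewrite -lee_fin prK// probability_le1. Qed.

(** Likelihoods are compared only off the null set [N], where (A2) is available; the integrals do
    not see the rest. *)
Lemma evidence_le_ae ss cs t ss' cs' t' A (b : R) : measurable A -> 0 <= b ->
  (forall th, A th -> ~ N th -> lik p ss cs t th <= b * lik p ss' cs' t' th) ->
  evidence ss cs t A <= b * evidence ss' cs' t' A.
Proof.
move=> mA b0 h; rewrite -lee_fin EFinM !evidence_fin//.
rewrite -ge0_integralZl//; last 2 first.
- exact: elik_measurable.
- by move=> th _; rewrite lee_fin lik_ge0.
apply: ae_ge0_le_integral => //.
- by move=> th _; rewrite lee_fin lik_ge0.
- exact: elik_measurable.
- by move=> th _; rewrite mule_ge0// lee_fin// lik_ge0.
- by apply: measurable_funeM; exact: elik_measurable.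
exists N; split => // th /= hn; apply: contrapT => nN; apply: hn => Ath.
by rewrite -EFinM lee_fin; exact: h.
Qed.

Lemma evidence0 ss cs A : measurable A -> evidence ss cs 0 A = pr A.
Proof.
move=> mA; rewrite /evidence (_ : (fun th => _) = cst 1%:E).
  by rewrite integral_cst// mul1e.
by apply/funext => th; rewrite /lik big_ord0.
Qed.

Lemma evidence_le ss cs t A (b : R) : measurable A -> 0 <= b ->
  (forall th, A th -> ~ N th -> lik p ss cs t th <= b) -> evidence ss cs t A <= b * pr A.
Proof.
move=> mA b0 h; rewrite -(evidence0 ss cs mA); apply: evidence_le_ae => // th Ath nN.
by rewrite [X in _ * X]/lik big_ord0 mulr1; exact: h.
Qed.

Lemma evidence_ge ss cs t A (b : R) : measurable A -> 0 < b ->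
  (forall th, A th -> ~ N th -> b <= lik p ss cs t th) -> b * pr A <= evidence ss cs t A.
Proof.
move=> mA b0 h; rewrite -(evidence0 ss cs mA) mulrC -ler_pdivlMr// mulrC.
apply: evidence_le_ae; rewrite ?invr_ge0 ?ltW// => th Ath nN.
by rewrite [leLHS]/lik big_ord0 ler_pdivlMl// mulr1; exact: h.
Qed.

Lemma evidence_mono ss cs t A A' : measurable A -> measurable A' -> A `<=` A' ->
  evidence ss cs t A <= evidence ss cs t A'.
Proof.
move=> mA mA' h; rewrite -lee_fin !evidence_fin//.
apply: ge0_subset_integral => //; first exact: elik_measurable.
by move=> th _; rewrite lee_fin lik_ge0.
Qed.

Lemma evidence_policies ss cs t :
  \sum_c evidence ss cs t (S c) = evidence ss cs t setT.
Proof.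
apply: EFin_inj; rewrite evidence_fin// -sumEFin.
rewrite (eq_bigr (fun c => \int[pi]_(th in S c) (lik p ss cs t th)%:E)%E); last first.
  by move=> c _; rewrite evidence_fin.
have E : \big[setU/set0]_(c <- index_enum (policy St Ac)) S c = setT.
  rewrite -subTset => th _; rewrite -bigcup_seq; exists (cOPT th) => //=.
  exact: mem_index_enum.
rewrite -[in RHS]E ge0_integral_bigsetU ?index_enum_uniq//.
- by move=> c c' _ _ [th [/= <- <-]].
- by rewrite E; exact: elik_measurable.
- by move=> th _; rewrite lee_fin lik_ge0.
Qed.

Lemma post_ge0 ss cs t A : 0 <= post pi p ss cs t A.
Proof. by rewrite postE divr_ge0 ?evidence_ge0. Qed.

Lemma post_sum ss cs t : \sum_c post pi p ss cs t (S c) = (evidence ss cs t setT != 0)%:R.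
Proof.
under eq_bigr do rewrite postE.
rewrite -mulr_suml evidence_policies; case: eqVneq => [->|h]; first by rewrite mul0r.
by rewrite divff.
Qed.

Lemma post_le1 ss cs t A : measurable A -> post pi p ss cs t A <= 1.
Proof.
move=> mA; rewrite postE.
have := evidence_ge0 ss cs t setT; rewrite le_eqVlt => /orP[/eqP <-|h].
  by rewrite invr0 mulr0 ler01.
by rewrite ler_pdivrMr// mul1r; exact: evidence_mono.
Qed.

Definition ell c s s' th : R := ln (p thstar s (c s) s' / p th s (c s) s').

Lemma ell_bound (c : policy St Ac) s s' th : ~ N th -> `|ell c s s' th| <= Gam.
Proof.
move=> nN; have [h1 h2] := HN nN s (c s) s'.
have [h|h] := eqVneq (p thstar s (c s) s') 0.
  by rewrite /ell h mul0r ln0// normr0.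
apply: h2; rewrite lt_def h /=; by case: (Hker thstar s (c s)).
Qed.

Lemma kernel_ell (c : policy St Ac) s s' th : ~ N th -> 0 < p thstar s (c s) s' ->
  p th s (c s) s' = p thstar s (c s) s' * expR (- ell c s s' th).
Proof.
move=> nN h; have [h1 _] := HN nN s (c s) s'.
have q0 : 0 < p th s (c s) s'.
  rewrite lt_def -h1 gt_eqF//=; by case: (Hker th s (c s)).
by rewrite expRN lnK ?posrE ?divr_gt0// invf_div mulrC divfK// gt_eqF.
Qed.

Definition pos_path T ss cs : Prop :=
  forall t, (t < T)%N -> 0 < p thstar (ss t) (cs t (ss t)) (ss t.+1).

Lemma lik_star_gt0 T ss cs : pos_path T ss cs -> 0 < lik p ss cs T thstar.
Proof. by move=> h; apply: prodr_gt0 => i _; exact: h. Qed.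

Lemma lik_ell T ss cs th : ~ N th -> pos_path T ss cs ->
  lik p ss cs T th = lik p ss cs T thstar *
    expR (- \sum_(t < T) ell (cs t) (ss t) (ss t.+1) th).
Proof.
move=> nN h; rewrite -sumrN /lik.
elim: T h => [|T IH] h; first by rewrite !big_ord0 expR0 mulr1.
rewrite !big_ord_recr /= IH; last by move=> t hT; apply: h; exact: ltnW.
by rewrite expRD (kernel_ell nN (h T (ltnSn _))); ring.
Qed.

Lemma path_sum_counts T ss cs (F : policy St Ac -> St -> St -> R) :
  \sum_(t < T) F (cs t) (ss t) (ss t.+1) =
  \sum_c \sum_s \sum_s' (Jc ss cs T c s s')%:R * F c s s'.
Proof.
have E c s s' : (Jc ss cs T c s s')%:R * F c s s' =
    \sum_(t < T) if [&& cs t == c, ss t == s & ss t.+1 == s'] then F c s s' else 0.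
  by rewrite /Jc sum1_card mulr_natl -sumr_const big_mkcond.
under [RHS]eq_bigr => c _ do under eq_bigr => s _ do
  (under eq_bigr => s' _ do rewrite E; rewrite exchange_big /=).
under [RHS]eq_bigr => c _ do rewrite exchange_big /=.
rewrite exchange_big /=; apply: eq_bigr => t _.
rewrite (bigD1 (cs t))//= [X in _ + X]big1 ?addr0; last first.
  by move=> c /negPf h; rewrite big1// => s _; rewrite big1// => s' _; rewrite eq_sym h.
rewrite (bigD1 (ss t))//= [X in _ + X]big1 ?addr0; last first.
  by move=> s /negPf h; rewrite big1// => s' _; rewrite [ss t == s]eq_sym h andbF.
rewrite (bigD1 (ss t.+1))//= [X in _ + X]big1 ?addr0; last first.
  by move=> s' /negPf h; rewrite [ss t.+1 == s']eq_sym h !andbF.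
by rewrite !eqxx.
Qed.

Definition usable c : Prop := (0 < pi (S c))%E.

(** A null set cannot contain a preimage of positive mass. This turns almost sure assumptions on
    [th] into statements about usable policies. *)
Lemma usable_good c : usable c -> exists2 th, cOPT th = c & ~ N th.
Proof.
move=> h; apply: contrapT => hn; move: h; rewrite /usable.
suff -> : pi (S c) = 0%E by rewrite ltxx.
apply: (subset_measure0 (B := N)) => // th /= hth; apply: contrapT => nN.
by apply: hn; exists th.
Qed.

(** Exactly the histories of positive probability, by [path_prob_gt0] and [path_prob_eq0]. *)
Definition feasible T ss cs : Prop :=
  ss 0%N = s0 /\ forall t, (t < T)%N ->
    0 < p thstar (ss t) (cs t (ss t)) (ss t.+1) /\
    (if isStart ss s0 t then usable (cs t) else cs t = cs t.-1).

Lemma feasible_pos T ss cs : feasible T ss cs -> pos_path T ss cs.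
Proof. by move=> [_ h] t /h[]. Qed.

Lemma evidence_gt0 T ss cs A : pos_path T ss cs -> measurable A -> (0 < pi A)%E ->
  0 < evidence ss cs T A.
Proof.
move=> pp mA A0.
have b0 : 0 < lik p ss cs T thstar * expR (- (T%:R * Gam)).
  by rewrite mulr_gt0 ?expR_gt0 ?lik_star_gt0.
apply: lt_le_trans (evidence_ge mA b0 _).
  by rewrite mulr_gt0// -lte_fin prK.
move=> th Ath nN; rewrite (lik_ell nN pp) ler_wpM2l ?lik_ge0//.
rewrite ler_expR lerN2; apply: (le_trans (ler_norm _)).
apply: (le_trans (ler_norm_sum _ _ _)).
apply: (@le_trans _ _ (\sum_(t < T) Gam)); last by rewrite sumr_const card_ord mulr_natl.
by apply: ler_sum => t _; exact: ell_bound.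
Qed.

Lemma post_gt0 T ss cs A : pos_path T ss cs -> measurable A -> (0 < pi A)%E ->
  0 < post pi p ss cs T A.
Proof.
move=> pp mA A0; rewrite postE divr_gt0// evidence_gt0//.
by rewrite probability_setT lte_fin.
Qed.

Lemma evidenceT_gt0 T ss cs : pos_path T ss cs -> 0 < evidence ss cs T setT.
Proof. by move=> pp; rewrite evidence_gt0// probability_setT lte_fin. Qed.

Lemma path_prob_gt0 T ss cs : feasible T ss cs ->
  0 < path_prob pi p thstar s0 cOPT ss cs T.
Proof.
move=> [h0 h]; rewrite /path_prob h0 eqxx mul1r; apply: prodr_gt0 => t _.
have [h1 h2] := h t (ltn_ord t).
rewrite mulr_gt0//; move: h2; case: ifP => _ h2; last by rewrite h2 eqxx.
apply: post_gt0 => // u hu; case: (h u) => //; exact: ltn_trans hu _.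
Qed.

Lemma path_prob_eq0 T ss cs : ~ feasible T ss cs ->
  path_prob pi p thstar s0 cOPT ss cs T = 0.
Proof.
move=> nf; apply/eqP; apply: contrapT => /negP hn; apply: nf.
move: hn; rewrite /path_prob mulf_eq0 negb_or => /andP[h0 hp].
split; first by apply/eqP; apply: contraNT h0 => /negPf ->.
move=> t hT.
have ht : ((if isStart ss s0 t then post pi p ss cs t (S (cs t))
      else (cs t == cs t.-1)%:R) * p thstar (ss t) (cs t (ss t)) (ss t.+1)) != 0.
  by move/prodf_neq0 : hp => /(_ (Ordinal hT) isT).
move: ht; rewrite mulf_eq0 negb_or => /andP[h1 h2]; split.
  by rewrite lt_def h2 /=; case: (Hker thstar (ss t) (cs t (ss t))).
move: h1; case: ifP => _ h1; last by apply/eqP; apply: contraNT h1 => /negPf ->.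
rewrite /usable lt_def measure_ge0 andbT; apply: contraNN h1 => /eqP h.
have : evidence ss cs t (S (cs t)) <= 0.
  have := @evidence_le ss cs t (S (cs t)) 1 (HcOPTm _) ler01
    (fun th _ _ => lik_le1 ss cs t th).
  by rewrite h mulr0.
move=> hle; rewrite postE; have -> : evidence ss cs t (S (cs t)) = 0.
  by apply/eqP; rewrite eq_le hle evidence_ge0.
by rewrite mul0r.
Qed.

Lemma feasible_used T ss cs c : feasible T ss cs -> (0 < Nc ss cs s0 T c)%N -> usable c.
Proof.
move=> [_ hf]; rewrite /Nc sum1_card => /card_gt0P[t].
rewrite unfold_in => /andP[hs /eqP <-].
by have [_] := hf t (ltn_ord t); rewrite hs.
Qed.

(** * Prolonging a history by whole cycles *)

Definition join {T : Type} (f g : nat -> T) n : nat -> T :=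
  fun t => if (t < n)%N then f t else g (t - n)%N.

Lemma join_lt {T : Type} (f g : nat -> T) n t : (t < n)%N -> join f g n t = f t.
Proof. by rewrite /join => ->. Qed.

Lemma join_add {T : Type} (f g : nat -> T) n i : join f g n (n + i) = g i.
Proof. by rewrite /join ltnNge leq_addr /= addnC addnK. Qed.

Lemma join_le {T : Type} (f g : nat -> T) n t : f n = g 0%N -> (t <= n)%N ->
  join f g n t = f t.
Proof.
move=> fg; rewrite leq_eqVlt => /orP[/eqP ->|]; last exact: join_lt.
by rewrite -{2}[n]addn0 join_add fg.
Qed.

Lemma lik_join T L ss cs y (d : nat -> policy St Ac) th : ss T = y 0%N ->
  lik p (join ss y T) (join cs d T) (T + L) th = lik p ss cs T th * lik p y d L th.
Proof.
move=> hy; rewrite /lik big_split_ord /=; congr (_ * _); apply: eq_bigr => i _ /=.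
  rewrite !(@join_le _ ss)//; last exact: ltnW.
  by rewrite join_lt.
by rewrite -addnS !join_add.
Qed.

Lemma Jc_join T L ss cs y (d : nat -> policy St Ac) c a b : ss T = y 0%N ->
  Jc (join ss y T) (join cs d T) (T + L) c a b = (Jc ss cs T c a b + Jc y d L c a b)%N.
Proof.
move=> hy; rewrite /Jc big_mkcond big_split_ord /= -!big_mkcond /=.
congr (_ + _)%N; apply: eq_bigl => i /=.
  rewrite !(@join_le _ ss)//; last exact: ltnW.
  by rewrite join_lt.
by rewrite -addnS !join_add.
Qed.

Lemma Nc_join T L ss cs y (d : nat -> policy St Ac) c : ss T = y 0%N -> y 0%N = s0 ->
  Nc (join ss y T) (join cs d T) s0 (T + L) c = (Nc ss cs s0 T c + Nc y d s0 L c)%N.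
Proof.
move=> hy y0; rewrite /Nc big_mkcond big_split_ord /= -!big_mkcond /=.
congr (_ + _)%N; apply: eq_bigl => i /=; rewrite /isStart.
  by rewrite (@join_le _ ss) ?join_lt//; exact: ltnW.
rewrite !join_add; case: (nat_of_ord i) => [|k]; first by rewrite y0 eqxx !orbT.
by rewrite addnS.
Qed.

(** By (A2) each appended transition changes the likelihood, relative to that at [thstar], by a
    factor between [expR (- Gam)] and [expR Gam]; numerator and denominator together give the
    exponent [2 * (L%:R * Gam)] of [post_join]. *)
Lemma evidence_join T L ss cs y (d : nat -> policy St Ac) A : ss T = y 0%N ->
  pos_path L y d -> measurable A ->
  lik p y d L thstar * expR (- (L%:R * Gam)) * evidence ss cs T A <=
    evidence (join ss y T) (join cs d T) (T + L) A <=
  lik p y d L thstar * expR (L%:R * Gam) * evidence ss cs T A.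
Proof.
move=> hy pp mA; have l0 := lik_star_gt0 pp.
have hell th : ~ N th -> `|\sum_(t < L) ell (d t) (y t) (y t.+1) th| <= L%:R * Gam.
  move=> nN; apply: (le_trans (ler_norm_sum _ _ _)).
  apply: (@le_trans _ _ (\sum_(t < L) Gam)); last by rewrite sumr_const card_ord mulr_natl.
  by apply: ler_sum => t _; exact: ell_bound.
apply/andP; split.
  rewrite mulrC -ler_pdivlMr ?mulr_gt0 ?expR_gt0// mulrC.
  apply: evidence_le_ae => //; first by rewrite invr_ge0 mulr_ge0 ?expR_ge0 ?lik_ge0.
  move=> th _ nN; rewrite lik_join// ler_pdivlMl ?mulr_gt0 ?expR_gt0//.
  rewrite (lik_ell nN pp) mulrC ler_wpM2l ?lik_ge0// ler_wpM2l ?lik_ge0//.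
  by rewrite ler_expR lerN2; apply: le_trans (ler_norm _) (hell _ nN).
apply: evidence_le_ae => //; first by rewrite mulr_ge0 ?expR_ge0 ?lik_ge0.
move=> th _ nN; rewrite lik_join// (lik_ell nN pp) mulrC.
rewrite ler_wpM2r ?lik_ge0// ler_wpM2l ?lik_ge0// ler_expR.
by apply: le_trans (hell _ nN); rewrite -normrN ler_norm.
Qed.

Lemma post_join T L ss cs y (d : nat -> policy St Ac) A : ss T = y 0%N ->
  pos_path T ss cs -> pos_path L y d -> measurable A ->
  post pi p (join ss y T) (join cs d T) (T + L) A <=
    expR (2 * (L%:R * Gam)) * post pi p ss cs T A.
Proof.
move=> hy pp0 pp mA.
have /andP[_ h1] := evidence_join cs hy pp mA.
have /andP[h2 _] := evidence_join cs hy pp measurableT.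
have l0 := lik_star_gt0 pp.
have e0 := evidenceT_gt0 pp0.
have h3 : 0 < lik p y d L thstar * expR (- (L%:R * Gam)) * evidence ss cs T setT.
  by rewrite !mulr_gt0 ?expR_gt0.
rewrite !postE ler_pdivrMr; last exact: lt_le_trans h2.
apply: (le_trans h1).
set E := evidence ss cs T setT in e0 h2 h3 *; set l := lik _ _ _ _ _ in l0 h1 h2 h3 *.
have -> : l * expR (L%:R * Gam) * evidence ss cs T A =
   expR (2 * (L%:R * Gam)) * (evidence ss cs T A / E) * (l * expR (- (L%:R * Gam)) * E).
  rewrite (_ : 2 * (L%:R * Gam) = L%:R * Gam + L%:R * Gam) ?expRD ?expRN; last by ring.
  by field; rewrite !gt_eqF ?expR_gt0.
by rewrite ler_wpM2l// mulr_ge0 ?expR_ge0// divr_ge0 ?evidence_ge0.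
Qed.

Hypothesis Hrec : forall c, usable c -> recurrent (p thstar) c s0.

(** [L] depends on [c] alone: the same positive path from [s0] to [s0], avoiding [s0] in between, is
    appended to every history and forms exactly one more epoch. *)
Lemma append_cycle c : usable c -> exists L : nat, forall T ss cs,
  feasible T ss cs -> ss T = s0 -> exists T' ss' cs',
  [/\ feasible T' ss' cs', ss' T' = s0,
     forall c', Nc ss' cs' s0 T' c' = (Nc ss cs s0 T c' + (c == c'))%N,
     forall c' a b, (Jc ss cs T c' a b <= Jc ss' cs' T' c' a b <= Jc ss cs T c' a b + L)%N &
     forall A, measurable A ->
       post pi p ss' cs' T' A <= expR (2 * (L%:R * Gam)) * post pi p ss cs T A].
Proof.
move=> uc; have [n [y [y0 yn yp ys]]] := return_path (Hker thstar) (Hrec uc).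
exists n.+1 => T ss cs hf hT.
have hy : ss T = y 0%N by rewrite hT y0.
have ppy : pos_path n.+1 y (fun=> c) by move=> t; rewrite ltnS; exact: yp.
exists (T + n.+1)%N, (join ss y T), (join cs (fun=> c) T); split.
- case: (hf) => h0 h; split; first by rewrite join_le.
  move=> t; have [tT|Tt] := ltnP t T.
    move=> _; have [h1 h2] := h t tT.
    rewrite !(@join_le _ ss)//; last exact: ltnW.
    rewrite !join_lt//; last exact: leq_ltn_trans (leq_pred _) tT.
    by split=> //; rewrite /isStart join_le//; exact: ltnW.
  rewrite -(subnKC Tt); set i := (t - T)%N; rewrite ltn_add2l => hi.
  rewrite -addnS !join_add; split; first exact: ppy.
  case: (posnP i) => [->|i0].
    by rewrite addn0 /isStart join_le// hT eqxx orbT.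
  rewrite /isStart join_add (negPf (ys i _)); last by rewrite i0.
  rewrite addn_eq0 (gtn_eqF i0) andbF /=.
  by rewrite -(prednK i0) addnS /= join_add.
- by rewrite join_add.
- move=> c'; rewrite Nc_join//; congr (_ + _)%N.
  rewrite /Nc big_mkcond big_ord_recl /= {1}/isStart /= big1 ?addn0.
    by case: (c == c').
  move=> i _; rewrite /bump /= /isStart /= (negPf (ys _ _))//.
  by rewrite add1n /= ltn_ord.
- move=> c' a b; rewrite Jc_join// leq_addr leq_add2l.
  by rewrite /Jc sum1_card (leq_trans (max_card _))// card_ord.
- by move=> A mA; apply: post_join => //; exact: feasible_pos hf.
Qed.

Lemma append_cycles (l : seq (policy St Ac)) : (forall c, c \in l -> usable c) ->
  exists L : nat, forall T ss cs,
  feasible T ss cs -> ss T = s0 -> exists T' ss' cs',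
  [/\ feasible T' ss' cs', ss' T' = s0,
     forall c', Nc ss' cs' s0 T' c' = (Nc ss cs s0 T c' + count_mem c' l)%N,
     forall c' a b, (Jc ss cs T c' a b <= Jc ss' cs' T' c' a b <= Jc ss cs T c' a b + L)%N &
     forall A, measurable A ->
       post pi p ss' cs' T' A <= expR (2 * (L%:R * Gam)) * post pi p ss cs T A].
Proof.
elim: l => [|c l IH] hl.
  exists 0%N => T ss cs hf hT; exists T, ss, cs; split=> //.
  - by move=> c'; rewrite addn0.
  - by move=> c' a b; rewrite leqnn addn0 leqnn.
  - by move=> A mA; rewrite mul0r mulr0 expR0 mul1r.
have [|L1 h1] := append_cycle (c := c); first by apply: hl; rewrite mem_head.
have [|L2 h2] := IH; first by move=> c' hc; apply: hl; rewrite in_cons hc orbT.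
exists (L1 + L2)%N => T ss cs hf hT.
have [T1 [x1 [y1 [f1 s1 n1 j1 p1]]]] := h1 T ss cs hf hT.
have [T2 [x2 [y2 [f2 s2 n2 j2 p2]]]] := h2 T1 x1 y1 f1 s1.
exists T2, x2, y2; split=> //.
- by move=> c'; rewrite n2 n1 /= addnA.
- move=> c' a b; have /andP[a1 a2] := j1 c' a b; have /andP[b1 b2] := j2 c' a b.
  rewrite (leq_trans a1 b1) /= addnA; apply: (leq_trans b2).
  by rewrite leq_add2r.
- move=> A mA; apply: (le_trans (p2 A mA)).
  have -> : 2 * ((L1 + L2)%:R * Gam) = 2 * (L2%:R * Gam) + 2 * (L1%:R * Gam).
    by rewrite natrD; ring.
  by rewrite expRD -mulrA ler_wpM2l ?expR_ge0// p1.
Qed.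

Variables (Cset : {set policy St Ac}) (cstar : policy St Ac).
Local Notation v c := (visits (p thstar) c s0).

Lemma mean_return_stat_pair c s s' : usable c ->
  mean_return (p thstar) c s0 * stat_pair (p thstar) c s0 s s' =
    v c s * p thstar s (c s) s'.
Proof.
move=> uc; have hr := Hrec uc; have t0 := cycle_len_gt0 (Hker thstar) hr.
rewrite mean_returnE// /stat_pair statE//; field.
by rewrite gt_eqF.
Qed.

Hypothesis HA4 : forall e1 e2 : R, 0 <= e1 -> 0 <= e2 ->
  exists2 ps : R, 0 < ps & forall T ss cs, feasible T ss cs -> ss T = s0 ->
  (forall c, c \in Cset -> (0 < Nc ss cs s0 T c)%N -> forall s1 s2,
     `| (Jc ss cs T c s1 s2)%:R / (Nc ss cs s0 T c)%:R
        - mean_return (p thstar) c s0 * stat_pair (p thstar) c s0 s1 s2 |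
     <= Num.sqrt (e1 * ln (e2 * ln (Nc ss cs s0 T c)%:R) / (Nc ss cs s0 T c)%:R)) ->
  ps <= post pi p ss cs T (S cstar).

(* The bound in (A4) vanishes for a policy used in exactly one epoch, so (A4) is
   applied to the history prolonged by two cycles of every usable policy; by (A2)
   this multiplies posterior probabilities by a bounded factor. *)
Lemma post_cstar_ge e : 0 <= e -> exists2 eta, 0 < eta & forall T ss cs,
  feasible T ss cs -> ss T = s0 ->
  (forall c, usable c -> forall s s',
    `|(Jc ss cs T c s s')%:R - (Nc ss cs s0 T c)%:R * (v c s * p thstar s (c s) s')|
    <= e * lilrate (Nc ss cs s0 T c).+1%:R) ->
  eta <= post pi p ss cs T (S cstar).
Proof.
move=> e0.
pose l := [seq c <- enum (policy St Ac) | `[< usable c >]].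
have hl c : c \in l ++ l -> usable c.
  by rewrite mem_cat orbb mem_filter => /andP[/asboolP].
have cnt c : usable c -> count_mem c (l ++ l) = 2%N.
  have ul : uniq l by rewrite filter_uniq ?enum_uniq.
  move=> uc; rewrite count_cat count_uniq_mem//.
  by rewrite mem_filter mem_enum andbT; have /asboolP -> := uc.
have [L hL] := append_cycles hl.
pose V := \sum_c \sum_s `|v c s|.
have V0 : 0 <= V by apply: sumr_ge0 => c _; apply: sumr_ge0.
have vV c s s' : `|v c s * p thstar s (c s) s'| <= V.
  rewrite normrM; apply: (@le_trans _ _ `|v c s|).
    rewrite ler_piMr// ger0_norm ?kernel_le1//; by case: (Hker thstar s (c s)).
  rewrite /V (bigD1 c)//= (bigD1 s)//= -addrA lerDl addr_ge0//.
    exact: sumr_ge0.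
  by apply: sumr_ge0 => c' _; apply: sumr_ge0.
(* Allowance for the given deviation, for the at most [L] extra transitions, and for the mean of the
   two extra epochs. *)
pose E := e + L%:R + 2 * V.
have E0 : 0 <= E by rewrite /E; have := ler0n R L; lra.
have e60 : 0 <= 6 * expR 1 :> R by rewrite mulr_ge0 ?expR_ge0.
(* [e1 = E ^+ 2] and [e2 = 6 * expR 1] match [loglog_le_ln_ln], which asks for at least two
   epochs. *)
have [ps ps0 hps] := HA4 (sqr_ge0 E) e60.
exists (ps * expR (- (2 * (L%:R * Gam)))); first by rewrite mulr_gt0 ?expR_gt0.
move=> T ss cs hf hT hdev.
have [T' [ss' [cs' [f' s' n' j' p']]]] := hL T ss cs hf hT.
suff h : ps <= post pi p ss' cs' T' (S cstar).
  rewrite expRN ler_pdivrMr ?expR_gt0// mulrC.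
  by apply: le_trans h _; exact: p'.
apply: (hps T' ss' cs' f' s') => c _ cpos a b.
have uc := feasible_used f' cpos.
rewrite mean_return_stat_pair//.
have nE := n' c; rewrite (cnt _ uc) addn2 in nE.
have /andP[j1 j2] := j' c a b.
have hd := hdev c uc a b; have hv := vV c a b.
rewrite nE; set n := Nc ss cs s0 T c in nE hd *; set w := v c a * _ in hd hv *.
set J := Jc ss cs T c a b in j1 j2 hd; set J' := Jc ss' cs' T' c a b in j1 j2 *.
have n0 : 0 < n.+2%:R :> R by rewrite ltr0n.
have hJ : `|J'%:R - n.+2%:R * w| <= E * lilrate n.+2%:R.
  have l1 : 1 <= lilrate (n.+2%:R : R).
    apply: le_trans (sqrt_le_lilrate _); last by rewrite ltW.
    by rewrite -[leLHS]sqrtr1 ler_wsqrtr// ler1n.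
  have l2 : lilrate (n.+1%:R : R) <= lilrate n.+2%:R.
    by apply: le_lilrate; rewrite ?ler0n// ler_nat.
  have jj : `|J'%:R - J%:R| <= L%:R :> R.
    rewrite -natrB// normr_nat ler_nat leq_subLR//.
  have -> : J'%:R - n.+2%:R * w = (J'%:R - J%:R) + (J%:R - n%:R * w) - 2 * w.
    by rewrite -[n.+2%:R]natr1 -[n.+1%:R]natr1; ring.
  apply: (le_trans (ler_normB _ _)); rewrite normrM ger0_norm//.
  have := ler_normD (J'%:R - J%:R) (J%:R - n%:R * w).
  have := ler0n R L; rewrite /E; nra.
have -> : J'%:R / n.+2%:R - w = (J'%:R - n.+2%:R * w) / n.+2%:R.
  by field; rewrite gt_eqF.
rewrite normrM normfV [X in _ / X]ger0_norm ?(ltW n0)//.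
apply: (@le_trans _ _ (E * lilrate n.+2%:R / n.+2%:R)).
  by rewrite ler_wpM2r// invr_ge0 ltW.
have x0 : 0 <= E * lilrate n.+2%:R / n.+2%:R.
  by rewrite divr_ge0 ?(ltW n0)// mulr_ge0// lilrate_ge0.
rewrite -[leLHS]ger0_norm// -sqrtr_sqr ler_wsqrtr//.
rewrite expr_div_n exprMn sqr_sqrtr; last first.
  by rewrite mulr_ge0 ?(ltW n0)//; have := @loglog_ge1 R n.+2%:R; rewrite ltW//; lra.
have -> : E ^+ 2 * (n.+2%:R * loglog n.+2%:R) / n.+2%:R ^+ 2 =
   E ^+ 2 * loglog n.+2%:R / n.+2%:R by field; rewrite gt_eqF.
rewrite ler_wpM2r ?invr_ge0 ?(ltW n0)// ler_wpM2l ?sqr_ge0//.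
exact: loglog_le_ln_ln.
Qed.

End Posterior.

(** * Martingales along a run *)

Section Run.
Context {R : realType} {St Ac : finType} {dT : measure_display} {Theta : measurableType dT}.
Variables (pi : probability Theta R) (p : Theta -> tkernel R St Ac) (thstar : Theta).
Variables (s0 : St) (cOPT : Theta -> policy St Ac).
Context {dO : measure_display} {Omega : measurableType dO}.
Variables (P : probability Omega R) (X : nat -> Omega -> St) (Pol : nat -> Omega -> policy St Ac).
Hypothesis Hker : forall th, is_kernel (p th).
Hypothesis Hpmeas : forall s1 a s2, measurable_fun setT (fun th => p th s1 a s2).
Hypothesis HcOPTm : forall c, measurable (cOPT @^-1` [set c]).
Hypothesis HSm : forall t s, measurable [set w | X t w = s].
Hypothesis HPolm : forall t c, measurable [set w | Pol t w = c].
Hypothesis Hlaw : forall (n : nat) (ss : nat -> St) (cs : nat -> policy St Ac),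
  P [set w | (forall t, (t <= n)%N -> X t w = ss t) /\
             (forall t, (t < n)%N -> Pol t w = cs t)]
  = (path_prob pi p thstar s0 cOPT ss cs n)%:E.
Implicit Types (ss : nat -> St) (cs : nat -> policy St Ac).
Local Notation S c := (cOPT @^-1` [set c]).
Local Notation ps := (p thstar).

Lemma lik_local t : local t (fun ss cs => lik p ss cs t).
Proof.
move=> x y x' y' [h1 h2]; apply/funext => th; apply: eq_bigr => i _.
by rewrite !h1 ?h2//; exact: ltnW.
Qed.

Lemma post_local t A : local t (fun ss cs => post pi p ss cs t A).
Proof. by move=> x y x' y' h; rewrite /post; have /= -> := lik_local h. Qed.

Lemma start_local t n : (t <= n)%N ->
  local n (fun (ss : nat -> St) (_ : nat -> policy St Ac) => isStart ss s0 t).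
Proof. by move=> tn x y x' y' [h _]; rewrite /isStart h. Qed.

(** Conditional probability of using [c] at time [t], given the history. *)
Definition selection t ss cs c : R :=
  if isStart ss s0 t then post pi p ss cs t (S c) else (c == cs t.-1)%:R.

Definition transition t ss cs : R :=
  selection t ss cs (cs t) * ps (ss t) (cs t (ss t)) (ss t.+1).

Lemma path_probS n ss cs : path_prob pi p thstar s0 cOPT ss cs n.+1 =
  path_prob pi p thstar s0 cOPT ss cs n * transition n ss cs.
Proof. by rewrite /path_prob big_ord_recr mulrA. Qed.

Lemma selection_local t c : local t (fun ss cs => selection t ss cs c).
Proof.
move=> x y x' y' h; rewrite /selection (start_local (leqnn t) h) (post_local _ h).
case: ifP => // hs; case: h => _ h2; rewrite h2//.
by case: t hs h2 => // t hs _; exact: ltnSn.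
Qed.

Lemma transition_local t : local t.+1 (transition t).
Proof.
move=> x y x' y' h; rewrite /transition.
have ht : agree t x y x' y' by apply: agreeW h.
case: (h) => h1 h2; rewrite !h1// !h2//.
by rewrite (selection_local _ ht).
Qed.

Lemma path_prob_local n : local n (fun ss cs => path_prob pi p thstar s0 cOPT ss cs n).
Proof.
move=> x y x' y' h; rewrite /path_prob; case: (h) => -> // _; congr (_ * _).
by apply: eq_bigr => t _; apply: (@transition_local t); apply: agreeW h.
Qed.

Lemma path_prob_init c : \sum_s path_prob pi p thstar s0 cOPT (fun=> s) (fun=> c) 0 = 1.
Proof.
rewrite (bigD1 s0)//= /path_prob eqxx big_ord0 mulr1 big1 ?addr0// => s /negPf ->.
by rewrite mul0r.
Qed.

Lemma transition_put n ss cs s c :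
  transition n (put ss n.+1 s) (put cs n c) = selection n ss cs c * ps (ss n) (c (ss n)) s.
Proof.
rewrite /transition put_at !put_at put_lt//.
by rewrite (selection_local _ (agree_put n ss cs s c)).
Qed.

Lemma selection_ge0 n ss cs c : 0 <= selection n ss cs c.
Proof.
rewrite /selection; case: ifP => _; last exact: ler0n.
exact: post_ge0.
Qed.

Lemma selection_sum_le1 n ss cs : \sum_c selection n ss cs c <= 1.
Proof.
rewrite /selection; case: (isStart ss s0 n).
  by rewrite (post_sum pi Hker Hpmeas HcOPTm) lern1 leq_b1.
rewrite (bigD1 (cs n.-1))//= eqxx big1 ?addr0// => c /negPf -> //.
Qed.

(** The next state is drawn after the policy, so it suffices to bound the moment under each fixed
    policy. *)
Lemma transition_moment n ss cs (F : St -> policy St Ac -> R) :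
  (forall c : policy St Ac, \sum_s ps (ss n) (c (ss n)) s * F s c <= 1) ->
  \sum_(ab : St * policy St Ac)
    transition n (put ss n.+1 ab.1) (put cs n ab.2) * F ab.1 ab.2 <= 1.
Proof.
move=> hF.
rewrite -(pair_big_dep xpredT (fun=> xpredT)
  (fun s c => transition n (put ss n.+1 s) (put cs n c) * F s c)) /=.
rewrite exchange_big /=; apply: le_trans (selection_sum_le1 n ss cs).
apply: ler_sum => c _.
under eq_bigr do rewrite transition_put -mulrA.
by rewrite -mulr_sumr ler_piMr ?selection_ge0.
Qed.

Definition steps cs (T : nat) c : nat := (\sum_(t < T) (cs t == c))%N.
Definition epochs ss (T : nat) : nat := (\sum_(t < T) isStart ss s0 t)%N.

(** [f] is centred in the next state under [c], hence a martingale difference; the clock counts only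
    the steps made with [c]. *)
Lemma transition_lil_upper (c : policy St Ac) (f : St -> St -> R) (D : R) : 0 < D ->
  (forall s, \sum_s' ps s (c s) s' * f s s' = 0) ->
  (forall s s', `|f s s'| <= D) ->
  \forall w \ae P, exists2 C, 0 <= C & forall T,
    \sum_(t < T) (if Pol t w == c then f (X t w) (X t.+1 w) else 0) <=
      6 * D * lilrate (steps (Pol^~ w) T c)%:R
      + C * (1 + Num.sqrt (steps (Pol^~ w) T c)%:R).
Proof.
move=> D0 f0 fD.
apply: (lil_sum HSm HPolm Hlaw (path_prob_init c) path_prob_local path_probS
  (f := fun t ss cs => if cs t == c then f (ss t) (ss t.+1) else 0)
  (a := fun t ss cs => cs t == c) D0).
- by move=> n x y x' y' [h1 h2]; rewrite !h1// !h2.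
- by move=> n x y x' y' [h1 h2]; rewrite !h2.
move=> l n ss cs l0 lD.
under eq_bigr do rewrite !put_at (@put_lt _ ss)//.
apply: (@transition_moment n ss cs (fun s c' =>
  expR (l * (if c' == c then f (ss n) s else 0) - 2 * (l * D) ^+ 2 * (c' == c)%:R))) => c'.
case: eqVneq => [->|_]; last first.
  under eq_bigr do rewrite !mulr0 subrr expR0 mulr1.
  by rewrite (ker_sum1 _ (Hker thstar)).
under eq_bigr do rewrite mulr1 expRD mulrA.
rewrite -mulr_suml expRN ler_pdivrMr ?expR_gt0// mul1r.
apply: exp_moment => //; first by move=> s; exact: (ker_ge0 _ (Hker thstar)).
- by rewrite (ker_sum1 _ (Hker thstar)).
- by rewrite f0.
Qed.

Lemma transition_lil (c : policy St Ac) (f : St -> St -> R) (D : R) : 0 < D ->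
  (forall s, \sum_s' ps s (c s) s' * f s s' = 0) ->
  (forall s s', `|f s s'| <= D) ->
  \forall w \ae P, exists2 C, 0 <= C & forall T,
    `|\sum_(t < T) (if Pol t w == c then f (X t w) (X t.+1 w) else 0)| <=
      6 * D * lilrate (steps (Pol^~ w) T c)%:R
      + C * (1 + Num.sqrt (steps (Pol^~ w) T c)%:R).
Proof.
move=> D0 f0 fD.
have := @transition_lil_upper c (fun s s' => - f s s') D D0.
have f0' s : \sum_s' ps s (c s) s' * - f s s' = 0.
  by under eq_bigr do rewrite mulrN; rewrite sumrN f0 oppr0.
have fD' s s' : `|- f s s'| <= D by rewrite normrN.
move=> /(_ f0' fD'); apply: filterS2 (transition_lil_upper D0 f0 fD).
move=> w [C1 C10 h1] [C2 C20 h2]; exists (C1 + C2); first exact: addr_ge0.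
move=> T; have := h1 T; have := h2 T.
set F' := \sum_(t < T) _; set F := \sum_(t < T) _.
have -> : F' = - F.
  by rewrite /F /F' -sumrN; apply: eq_bigr => t _; case: ifP; rewrite ?oppr0.
have := sqrtr_ge0 ((steps (Pol^~ w) T c)%:R : R).
set sq := Num.sqrt _; set g := lilrate _ => h0 h3 h4.
rewrite ler_norml; apply/andP; split; nra.
Qed.

(** At an epoch start the posterior mass of [S c] is the conditional probability of selecting [c].
    The sign [b] provides both tails. *)
Lemma selection_lil_upper (c : policy St Ac) (b : bool) :
  \forall w \ae P, exists2 C, 0 <= C & forall T,
    \sum_(t < T) (if isStart (X^~ w) s0 t then (-1) ^+ b *
      ((Pol t w == c)%:R - post pi p (X^~ w) (Pol^~ w) t (S c)) else 0) <=
      6 * 1 * lilrate (epochs (X^~ w) T)%:R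
      + C * (1 + Num.sqrt (epochs (X^~ w) T)%:R).
Proof.
apply: (lil_sum HSm HPolm Hlaw (path_prob_init c) path_prob_local path_probS
  (f := fun t ss cs => if isStart ss s0 t then (-1) ^+ b *
      ((cs t == c)%:R - post pi p ss cs t (S c)) else 0)
  (a := fun t ss cs => isStart ss s0 t) ltr01).
- move=> n x y x' y' h; have hn : agree n x y x' y' by apply: agreeW h.
  by rewrite (start_local (leqnn n) hn) (post_local _ hn); case: h => _ ->.
- by move=> n x y x' y' h; rewrite (start_local (leqnSn n) h).
move=> l n ss cs l0 lD.
set x := post pi p ss cs n (S c).
have E (ab : St * policy St Ac) :
    post pi p (put ss n.+1 ab.1) (put cs n ab.2) n (S c) = x.
  by rewrite -(post_local _ (agree_put n ss cs ab.1 ab.2)).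
have E2 (ab : St * policy St Ac) : isStart (put ss n.+1 ab.1) s0 n = isStart ss s0 n.
  by rewrite -(start_local (leqnn n) (agree_put n ss cs ab.1 ab.2)).
under eq_bigr do rewrite E E2 put_at.
have [hs|hs] := boolP (isStart ss s0 n); last first.
  apply: (@transition_moment n ss cs (fun s c' => expR (l * 0 - 2 * (l * 1) ^+ 2 * 0))) => c'.
  under eq_bigr do rewrite !mulr0 subrr expR0 mulr1.
  by rewrite (ker_sum1 _ (Hker thstar)).
pose d (c' : policy St Ac) : R := (-1) ^+ b * ((c' == c)%:R - x).
rewrite -(pair_big_dep xpredT (fun=> xpredT)
  (fun s c' => transition n (put ss n.+1 s) (put cs n c') *
     expR (l * d c' - 2 * (l * 1) ^+ 2 * true%:R))) /=.
rewrite exchange_big /=.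
have -> : \sum_c' \sum_s transition n (put ss n.+1 s) (put cs n c') *
     expR (l * d c' - 2 * (l * 1) ^+ 2 * true%:R) =
   (\sum_c' selection n ss cs c' * expR (l * d c')) * expR (- (2 * (l * 1) ^+ 2)).
  rewrite mulr_suml; apply: eq_bigr => c' _.
  under eq_bigr do rewrite transition_put.
  by rewrite -mulr_suml -mulr_sumr (ker_sum1 _ (Hker thstar)) !mulr1 expRD mulrA.
rewrite expRN ler_pdivrMr ?expR_gt0// mul1r.
have x0 : 0 <= x by exact: post_ge0.
have x1 : x <= 1 by exact: post_le1.
apply: exp_moment => //.
- exact: selection_ge0.
- exact: selection_sum_le1.
- under eq_bigr do rewrite mulrCA mulrBr.
  rewrite -mulr_sumr sumrB -mulr_suml (bigD1 c)//= eqxx mulr1 big1 ?addr0; last first.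
    by move=> c' /negPf ->; rewrite mulr0.
  rewrite /selection hs (post_sum pi Hker Hpmeas HcOPTm) -/x.
  (* On a history of zero evidence the posterior is 0 by the convention for division, and so is the
     mean. *)
  case: eqVneq => [h|_]; last by rewrite mul1r subrr mulr0.
  have -> : x = 0 by rewrite /x postE h invr0 mulr0.
  by rewrite mulr0 subrr mulr0.
- move=> c'; rewrite /d normrM normrX normrN1 expr1n mul1r.
  by case: (c' == c) => /=; rewrite ler_norml; apply/andP; split; lra.
Qed.

Lemma selection_lil (c : policy St Ac) :
  \forall w \ae P, exists2 C, 0 <= C & forall T,
    `|\sum_(t < T) (if isStart (X^~ w) s0 t then
      (Pol t w == c)%:R - post pi p (X^~ w) (Pol^~ w) t (S c) else 0)| <=
      6 * 1 * lilrate (epochs (X^~ w) T)%:R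
      + C * (1 + Num.sqrt (epochs (X^~ w) T)%:R).
Proof.
have := selection_lil_upper c true; have := selection_lil_upper c false.
apply: filterS2 => w [C1 C10 h1] [C2 C20 h2].
exists (C1 + C2); first exact: addr_ge0.
move=> T; set F := \sum_(t < T) _.
have E (b : bool) : \sum_(t < T) (if isStart (X^~ w) s0 t then (-1) ^+ b *
      ((Pol t w == c)%:R - post pi p (X^~ w) (Pol^~ w) t (S c)) else 0) = (-1) ^+ b * F.
  by rewrite mulr_sumr; apply: eq_bigr => t _; case: ifP => _; rewrite ?mulr0.
have := h1 T; have := h2 T; rewrite !E expr1 expr0 mul1r mulN1r.
have := sqrtr_ge0 ((epochs (X^~ w) T)%:R : R).
set sq := Num.sqrt _; set g := lilrate _ => h0 h3 h4.
rewrite ler_norml; apply/andP; split; nra.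
Qed.

(** * Additive functionals of one policy as martingales *)

Variables (Gam : R) (N : set Theta).
Hypothesis Gam0 : 0 <= Gam.
Hypothesis Nm : measurable N.
Hypothesis N0 : pi N = 0%E.
Hypothesis HN : forall th, ~ N th -> forall s1 a s2,
  ((p thstar s1 a s2 == 0) = (p th s1 a s2 == 0)) /\
  (0 < p thstar s1 a s2 -> `|ln (p thstar s1 a s2 / p th s1 a s2)| <= Gam).
Hypothesis Hrec : forall c, usable pi cOPT c -> recurrent (p thstar) c s0.
Local Notation feas := (feasible pi p thstar s0 cOPT).

Lemma feasible_local T : local T (feas T).
Proof.
suff key x y x' y' : agree T x y x' y' -> feas T x y -> feas T x' y'.
  move=> x y x' y' h; apply/propext; split; apply: key => //; exact: agree_sym.
move=> [h1 h2] [h0 h]; split; first by rewrite -h1.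
move=> t tT.
have e1 : x' t = x t by rewrite h1// ltnW.
have e2 : x' t.+1 = x t.+1 by rewrite h1.
have e3 : y' t = y t by rewrite h2.
have e4 : y' t.-1 = y t.-1 by rewrite h2// (leq_ltn_trans (leq_pred _) tT).
by rewrite /isStart e1 e2 e3 e4; exact: h.
Qed.

Lemma ae_feasible : \forall w \ae P, forall T, feas T (X^~ w) (Pol^~ w).
Proof.
apply: ae_foralln => T.
apply: (ae_of_weight HSm HPolm Hlaw (@feasible_local T)) => x y.
exact: (path_prob_eq0 Hker Hpmeas HcOPTm Nm N0).
Qed.

(** The policy changes only at [s0], which is reachable under every policy. *)
Lemma feasible_reach T ss cs t : feas T ss cs -> (t < T)%N ->
  reach ps (cs t) s0 (ss t).
Proof.
move=> [h0 h]; elim: t => [|t IH] tT; first by rewrite h0 reach0.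
have [hp hs] := h t (ltnW tT); have [_ hs'] := h t.+1 tT.
move: hs'; rewrite /isStart /=; case: eqVneq => [-> _|_ /= ->]; first exact: reach0.
by apply: (reach_closed (Hker thstar)) hp; apply: IH; exact: ltnW.
Qed.

(* A potential vanishing at [s0] telescopes over every epoch but the last one. *)
Lemma potential_sum T ss cs c (u : St -> R) : feas T ss cs -> u s0 = 0 ->
  \sum_(t < T) (if cs t == c then u (ss t.+1) - u (ss t) else 0) =
  if (0 < T)%N && (cs T.-1 == c) then u (ss T) else 0.
Proof.
move=> hf u0; elim: T hf => [|T IH] [h0 h]; first by rewrite big_ord0.
rewrite big_ord_recr /= IH; last by split=> // t tT; apply: h; exact: ltnW.
have [_] := h T (ltnSn T); rewrite /isStart.
case: T {IH h} => [|T] /=.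
  by move=> _; rewrite h0 u0 subr0 add0r.
case: eqVneq => [-> _|_ /= ->].
  rewrite u0 subr0; case: ifP => _; case: ifP => _; by rewrite ?addr0 ?add0r.
by case: ifP => _; rewrite ?addr0// addrC subrK.
Qed.

(** The hypothesis says that [phi] has zero expected total over a cycle. The Poisson solution [u] of
    its conditional mean turns it into a martingale difference minus an increment of [u], which
    telescopes by [potential_sum]. *)
Lemma cycle_lil c (phi : St -> St -> R) : usable pi cOPT c ->
  \sum_s visits ps c s0 s * (\sum_s' ps s (c s) s' * phi s s') = 0 ->
  exists2 K, 0 <= K & \forall w \ae P, exists2 C, 0 <= C & forall T,
    `|\sum_(t < T) (if Pol t w == c then phi (X t w) (X t.+1 w) else 0)| <=
      K * lilrate (steps (Pol^~ w) T c)%:R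
      + C * (1 + Num.sqrt (steps (Pol^~ w) T c)%:R).
Proof.
move=> uc hphi; have hr := Hrec uc; have hk := Hker thstar.
pose phib s := \sum_s' ps s (c s) s' * phi s s'.
pose u := solve ps c s0 phib.
have u0 : u s0 = 0 by rewrite /u solve_start.
(* The Poisson equation is only known on reachable states; a feasible run meets no others under [c],
   so [f] is put to 0 there. *)
pose f s s' := if reach ps c s0 s then phi s s' + u s' - u s else 0.
pose U := \sum_s `|u s|.
have uU s : `|u s| <= U by rewrite /U (bigD1 s)//= lerDl sumr_ge0.
have U0 : 0 <= U by exact: le_trans (uU s0).
pose F := \sum_s \sum_s' `|phi s s'|.
have pF s s' : `|phi s s'| <= F.
  rewrite /F (bigD1 s)//= (bigD1 s')//= -addrA lerDl addr_ge0 ?sumr_ge0// => x _.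
  exact: sumr_ge0.
have F0 : 0 <= F by exact: le_trans (pF s0 s0).
have D0 : 0 < 1 + F + 2 * U by lra.
exists (6 * (1 + F + 2 * U)); first by lra.
have f0 s : \sum_s' ps s (c s) s' * f s s' = 0.
  rewrite /f; have [rs|rs] := boolP (reach ps c s0 s); last by rewrite big1// => s' _; rewrite mulr0.
  under eq_bigr do rewrite -addrA mulrDr mulrBr.
  rewrite big_split sumrB -[X in _ - X]mulr_suml (ker_sum1 _ hk) mul1r /=.
  by rewrite addrA {2}/u (poisson hk hr hphi rs) subrr.
have fD s s' : `|f s s'| <= 1 + F + 2 * U.
  rewrite /f; case: ifP => _; last by rewrite normr0; lra.
  apply: (le_trans (ler_normB _ _)); have := ler_normD (phi s s') (u s').
  have := uU s; have := uU s'; have := pF s s'; lra.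
have := transition_lil D0 f0 fD; have := ae_feasible.
apply: filterS2 => w hf [C C0 hC]; exists (C + U); first exact: addr_ge0.
move=> T; have E : \sum_(t < T) (if Pol t w == c then phi (X t w) (X t.+1 w) else 0) =
    \sum_(t < T) (if Pol t w == c then f (X t w) (X t.+1 w) else 0) -
    \sum_(t < T) (if Pol t w == c then u (X t.+1 w) - u (X t w) else 0).
  rewrite -sumrB; apply: eq_bigr => t _; case: eqVneq => [hc|_]; last by rewrite subrr.
  have := feasible_reach (hf T) (ltn_ord t); rewrite hc => rt.
  by rewrite /f rt; ring.
rewrite E (potential_sum c (hf T) u0); apply: (le_trans (ler_normB _ _)).
have hU : `|if (0 < T)%N && (Pol T.-1 w == c) then u (X T w) else 0| <= U.
  by case: ifP => _; rewrite ?normr0.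
have := hC T; have := sqrtr_ge0 ((steps (Pol^~ w) T c)%:R : R).
set sq := Num.sqrt _; set g := lilrate _ => h0 h1.
nra.
Qed.

End Run.

(** * Counts along a feasible path *)

Section Path.
Context {R : realType} {St Ac : finType} {dT : measure_display} {Theta : measurableType dT}.
Variables (pi : probability Theta R) (p : Theta -> tkernel R St Ac) (thstar : Theta).
Variables (s0 : St) (cOPT : Theta -> policy St Ac).
Hypothesis Hker : forall th, is_kernel (p th).
Hypothesis Hpmeas : forall s1 a s2, measurable_fun setT (fun th => p th s1 a s2).
Hypothesis HcOPTm : forall c, measurable (cOPT @^-1` [set c]).
Variables (Gam : R) (N : set Theta).
Hypothesis Gam0 : 0 <= Gam.
Hypothesis Nm : measurable N.
Hypothesis N0 : pi N = 0%E.
Hypothesis HN : forall th, ~ N th -> forall s1 a s2,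
  ((p thstar s1 a s2 == 0) = (p th s1 a s2 == 0)) /\
  (0 < p thstar s1 a s2 -> `|ln (p thstar s1 a s2 / p th s1 a s2)| <= Gam).
Local Notation S c := (cOPT @^-1` [set c]).
Local Notation ps := (p thstar).
Local Notation feas := (feasible pi p thstar s0 cOPT).
Local Notation usable := (usable pi cOPT).
Hypothesis Hrec : forall c, usable c -> recurrent ps c s0.
Local Notation v c := (visits ps c s0).
Local Notation tau c := (cycle_len ps c s0).
Local Notation post := (post pi p).
Local Notation ell := (ell p thstar).

(** [K] is reserved for deterministic constants, while random ones go into [C]; the two are kept
    apart throughout. *)
Definition err (K C : R) (T : nat) : R := K * lilrate T%:R + C * (1 + Num.sqrt T%:R).

Lemma sqrtn_ge0 (T : nat) : 0 <= Num.sqrt T%:R :> R.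
Proof. exact: sqrtr_ge0. Qed.

Lemma err_le K C n m : 0 <= K -> 0 <= C -> (n <= m)%N -> err K C n <= err K C m.
Proof.
move=> K0 C0 nm; rewrite lerD// ler_wpM2l//.
  by apply: le_lilrate; rewrite ?ler_nat.
by rewrite lerD2l ler_wsqrtr// ler_nat.
Qed.

Lemma err_ge0 K C n : 0 <= K -> 0 <= C -> 0 <= err K C n.
Proof.
by move=> K0 C0; rewrite addr_ge0// mulr_ge0 ?lilrate_ge0// addr_ge0.
Qed.

Variables (ss : nat -> St) (cs : nat -> policy St Ac).
Hypothesis Hf : forall T, feas T ss cs.
Local Notation Nn T c := (Nc ss cs s0 T c).
Local Notation Jn T c a b := (Jc ss cs T c a b).
Local Notation sn T c := (steps cs T c).
Local Notation en T := (epochs s0 ss T).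

Lemma policy_usable t : usable (cs t).
Proof.
elim: t => [|t IH].
  by have [_ h] := Hf 1; have [_] := h 0%N isT.
have [_ h] := Hf t.+2; have [_] := h t.+1 (ltnSn _); case: ifP => // _ -> //.
Qed.

Lemma steps_unusable T c : ~ usable c -> sn T c = 0%N.
Proof.
move=> nu; rewrite /steps big1// => t _; case: eqVneq => // h.
by case: nu; rewrite -h; exact: policy_usable.
Qed.

Lemma Nc_unusable T c : ~ usable c -> Nn T c = 0%N.
Proof.
by move=> nu; apply/eqP; rewrite -leqn0 leqNgt; apply/negP => /(feasible_used (Hf T)).
Qed.

Lemma Jc_le T c a b : (Jn T c a b <= sn T c)%N.
Proof.
rewrite /Jc /steps big_mkcond /=; apply: leq_sum => t _.
by case: (cs t == c) => //=; case: ifP.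
Qed.

Lemma steps_sum T : (\sum_c sn T c)%N = T.
Proof.
rewrite /steps exchange_big /= -[RHS]card_ord -sum1_card.
apply: eq_bigr => t _; rewrite (bigD1 (cs t))//= eqxx big1// => c.
by rewrite eq_sym => /negPf ->.
Qed.

Lemma steps_le T c : (sn T c <= T)%N.
Proof. by rewrite -[leqRHS](steps_sum T) (bigD1 c)//= leq_addr. Qed.

Lemma Nc_sum T : (\sum_c Nn T c)%N = en T.
Proof.
rewrite /Nc /epochs; under eq_bigr do rewrite big_mkcond.
rewrite exchange_big /=; apply: eq_bigr => t _.
rewrite (bigD1 (cs t))//= eqxx andbT big1 ?addn0; first by case: isStart.
by move=> c /negPf h; rewrite eq_sym h andbF.
Qed.

Lemma Nc_le_epochs T c : (Nn T c <= en T)%N.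
Proof. by rewrite -(Nc_sum T) (bigD1 c)//= leq_addr. Qed.

Lemma epochs_le T : (en T <= T)%N.
Proof.
rewrite -[leqRHS]card_ord -sum1_card; apply: leq_sum => t _; exact: leq_b1.
Qed.

Lemma epochs_gt0 T : (0 < T)%N -> (0 < en T)%N.
Proof. by case: T => // T _; rewrite /epochs big_ord_recl /isStart. Qed.

Lemma startE t : isStart ss s0 t = (ss t == s0).
Proof. by rewrite /isStart; case: t => //=; have [-> _] := Hf 0; rewrite eqxx. Qed.

Lemma usable_all T c : usable c \/ (sn T c = 0%N /\ Nn T c = 0%N).
Proof.
have [h|h] := pselect (usable c); [by left|right].
by rewrite steps_unusable// Nc_unusable.
Qed.

Variables (K C : R).
Hypotheses (K0 : 0 <= K) (C0 : 0 <= C).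
Hypothesis Hlen : forall c T, usable c ->
  `|(sn T c)%:R - tau c * (Nn T c)%:R| <= err K C (sn T c).
Hypothesis Htrans : forall c a b T, usable c ->
  `|(Jn T c a b)%:R - (Nn T c)%:R * (v c a * ps a (c a) b)| <= err K C (sn T c).
Hypothesis Hsel : forall c T,
  `|(Nn T c)%:R - \sum_(t < T) (if isStart ss s0 t then post ss cs t (S c) else 0)|
    <= err K C (en T).

Definition tmax : R := 1 + \sum_(c : policy St Ac) `|tau c|.

Lemma tau_le c : tau c <= tmax.
Proof.
apply: (le_trans (ler_norm _)); rewrite /tmax (bigD1 c)//= addrCA lerDl addr_ge0//.
exact: sumr_ge0.
Qed.

Lemma tmax_ge1 : 1 <= tmax.
Proof. by rewrite lerDl sumr_ge0. Qed.

Lemma steps_Nc T c : (sn T c)%:R <= tmax * (Nn T c)%:R + err K C T.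
Proof.
have [uc|[-> ->]] := usable_all T c; last first.
  by rewrite mulr0 add0r err_ge0.
have := Hlen T uc; rewrite ler_norml => /andP[_].
have := err_le K0 C0 (steps_le T c).
have := ler_wpM2r (ler0n R (Nn T c)) (tau_le c); lra.
Qed.

(** The deviation is itself measured in steps; being sublinear, it is absorbed by half of the
    left-hand side. *)
Lemma steps_linear : exists2 b : R, 1 <= b & forall c T, usable c ->
  (sn T c)%:R <= b * (Nn T c).+1%:R.
Proof.
have h2 : 0 < 2^-1 :> R by lra.
have [B [B0 hB]] := err_sublinear K0 C0 h2.
have t1 := tmax_ge1.
exists (2 * tmax + 2 * B); first by lra.
move=> c T uc; have := Hlen T uc; rewrite ler_norml => /andP[_].
rewrite /err; have := hB (sn T c)%:R (ler0n _ _).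
have := ler_wpM2r (ler0n R (Nn T c)) (tau_le c).
have := mulr_ge0 B0 (ler0n R (Nn T c)).
have := ler0n R (Nn T c); rewrite -[(Nn T c).+1%:R]natr1; lra.
Qed.

Lemma epochs_linear : exists2 B : R, 0 <= B & forall T : nat, T%:R <= 2 * tmax * (en T)%:R + B.
Proof.
pose M : R := #|{: policy St Ac}|%:R.
have M0 : 0 <= M by exact: ler0n.
have h2 : 0 < 2^-1 :> R by lra.
have [B [B0 hB]] := err_sublinear (mulr_ge0 M0 K0) (mulr_ge0 M0 C0) h2.
exists (2 * B); first by lra.
move=> T; have h : T%:R <= tmax * (en T)%:R + M * err K C T.
  rewrite -{1}(steps_sum T) -(Nc_sum T) !natr_sum mulr_sumr /M mulr_natl -sumr_const.
  by rewrite -big_split /=; apply: ler_sum => c _; exact: steps_Nc.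
have := hB T%:R (ler0n _ _); rewrite /err in h; lra.
Qed.

Variables (Cset : {set policy St Ac}) (cstar : policy St Ac).
Hypothesis HCset : forall c, usable c -> c \in Cset.
Hypothesis HA4 : forall e1 e2 : R, 0 <= e1 -> 0 <= e2 ->
  exists2 ps : R, 0 < ps & forall T ss cs, feas T ss cs -> ss T = s0 ->
  (forall c, c \in Cset -> (0 < Nc ss cs s0 T c)%N -> forall s1 s2,
     `| (Jc ss cs T c s1 s2)%:R / (Nc ss cs s0 T c)%:R
        - mean_return (p thstar) c s0 * stat_pair (p thstar) c s0 s1 s2 |
     <= Num.sqrt (e1 * ln (e2 * ln (Nc ss cs s0 T c)%:R) / (Nc ss cs s0 T c)%:R)) ->
  ps <= post ss cs T (S cstar).

(** Deviations are measured in steps of [c], whereas [post_cstar_ge] wants epochs; [steps_linear]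
    and [lilrateM] make the exchange. The resulting [e] contains the random [C], so [eta] is random
    as well. *)
Lemma post_cstar_bounded : exists2 eta : R, 0 < eta &
  forall t, isStart ss s0 t -> eta <= post ss cs t (S cstar).
Proof.
have [b b1 hb] := steps_linear.
have b0 : 0 <= b by lra.
pose e := K * lilrate b + C * (1 + Num.sqrt b).
have e0 : 0 <= e.
  by rewrite addr_ge0// mulr_ge0 ?lilrate_ge0// addr_ge0// sqrtr_ge0.
have [eta eta0 h] := post_cstar_ge Hker Hpmeas HcOPTm Gam0 Nm N0 HN Hrec HA4 e0.
exists eta => // t; rewrite startE => /eqP st; apply: h => // c uc a a'.
apply: (le_trans (Htrans a a' t uc)); rewrite /err /e.
set n := Nc _ _ _ _ _; have hs := hb c t uc; rewrite -/n in hs.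
have n0 : 0 <= n.+1%:R :> R by exact: ler0n.
have h1 : lilrate (sn t c)%:R <= lilrate b * lilrate n.+1%:R.
  by apply: le_trans (lilrateM b0 n0); apply: le_lilrate.
have h2 : Num.sqrt (sn t c)%:R <= Num.sqrt b * Num.sqrt n.+1%:R.
  by rewrite -sqrtrM// ler_wsqrtr.
have h3 := sqrt_le_lilrate n0.
have h4 : 1 <= Num.sqrt n.+1%:R :> R by rewrite -[leLHS]sqrtr1 ler_wsqrtr// ler1n.
have h5 := sqrtr_ge0 b.
have h6 : 1 + Num.sqrt (sn t c)%:R <= (1 + Num.sqrt b) * lilrate n.+1%:R by nra.
have h7 := ler_wpM2l K0 h1; have h8 := ler_wpM2l C0 h6.
by rewrite mulrDl -!mulrA lerD.
Qed.

(** Each epoch selects [cstar] with conditional probability at least [eta], and [Hsel] compares the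
    count with this compensator. *)
Lemma Nc_cstar_linear : exists2 eta : R, 0 < eta &
  forall T, eta * (en T)%:R - err K C T <= (Nn T cstar)%:R.
Proof.
have [eta eta0 h] := post_cstar_bounded; exists eta => // T.
have := Hsel cstar T; rewrite ler_norml => /andP[h1 _].
have h2 := err_le K0 C0 (epochs_le T).
have : eta * (en T)%:R <=
    \sum_(t < T) (if isStart ss s0 t then post ss cs t (S cstar) else 0).
  rewrite /epochs natr_sum mulr_sumr; apply: ler_sum => t _.
  by case: ifP => st; rewrite ?mulr1 ?mulr0//; exact: h.
lra.
Qed.

(** * Likelihood of the observed path and posterior probabilities *)

Definition triples : R := \sum_(c : policy St Ac) \sum_(a : St) \sum_(b : St) 1.

Lemma triples_ge0 : 0 <= triples.
Proof. by do 3![apply: sumr_ge0 => ? _]. Qed.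

Lemma KL_ell (c : policy St Ac) a th :
  KL (ps a (c a)) (p th a (c a)) = \sum_b ps a (c a) b * ell c a b th.
Proof. by apply: eq_bigr => b _; case: eqVneq => [->|]//; rewrite mul0r. Qed.

(** Group the log-likelihood ratio by policy, state and next state: each count is close to its mean,
    each coefficient is at most [Gam], and the means add up to the divergences per cycle. *)
Lemma loglik_dev T th : ~ N th ->
  `|\sum_(t < T) ell (cs t) (ss t) (ss t.+1) th
    - \sum_c (Nn T c)%:R * cycle_KL ps c s0 (p th)| <= Gam * triples * err K C T.
Proof.
move=> nN; rewrite (path_sum_counts T ss cs (fun c a b => ell c a b th)) -sumrB.
have -> : Gam * triples * err K C T = \sum_(c : policy St Ac) \sum_(a : St) \sum_(b : St)
    Gam * err K C T.
  rewrite /triples mulrAC mulr_sumr; apply: eq_bigr => c _.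
  rewrite mulr_sumr; apply: eq_bigr => a _.
  by rewrite mulr_sumr; apply: eq_bigr => b _; rewrite mulr1.
apply: (le_trans (ler_norm_sum _ _ _)); apply: ler_sum => c _.
rewrite /cycle_KL mulr_sumr -sumrB.
apply: (le_trans (ler_norm_sum _ _ _)); apply: ler_sum => a _.
rewrite KL_ell !mulr_sumr -sumrB.
apply: (le_trans (ler_norm_sum _ _ _)); apply: ler_sum => b _.
rewrite !mulrA -mulrBl normrM mulrC ler_pM//; first exact: (ell_bound Hker Gam0 HN).
have [uc|[h1 h2]] := usable_all T c; last first.
  have -> : Jn T c a b = 0%N by apply/eqP; rewrite -leqn0 -h1 Jc_le.
  by rewrite h2 !mul0r subrr normr0 err_ge0.
rewrite -mulrA; apply: (le_trans (Htrans a b T uc)).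
exact: err_le (steps_le T c).
Qed.

Lemma cycle_KL_good_ge0 c th : usable c -> ~ N th -> 0 <= cycle_KL ps c s0 (p th).
Proof.
move=> uc nN; apply: (cycle_KL_ge0 (Hker thstar) (Hrec uc) (Hker th)) => s s'.
by have [] := HN nN s (c s) s'.
Qed.

Lemma pos_all T : pos_path p thstar T ss cs.
Proof. exact: feasible_pos (Hf T). Qed.

(** All divergences are nonnegative, so the term of [cstar] or of [c], whichever exceeds [xi], may
    be kept alone. Which one it is depends on [th], hence the minimum of the two counts. *)
Lemma evidence_upper T c xi : 0 < xi -> usable c -> usable cstar -> c != cstar ->
  (forall th, ~ N th -> cOPT th = c ->
     xi <= cycle_KL ps cstar s0 (p th) \/ xi <= cycle_KL ps c s0 (p th)) ->
  evidence pi p ss cs T (S c) <= lik p ss cs T thstar *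
    expR (Gam * triples * err K C T - xi * (minn (Nn T cstar) (Nn T c))%:R).
Proof.
move=> xi0 uc ucs ccs hxi.
apply: (@le_trans _ _ (lik p ss cs T thstar *
    expR (Gam * triples * err K C T - xi * (minn (Nn T cstar) (Nn T c))%:R) * fine (pi (S c)))).
  apply: (evidence_le Hker Hpmeas Nm N0) => //.
    by rewrite mulr_ge0 ?expR_ge0 ?lik_ge0.
  move=> th Sth nN; rewrite (lik_ell Hker HN nN (@pos_all T)) ler_wpM2l ?lik_ge0//.
  rewrite ler_expR.
  have := loglik_dev T nN; rewrite ler_norml => /andP[h1 _].
  suff : xi * (minn (Nn T cstar) (Nn T c))%:R <=
     \sum_c (Nn T c)%:R * cycle_KL ps c s0 (p th) by lra.
  have nneg d : 0 <= (Nn T d)%:R * cycle_KL ps d s0 (p th).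
    have [ud|[_ ->]] := usable_all T d; last by rewrite mul0r.
    by rewrite mulr_ge0// cycle_KL_good_ge0.
  have [hd|hd] := hxi th nN Sth.
    rewrite (bigD1 cstar)//=; apply: ler_wpDr; first exact: sumr_ge0.
    by rewrite mulrC ler_pM ?(ltW xi0)// ler_nat geq_minl.
  rewrite (bigD1 c)//=; apply: ler_wpDr; first exact: sumr_ge0.
  by rewrite mulrC ler_pM ?(ltW xi0)// ler_nat geq_minr.
rewrite ler_piMr//; last exact: pr_le1.
by rewrite mulr_ge0 ?expR_ge0 ?lik_ge0.
Qed.

Lemma prior_ball_measurable kc : measurable (prior_ball p thstar s0 Cset kc).
Proof.
rewrite /prior_ball.
have mF : measurable_fun setT (fun th => \sum_(c in Cset) (kc c)%:R *
    mean_return (p thstar) c s0 * Dc (p thstar) (p th) c s0).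
  rewrite (_ : (fun th => _) = (fun th => \sum_(c <- [seq c <- index_enum (policy St Ac) | c \in Cset])
     (kc c)%:R * mean_return (p thstar) c s0 * Dc (p thstar) (p th) c s0)); last first.
    by apply/funext => th; rewrite big_filter.
  rewrite /Dc /KL.
  apply: measurable_sum => c; apply: measurable_funM; first exact: measurable_cst.
  apply: measurable_sum => s; apply: measurable_funM; first exact: measurable_cst.
  apply: measurable_sum => s'; have [_|h] := eqVneq (p thstar s (c s) s') 0; first exact: measurable_cst.
  apply: measurable_funM; first exact: measurable_cst.
  (* Inverting the quotient leaves [p th] in the numerator; where it is 0 both sides vanish by the
     conventions for inverse and [ln]. *)
  rewrite (_ : (fun th => _) = (fun th => - ln (p th s (c s) s' / p thstar s (c s) s'))); last first.
    apply/funext => th; have t0 : 0 < p thstar s (c s) s'.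
      by rewrite lt_def h /=; case: (Hker thstar s (c s)).
    have [->|h'] := eqVneq (p th s (c s) s') 0.
      by rewrite invr0 mulr0 mul0r ln0// oppr0.
    have t1 : 0 < p th s (c s) s'.
      by rewrite lt_def h' /=; case: (Hker th s (c s)).
    by rewrite -[X in ln X = _]invf_div lnV ?posrE ?divr_gt0.
  apply: measurable_funN; apply: measurableT_comp => //.
  by apply: measurable_funM => //; exact: measurable_cst.
have := mF measurableT _ (measurable_itv (`]-oo, 1]%R : interval R)).
by rewrite setTI; congr measurable.
Qed.

Hypothesis HA5A : exists a1 a2 : R, [/\ 0 < a1, 0 <= a2 &
     forall kc : policy St Ac -> nat,
       (1 <= \sum_(c in Cset) kc c)%N ->
       ((a1 * (\sum_(c in Cset) kc c)%:R `^ (- a2))%:E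
          <= pi (prior_ball p thstar s0 Cset kc))%E].

(** Restrict the evidence to the prior ball of the epoch counts, where the log-likelihood loss is at
    most 1 up to the deviation. The polynomial mass of the ball costs a logarithm, charged to the
    [1 + sqrt T] term. *)
Lemma evidence_lower : exists2 D : R, 0 <= D & forall T, (0 < T)%N ->
  lik p ss cs T thstar * expR (- (Gam * triples * err K C T + D * (1 + Num.sqrt T%:R)))
    <= evidence pi p ss cs T setT.
Proof.
have [a1 [a2 [a10 a20 h]]] := HA5A.
(* Contributions of the radius 1, of [a1], and of the power [a2] through [ln_le_sqrt]. *)
exists (1 + `|ln a1| + 2 * a2); first by rewrite !addr_ge0// mulr_ge0.
move=> T T0; pose kc c := Nn T c.
have kE : (\sum_(c in Cset) kc c)%N = en T.
  rewrite -(Nc_sum T) [RHS](bigID (mem Cset))/= [X in (_ + X)%N]big1 ?addn0// => c hc.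
  by apply: Nc_unusable => uc; rewrite HCset in hc.
have e0 := epochs_gt0 T0.
have := h kc; rewrite kE => /(_ e0); set Bl := prior_ball _ _ _ _ _ => hB.
have mB : measurable Bl by exact: prior_ball_measurable.
have hB' : a1 * (en T)%:R `^ (- a2) <= fine (pi Bl) by rewrite -lee_fin prK.
apply: (@le_trans _ _ (evidence pi p ss cs T Bl)); last first.
  by apply: (evidence_mono pi Hker Hpmeas).
have l0 := lik_star_gt0 (@pos_all T).
pose b := lik p ss cs T thstar * expR (- (Gam * triples * err K C T + 1)).
have b0 : 0 < b by rewrite mulr_gt0 ?expR_gt0.
apply: (@le_trans _ _ (b * fine (pi Bl))); last first.
  apply: (evidence_ge Hker Hpmeas Nm N0) => // th Bth nN.
  rewrite (lik_ell Hker HN nN (@pos_all T)) ler_wpM2l ?lik_ge0// ler_expR lerN2.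
  have := loglik_dev T nN; rewrite ler_norml => /andP[_ h1].
  suff : \sum_c (Nn T c)%:R * cycle_KL ps c s0 (p th) <= 1 by lra.
  apply: le_trans Bth; rewrite [leLHS](bigID (mem Cset))/= [X in _ + X]big1 ?addr0; last first.
    by move=> c hc; rewrite Nc_unusable ?mul0r// => uc; rewrite HCset in hc.
  apply: ler_sum => c _; have [uc|[_ h2]] := usable_all T c; last by rewrite /kc h2 !mul0r.
  by rewrite -mulrA (mean_return_Dc (Hker thstar) (Hrec uc)).
rewrite /b -[leRHS]mulrA ler_wpM2l ?(ltW l0)//.
apply: (@le_trans _ _ (expR (- (Gam * triples * err K C T + 1)) *
    (a1 * (en T)%:R `^ (- a2)))); last by rewrite ler_wpM2l ?expR_ge0.
have en0 : 0 < (en T)%:R :> R by rewrite ltr0n.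
rewrite /powR gt_eqF// -[a1]lnK ?posrE// -!expRD ler_expR lnK ?posrE//.
have h3 : ln (en T)%:R <= 2 * Num.sqrt T%:R :> R.
  apply: le_trans (ln_le_sqrt (ler0n R T)).
  have T0' := ler0n R T.
  have T1' : 0 < 1 + T%:R :> R by lra.
  rewrite ler_ln ?posrE//.
  by apply: (@le_trans _ _ T%:R); [rewrite ler_nat epochs_le|lra].
have h4 := sqrtn_ge0 T.
have h5 := ler_wpM2l a20 h3.
have h6 : - `|ln a1| <= ln a1 by rewrite lerNl -normrN ler_norm.
have h7 : 0 <= `|ln a1| by [].
set s := Num.sqrt _ in h3 h4 h5 *; set l := ln _%:R in h3 h5 *.
set la := `|ln a1| in h6 h7 *.
nra.
Qed.

(** The likelihood at [thstar] cancels in the quotient; numerator and denominator each contribute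
    one deviation, hence the factor 2. *)
Lemma post_upper c xi : 0 < xi -> usable c -> usable cstar -> c != cstar ->
  (forall th, ~ N th -> cOPT th = c ->
     xi <= cycle_KL ps cstar s0 (p th) \/ xi <= cycle_KL ps c s0 (p th)) ->
  exists2 D : R, 0 <= D & forall T, (0 < T)%N ->
    post ss cs T (S c) <= expR (err (2 * (Gam * triples) * K) D T
      - xi * (minn (Nn T cstar) (Nn T c))%:R).
Proof.
move=> xi0 uc ucs ccs hxi; have [D D0 hD] := evidence_lower.
have G0 : 0 <= Gam * triples by rewrite mulr_ge0 ?triples_ge0.
exists (D + 2 * (Gam * triples) * C); first by apply: addr_ge0 => //; do 2!apply: mulr_ge0 => //.
move=> T T0; have hl := hD T T0.
have hu := evidence_upper T xi0 uc ucs ccs hxi.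
have l0 := lik_star_gt0 (@pos_all T).
rewrite postE ler_pdivrMr; last first.
  by apply: lt_le_trans hl; rewrite mulr_gt0 ?expR_gt0.
apply: (le_trans hu); set m := xi * _.
apply: le_trans (ler_wpM2l (expR_ge0 _) hl).
rewrite mulrCA -expRD ler_wpM2l ?(ltW l0)// ler_expR /err.
set g := lilrate _; set s := 1 + _; lra.
Qed.

(* Once [Nn T c] exceeds the threshold [thr T], the posterior probability of
   selecting [c] is at most [exp (- 2 sqrt (T + 1)) <= sqrt (T + 1) - sqrt T], so
   the selections beyond the threshold telescope to [O (sqrt T)]. *)
Lemma Nc_suboptimal c xi : 0 < xi -> usable c -> usable cstar -> c != cstar ->
  (forall th, ~ N th -> cOPT th = c ->
     xi <= cycle_KL ps cstar s0 (p th) \/ xi <= cycle_KL ps c s0 (p th)) ->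
  exists2 D : R, 0 <= D & forall T,
    (Nn T c)%:R <= err (2 * (Gam * triples) * K / xi + 2 * K) D T.
Proof.
move=> xi0 uc ucs ccs hxi.
have [D D0 hD] := post_upper xi0 uc ucs ccs hxi.
have [eta eta0 heta] := Nc_cstar_linear.
have [B B0 hB] := epochs_linear.
have t1 := tmax_ge1.
have G0 : 0 <= Gam * triples by rewrite mulr_ge0 ?triples_ge0.
pose KD := 2 * (Gam * triples) * K.
have KD0 : 0 <= KD by apply: mulr_ge0 => //; exact: mulr_ge0.
(* The added 2 makes the exponent of [post_upper] at most [- 2 * (1 + sqrt T)] once both counts
   exceed this threshold. *)
pose thr T := err KD (D + 2) T / xi.
have thr_le n m : (n <= m)%N -> thr n <= thr m.
  by move=> nm; rewrite ler_pM2r ?invr_gt0// err_le// addr_ge0.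
have sq1 T : Num.sqrt T.+1%:R <= 1 + Num.sqrt T%:R :> R.
  have h0 := sqrtn_ge0 T.
  rewrite -[leRHS]ger0_norm -?sqrtr_sqr; last by lra.
  rewrite ler_wsqrtr// sqrrD sqr_sqrtr// expr1n mul1r -natr1.
  by set s := Num.sqrt _ in h0 *; rewrite -mulr_natl; lra.
(* The threshold is sublinear and the count of [cstar] linear, so after [T0] only the count of [c]
   can keep the minimum below [thr]. *)
have [T0 hT0] : exists T0 : nat, forall T, (T0 <= T)%N -> thr T <= (Nn T cstar)%:R.
  pose K' := KD / xi + K; pose C' := (D + 2) / xi + C.
  pose e := eta / (4 * tmax).
  have e0 : 0 < e by rewrite divr_gt0//; lra.
  have K'0 : 0 <= K' by rewrite addr_ge0// divr_ge0 ?(ltW xi0).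
  have C'0 : 0 <= C' by rewrite addr_ge0// divr_ge0 ?(ltW xi0)// addr_ge0.
  have [B' [B'0 hB']] := err_sublinear K'0 C'0 e0.
  pose Q := (B' + 2 * e * B) / e.
  exists (Num.truncn Q).+1 => T hT.
  have QT : Q <= T%:R.
    apply: (@le_trans _ _ (Num.truncn Q).+1%:R); last by rewrite ler_nat.
    by apply: ltW; rewrite truncnS_gt.
  have h1 := heta T; have h2 := hB T; have h3 := hB' T%:R (ler0n _ _).
  have h4 : B' + 2 * e * B <= e * T%:R by rewrite [leRHS]mulrC -ler_pdivrMr.
  have h5 : eta * (en T)%:R = 2 * e * (2 * tmax * (en T)%:R).
    by rewrite /e; field; rewrite gt_eqF//; lra.
  have h6 : 2 * e * T%:R <= 2 * e * (2 * tmax * (en T)%:R) + 2 * e * B.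
    by rewrite -mulrDr ler_wpM2l// mulr_ge0// ltW.
  have -> : thr T = K' * lilrate T%:R + C' * (1 + Num.sqrt T%:R) - err K C T.
    rewrite /thr /K' /C' /err; set g := lilrate _; set s := 1 + _.
    by field; rewrite gt_eqF.
  lra.
pose Pt T := \sum_(t < T) (if isStart ss s0 t then post ss cs t (S c) else 0).
(* Before [T0], or while [Nn T c] is below the threshold, the compensator [Pt] is controlled by
   [Nn T c] itself; [At] is that bound with room for one more selection. *)
pose At T := thr T + err K C T + T0%:R + 2.
have At_le n m : (n <= m)%N -> At n <= At m.
  by move=> nm; rewrite /At; have := thr_le _ _ nm; have := err_le K0 C0 nm; lra.
have thr0 T : 0 <= thr T.
  by rewrite divr_ge0 ?(ltW xi0)// err_ge0// addr_ge0.
have p1 t : post ss cs t (S c) <= 1 by exact: post_le1.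
have claim T : Pt T <= At T + Num.sqrt T%:R.
  elim: T => [|T IH].
    rewrite /Pt big_ord0 sqrtr0 addr0 /At.
    by have := thr0 0%N; have := @err_ge0 K C 0 K0 C0; have := ler0n R T0; lra.
  have hA := At_le _ _ (leqnSn T).
  have hs : Num.sqrt T%:R <= Num.sqrt T.+1%:R :> R by rewrite ler_wsqrtr// ler_nat.
  rewrite /Pt big_ord_recr /= -/(Pt T); case: ifP => [st|_]; last by lra.
  have hbad : (Nn T c)%:R <= thr T + T0%:R -> Pt T + post ss cs T (S c) <=
      At T.+1 + Num.sqrt T.+1%:R.
    move=> hN; have := Hsel c T; rewrite ler_norml => /andP[h1 _].
    have h2 := err_le K0 C0 (epochs_le T); have := p1 T.
    have := sqrtn_ge0 T.+1; rewrite -/(Pt T) in h1; rewrite /At in hA *; lra.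
  have [hT|hT] := ltnP T T0.
    apply: hbad; have : (Nn T c)%:R <= T0%:R :> R.
      by rewrite ler_nat (leq_trans (Nc_le_epochs T c))// (leq_trans (epochs_le T))// ltnW.
    by have := thr0 T; lra.
  have [hN|hN] := leP (Nn T c)%:R (thr T).
    by apply: hbad; have := ler0n R T0; lra.
  have Tp : (0 < T)%N.
    by move: hN (Nc_le_epochs T c) (epochs_le T); case: T {IH hA hs st hbad hT} => // hN;
      rewrite /Nc big_ord0 ltNge thr0 in hN.
  have hm : thr T <= (minn (Nn T cstar) (Nn T c))%:R.
    by rewrite /minn; case: ifP => _; [exact: hT0|exact: ltW].
  have hp : post ss cs T (S c) <= expR (- (2 * Num.sqrt T.+1%:R)).
    apply: (le_trans (hD T Tp)); rewrite ler_expR -/KD.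
    have : xi * thr T <= xi * (minn (Nn T cstar) (Nn T c))%:R by rewrite ler_wpM2l// ltW.
    rewrite /thr mulrCA divff ?mulr1 ?gt_eqF// /err.
    have := sq1 T; set g := lilrate _; set s := Num.sqrt T%:R; set s' := Num.sqrt _.
    set x := _%:R; lra.
  have s1 : 1 <= Num.sqrt T.+1%:R :> R by rewrite -[leLHS]sqrtr1 ler_wsqrtr// ler1n.
  have he : expR (- (2 * Num.sqrt T.+1%:R)) <= (2 * Num.sqrt T.+1%:R)^-1 :> R.
    have s2 : 0 < 2 * Num.sqrt T.+1%:R :> R by lra.
    rewrite expRN lef_pV2 ?posrE ?expR_gt0//.
    by apply: le_trans (expR_ge1Dx _); lra.
  have hsq : (2 * Num.sqrt T.+1%:R)^-1 <= Num.sqrt T.+1%:R - Num.sqrt T%:R :> R.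
    have q : Num.sqrt T%:R ^+ 2 + 1 = Num.sqrt T.+1%:R ^+ 2 :> R.
      by rewrite !sqr_sqrtr// natr1.
    have q0 : 0 < 2 * Num.sqrt T.+1%:R :> R by lra.
    rewrite -[leLHS]mul1r ler_pdivrMr//.
    by have := sqr_ge0 (Num.sqrt T.+1%:R - Num.sqrt T%:R : R); nra.
  have := hA; lra.
exists ((D + 2) / xi + 2 * C + T0%:R + 3).
  by rewrite !addr_ge0// ?divr_ge0 ?(ltW xi0)// ?addr_ge0// mulr_ge0.
move=> T; have := Hsel c T; rewrite ler_norml => /andP[_ h1].
have h2 := err_le K0 C0 (epochs_le T); have := claim T; rewrite -/(Pt T) in h1.
have -> : err (KD / xi + 2 * K) ((D + 2) / xi + 2 * C + T0%:R + 3) T =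
   thr T + 2 * err K C T + (T0%:R + 3) * (1 + Num.sqrt T%:R).
  rewrite /thr /err; set g := lilrate _; set s := 1 + _.
  by field; rewrite gt_eqF.
rewrite /At; have := sqrtn_ge0 T; have := ler0n R T0; set s := Num.sqrt _.
nra.
Qed.

(** * Regret along one run *)

Variables (r : St -> Ac -> R) (mu : R).
Hypothesis Hrew : forall T,
  `|\sum_(t < T) (if cs t == cstar then mu - r (ss t) (cstar (ss t)) else 0)|
    <= err K C (sn T cstar).
Variable xi : policy St Ac -> R.
Hypothesis Hxi : forall c, usable c -> c != cstar -> 0 < xi c /\
  forall th, ~ N th -> cOPT th = c ->
     xi c <= cycle_KL ps cstar s0 (p th) \/ xi c <= cycle_KL ps c s0 (p th).
Hypothesis Hstar : usable cstar.

Definition rmax : R := `|mu| + \sum_s \sum_a `|r s a|.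

Lemma rmaxP s a : `|mu - r s a| <= rmax.
Proof.
apply: (le_trans (ler_normB _ _)); rewrite lerD2l (bigD1 s)//= (bigD1 a)//= -addrA.
by rewrite lerDl addr_ge0 ?sumr_ge0// => x _; exact: sumr_ge0.
Qed.

(** Contains none of the random constants of a run. The absolute value keeps the coefficient
    nonnegative for unusable policies too, whose [xi c] is arbitrary. *)
Definition regret_rate : R := K + rmax * \sum_(c : policy St Ac | c != cstar)
  (tmax * `|2 * (Gam * triples) * K / xi c + 2 * K| + K).

Lemma regret_upper : exists2 D : R, 0 <= D & forall T,
  \sum_(t < T) (mu - r (ss t) (cs t (ss t))) <= err regret_rate D T.
Proof.
have t1 := tmax_ge1.
have rm0 : 0 <= rmax by rewrite addr_ge0// sumr_ge0// => s _; exact: sumr_ge0.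
have hc c : exists D, 0 <= D /\ (c != cstar -> forall T,
    (sn T c)%:R <= err (tmax * `|2 * (Gam * triples) * K / xi c + 2 * K| + K) D T).
  have [uc|nuc] := pselect (usable c); last first.
    exists 0; split=> // _ T; rewrite steps_unusable// err_ge0// addr_ge0//.
    by rewrite mulr_ge0//; lra.
  have [ccs|] := eqVneq c cstar; first by exists 0.
  move=> ccs; have [xi0 hxi] := Hxi uc ccs.
  have [D D0 hD] := Nc_suboptimal xi0 uc Hstar ccs hxi.
  exists (tmax * D + C); split; first by rewrite addr_ge0// mulr_ge0//; lra.
  move=> _ T; apply: (le_trans (steps_Nc T c)).
  set k := 2 * _ * K / _ + _ in hD *.
  have h1 : (Nn T c)%:R <= err `|k| D T.
    by apply: (le_trans (hD T)); rewrite lerD2r ler_wpM2r ?lilrate_ge0// ler_norm.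
  have : tmax * (Nn T c)%:R <= tmax * err `|k| D T by rewrite ler_wpM2l//; lra.
  by rewrite /err; set g := lilrate _; set s := 1 + _; lra.
have [D hD] := boolp.choice hc.
have D0 c : 0 <= D c by case: (hD c).
exists (C + rmax * \sum_(c | c != cstar) D c).
  by rewrite addr_ge0// mulr_ge0// sumr_ge0.
move=> T.
have -> : \sum_(t < T) (mu - r (ss t) (cs t (ss t))) = \sum_c \sum_(t < T)
    (if cs t == c then mu - r (ss t) (c (ss t)) else 0).
  rewrite exchange_big /=; apply: eq_bigr => t _.
  rewrite (bigD1 (cs t))//= eqxx big1 ?addr0// => c.
  by rewrite eq_sym => /negPf ->.
rewrite (bigD1 cstar)//=.
have h1 := le_trans (ler_norm _) (le_trans (Hrew T) (err_le K0 C0 (steps_le T cstar))).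
have h2 : \sum_(c | c != cstar) \sum_(t < T)
    (if cs t == c then mu - r (ss t) (c (ss t)) else 0) <=
    \sum_(c | c != cstar) rmax *
      err (tmax * `|2 * (Gam * triples) * K / xi c + 2 * K| + K) (D c) T.
  apply: ler_sum => c ccs.
  apply: (@le_trans _ _ (rmax * (sn T c)%:R)); last first.
    by rewrite ler_wpM2l//; have [_] := hD c; apply.
  rewrite /steps natr_sum mulr_sumr; apply: ler_sum => t _.
  case: (cs t == c); rewrite ?mulr1 ?mulr0//.
  exact: le_trans (ler_norm _) (rmaxP _ _).
apply: le_trans (lerD h1 h2) _.
rewrite /err /regret_rate -mulr_sumr big_split /= -!mulr_suml.
set g := lilrate _; set s := 1 + _; lra.
Qed.

End Path.

(** * Almost sure regret rate *)

Section AlmostSure.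
Context {R : realType} {dO : measure_display} {Omega : measurableType dO}.
Variable P : probability Omega R.

Lemma err_mono (K K' C C' : R) T : K <= K' -> C <= C' -> err K C T <= err K' C' T.
Proof.
by move=> hK hC; rewrite lerD// ler_wpM2r ?lilrate_ge0// addr_ge0// sqrtr_ge0.
Qed.

(** The deterministic constants are summed over the finite index before the run is fixed, the random
    ones after. *)
Lemma ae_err_uniform (I : finType) (F : I -> nat -> Omega -> R) (W : I -> nat -> Omega -> nat) :
  (forall i, exists2 K, 0 <= K & \forall w \ae P, exists2 C, 0 <= C &
     forall T, `|F i T w| <= err K C (W i T w)) ->
  exists2 K, 0 <= K & \forall w \ae P, exists2 C, 0 <= C &
     forall i T, `|F i T w| <= err K C (W i T w).
Proof.
move=> h.
have h' i : exists K, 0 <= K /\ \forall w \ae P, exists2 C, 0 <= C &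
     forall T, `|F i T w| <= err K C (W i T w).
  by have [K K0 hK] := h i; exists K.
have [K hK] := boolp.choice h'.
have K0 i : 0 <= K i by case: (hK i).
have le_sum (f : I -> R) i : (forall j, 0 <= f j) -> f i <= \sum_j f j.
  by move=> f0; rewrite (bigD1 i)//= lerDl sumr_ge0.
exists (\sum_i K i); first exact: sumr_ge0.
have hall : \forall w \ae P, forall i, exists2 C, 0 <= C &
     forall T, `|F i T w| <= err (K i) C (W i T w).
  by apply: filter_forall => i; case: (hK i).
apply: filterS hall => w hw.
have hw' i : exists C, 0 <= C /\ forall T, `|F i T w| <= err (K i) C (W i T w).
  by have [C C0 hC] := hw i; exists C.
have [C hC] := boolp.choice hw'.
have C0 i : 0 <= C i by case: (hC i).
exists (\sum_i C i); first exact: sumr_ge0.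
move=> i T; have [_ hi] := hC i; apply: (le_trans (hi T)).
by apply: err_mono; exact: le_sum.
Qed.

End AlmostSure.

Section RegretRate.
Context {R : realType} {St Ac : finType} {dT : measure_display} {Theta : measurableType dT}.
Variables (pi : probability Theta R) (p : Theta -> tkernel R St Ac) (thstar : Theta).
Variables (r : St -> Ac -> R) (s0 : St).
Variables (Cset : {set policy St Ac}) (cOPT : Theta -> policy St Ac).
Context {dO : measure_display} {Omega : measurableType dO}.
Variables (P : probability Omega R) (X : nat -> Omega -> St) (Pol : nat -> Omega -> policy St Ac).
Hypothesis Hker : forall th, is_kernel (p th).
Hypothesis Hpmeas : forall s1 a s2, measurable_fun setT (fun th => p th s1 a s2).
Hypothesis Hcvg : forall th (c : policy St Ac), cvgn (avg_seq (p th) r c s0).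
Hypothesis HcOPT : forall th, cOPT th \in Cset /\
  forall c, c \in Cset -> gain (p th) r c s0 <= gain (p th) r (cOPT th) s0.
Hypothesis HcOPTm : forall c, measurable (cOPT @^-1` [set c]).
Hypothesis HSm : forall t s, measurable [set w | X t w = s].
Hypothesis HPolm : forall t c, measurable [set w | Pol t w = c].
Hypothesis Hlaw : forall (n : nat) (ss : nat -> St) (cs : nat -> policy St Ac),
  P [set w | (forall t, (t <= n)%N -> X t w = ss t) /\
             (forall t, (t < n)%N -> Pol t w = cs t)]
  = (path_prob pi p thstar s0 cOPT ss cs n)%:E.
Variables (Gam : R) (N : set Theta).
Hypothesis Gam0 : 0 <= Gam.
Hypothesis Nm : measurable N.
Hypothesis N0 : pi N = 0%E.
Hypothesis HN : forall th, ~ N th -> forall s1 a s2,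
  ((p thstar s1 a s2 == 0) = (p th s1 a s2 == 0)) /\
  (0 < p thstar s1 a s2 -> `|ln (p thstar s1 a s2 / p th s1 a s2)| <= Gam).
Local Notation S c := (cOPT @^-1` [set c]).
Local Notation ps := (p thstar).
Local Notation cstar := (cOPT thstar).
Local Notation feas := (feasible pi p thstar s0 cOPT).
Local Notation usable := (usable pi cOPT).
Local Notation v c := (visits ps c s0).
Local Notation tau c := (cycle_len ps c s0).
Hypothesis Hrec : forall c, usable c -> recurrent ps c s0.
Hypothesis HA3 : forall c, c \in Cset -> c != cstar ->
  gain ps r c s0 < gain ps r cstar s0.
Hypothesis HA4 : forall e1 e2 : R, 0 <= e1 -> 0 <= e2 ->
  exists2 ps : R, 0 < ps &
  exists E : set Omega, [/\ measurable E, P E = 1%E &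
    forall w, E w -> forall T : nat, isStart (X^~ w) s0 T ->
      (forall c, c \in Cset -> (0 < Nc (X^~ w) (Pol^~ w) s0 T c)%N ->
         forall s1 s2,
           `| (Jc (X^~ w) (Pol^~ w) T c s1 s2)%:R / (Nc (X^~ w) (Pol^~ w) s0 T c)%:R
              - mean_return (p thstar) c s0 * stat_pair (p thstar) c s0 s1 s2 |
           <= Num.sqrt (e1 * ln (e2 * ln (Nc (X^~ w) (Pol^~ w) s0 T c)%:R)
                        / (Nc (X^~ w) (Pol^~ w) s0 T c)%:R)) ->
      ps <= post pi p (X^~ w) (Pol^~ w) T (S cstar)].
Hypothesis HA5A : exists a1 a2 : R, [/\ 0 < a1, 0 <= a2 &
  forall kc : policy St Ac -> nat,
    (1 <= \sum_(c in Cset) kc c)%N ->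
    ((a1 * (\sum_(c in Cset) kc c)%:R `^ (- a2))%:E
       <= pi (prior_ball p thstar s0 Cset kc))%E].

Lemma Nc_local T c : local T (fun (ss : nat -> St) (cs : nat -> policy St Ac) => Nc ss cs s0 T c).
Proof.
move=> x y x' y' [h1 h2]; apply: eq_bigl => t.
by rewrite /isStart h1 ?h2//; exact: ltnW.
Qed.

Lemma Jc_local T c a b : local T (fun (ss : nat -> St) (cs : nat -> policy St Ac) => Jc ss cs T c a b).
Proof.
move=> x y x' y' [h1 h2]; apply: eq_bigl => t.
by rewrite !h1 ?h2//; exact: ltnW.
Qed.

(* Every feasible history has positive probability, hence is met inside the
   almost sure event of (A4). *)
Lemma A4_feasible (e1 e2 : R) : 0 <= e1 -> 0 <= e2 ->
  exists2 ps : R, 0 < ps & forall T ss cs, feas T ss cs -> ss T = s0 ->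
  (forall c, c \in Cset -> (0 < Nc ss cs s0 T c)%N -> forall s1 s2,
     `| (Jc ss cs T c s1 s2)%:R / (Nc ss cs s0 T c)%:R
        - mean_return (p thstar) c s0 * stat_pair (p thstar) c s0 s1 s2 |
     <= Num.sqrt (e1 * ln (e2 * ln (Nc ss cs s0 T c)%:R) / (Nc ss cs s0 T c)%:R)) ->
  ps <= post pi p ss cs T (S cstar).
Proof.
move=> e10 e20; have [q q0 [E [mE PE hE]]] := HA4 e10 e20.
exists q => // T ss cs hf hT hdev.
have pp := path_prob_gt0 Hker Hpmeas HcOPTm Gam0 Nm N0 HN hf.
have [w Ew hw] := realize HSm HPolm Hlaw pp mE PE.
have := hE w Ew T; rewrite (post_local _ _ _ hw); apply.
  by rewrite /isStart; case: hw => h _; rewrite h// hT eqxx orbT.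
move=> c cC; rewrite (Nc_local c hw) => cN s1 s2; rewrite (Jc_local c s1 s2 hw).
exact: hdev.
Qed.

(** At time 0 the condition in (A4) is vacuous and the posterior is the prior. *)
Lemma usable_cstar : usable cstar.
Proof.
have [q q0 h] := A4_feasible (lexx 0) (lexx 0).
have hf : feas 0 (fun=> s0) (fun=> cstar) by [].
have := h _ _ _ hf erefl; rewrite postE evidence0// evidence0// => h'.
suff : (0 < pi (S cstar))%E by [].
rewrite lt_def measure_ge0 andbT; apply/eqP => h0.
have : q <= 0.
  rewrite -[leRHS](mul0r (fine (pi setT))^-1) -[X in X / _](_ : fine (pi (S cstar)) = 0).
    by apply: h' => c _; rewrite /Nc big_ord0.
  by rewrite h0.
by rewrite leNgt q0.
Qed.

Lemma usable_Cset c : usable c -> c \in Cset.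
Proof. by move=> /(usable_good HcOPTm Nm N0)[th <- _]; case: (HcOPT th). Qed.

(* If both divergences were small, [gain th] would be close to [gain thstar] at
   [c] and at [cstar], so that [c] could not be optimal for [th]. *)
Lemma divergence_gap c : usable c -> c != cstar -> exists xi : R, 0 < xi /\
  forall th, ~ N th -> cOPT th = c ->
    xi <= cycle_KL ps cstar s0 (p th) \/ xi <= cycle_KL ps c s0 (p th).
Proof.
move=> uc ccs; have cC := usable_Cset uc; have hlt := HA3 cC ccs.
pose D := gain ps r cstar s0 - gain ps r c s0.
(* Two errors of a quarter of the gap still leave [cstar] ahead of [c] at [th]. *)
have D0 : 0 < D / 4 by rewrite divr_gt0// subr_gt0.
have [x1 x10 h1] := gain_continuous (Hker thstar) (Hrec usable_cstar) D0 (@Hcvg _ _).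
have [x2 x20 h2] := gain_continuous (Hker thstar) (Hrec uc) D0 (@Hcvg _ _).
exists (Num.min x1 x2); split; first by rewrite lt_min x10.
move=> th nN hth.
have supp (d : policy St Ac) s s' : (ps s (d s) s' == 0) = (p th s (d s) s' == 0).
  by have [] := HN nN s (d s) s'.
have [l1|l1] := leP x1 (cycle_KL ps cstar s0 (p th)).
  by left; rewrite ge_min l1.
have [l2|l2] := leP x2 (cycle_KL ps c s0 (p th)).
  by right; rewrite ge_min l2 orbT.
have := h1 _ (Hker th) (@Hcvg _ _) (supp _) l1.
have := h2 _ (Hker th) (@Hcvg _ _) (supp _) l2.
have [_ hopt] := HcOPT th; have := hopt _ (usable_Cset usable_cstar).
rewrite hth !ler_norml /D => h3 /andP[h4 h5] /andP[h6 h7]; exfalso.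
move: h3 h4 h5 h6 h7 hlt D0; rewrite /D; lra.
Qed.

Lemma start_feasible (ss : nat -> St) t :
  ss 0%N = s0 -> isStart ss s0 t = (ss t == s0).
Proof. by rewrite /isStart => h; case: t => //=; rewrite h eqxx. Qed.

Lemma Nc_natr (ss : nat -> St) (cs : nat -> policy St Ac) T c :
  (Nc ss cs s0 T c)%:R = \sum_(t < T) (isStart ss s0 t && (cs t == c))%:R :> R.
Proof. by rewrite /Nc big_mkcond natr_sum; apply: eq_bigr => t _; case: ifP. Qed.

Lemma Jc_natr (ss : nat -> St) (cs : nat -> policy St Ac) T c a b :
  (Jc ss cs T c a b)%:R =
    \sum_(t < T) [&& cs t == c, ss t == a & ss t.+1 == b]%:R :> R.
Proof. by rewrite /Jc big_mkcond natr_sum; apply: eq_bigr => t _; case: ifP. Qed.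

(** [phi] totals zero over a cycle, as [s0] is visited once and all visits add up to [tau]; along
    the run it compares steps with epochs. Unusable policies get the zero functional, so that one
    family covers all policies. *)
Lemma ae_lengths : exists2 K, 0 <= K & \forall w \ae P, exists2 C, 0 <= C &
  forall c T, usable c ->
   `|(steps (Pol^~ w) T c)%:R - tau c * (Nc (X^~ w) (Pol^~ w) s0 T c)%:R|
   <= err K C (steps (Pol^~ w) T c).
Proof.
pose phi (c : policy St Ac) (s s' : St) : R := 1 - tau c * (s == s0)%:R.
have [c|K K0 hK] := @ae_err_uniform _ _ _ P (policy St Ac)
  (fun c T w => if `[< usable c >] then
     \sum_(t < T) (if Pol t w == c then phi c (X t w) (X t.+1 w) else 0) else 0)
  (fun c T w => steps (Pol^~ w) T c).
  case: asboolP => [uc|_]; last first.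
    exists 0 => //; apply: aeW => w; exists 0 => // T.
    by rewrite normr0 err_ge0.
  apply: (cycle_lil Hker Hpmeas HcOPTm HSm HPolm Hlaw Nm N0 Hrec uc).
  rewrite /phi; under eq_bigr do rewrite -mulr_suml (ker_sum1 _ (Hker thstar)) mul1r mulrBr mulr1.
  rewrite sumrB (bigD1 s0)//= [X in _ - X](bigD1 s0)//= eqxx mulr1.
  rewrite [X in _ - (_ + X)]big1 ?addr0; last first.
    by move=> s /negPf ->; rewrite !mulr0.
  rewrite (visits_start (Hker thstar) (Hrec uc)) mul1r.
  by rewrite /cycle_len [X in _ - X](bigD1 s0)//= (visits_start (Hker thstar) (Hrec uc)) subrr.
exists K => //; have := ae_feasible Hker Hpmeas HcOPTm HSm HPolm Hlaw Nm N0.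
apply: filterS2 hK => w [C C0 hC] hf; exists C => // c T uc.
have := hC c T; have /asboolP -> := uc; apply: le_trans; rewrite le_eqVlt.
apply/orP; left; apply/eqP; congr (`| _ |).
rewrite Nc_natr /steps natr_sum mulr_sumr -sumrB.
apply: eq_bigr => t _; rewrite /phi start_feasible; last by case: (hf 0%N).
by case: (Pol t w == c); rewrite ?andbT ?andbF /= ?mulr0 ?subrr//; case: (X t w == s0).
Qed.

(** The same device for the indicator of a transition from [a] to [b], whose expected total over a
    cycle is [v c a * ps a (c a) b]. *)
Lemma ae_transitions : exists2 K, 0 <= K & \forall w \ae P, exists2 C, 0 <= C &
  forall c a b T, usable c ->
   `|(Jc (X^~ w) (Pol^~ w) T c a b)%:R -
      (Nc (X^~ w) (Pol^~ w) s0 T c)%:R * (v c a * ps a (c a) b)|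
   <= err K C (steps (Pol^~ w) T c).
Proof.
pose phi (i : policy St Ac * St * St) (s s' : St) : R :=
  ((s == i.1.2) && (s' == i.2))%:R - v i.1.1 i.1.2 * ps i.1.2 (i.1.1 i.1.2) i.2 * (s == s0)%:R.
have [i|K K0 hK] := @ae_err_uniform _ _ _ P (policy St Ac * St * St)%type
  (fun i T w => if `[< usable i.1.1 >] then
     \sum_(t < T) (if Pol t w == i.1.1 then phi i (X t w) (X t.+1 w) else 0) else 0)
  (fun i T w => steps (Pol^~ w) T i.1.1).
  case: i => [[c a] b] /=; case: asboolP => [uc|_]; last first.
    exists 0 => //; apply: aeW => w; exists 0 => // T.
    by rewrite normr0 err_ge0.
  apply: (cycle_lil Hker Hpmeas HcOPTm HSm HPolm Hlaw Nm N0 Hrec uc).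
  rewrite /phi /=.
  have E s : v c s * (\sum_s' ps s (c s) s' * (((s == a) && (s' == b))%:R -
      v c a * ps a (c a) b * (s == s0)%:R)) =
      (s == a)%:R * (v c a * ps a (c a) b) - (s == s0)%:R * (v c a * ps a (c a) b).
    under eq_bigr do rewrite mulrBr.
    rewrite sumrB -mulr_suml (ker_sum1 _ (Hker thstar)) mul1r mulrBr; congr (_ - _).
      have [->|_] := eqVneq s a; last by rewrite mul0r big1 ?mulr0// => s' _; rewrite mulr0.
      rewrite mul1r (bigD1 b)//= eqxx mulr1 big1 ?addr0// => s' /negPf ->.
      by rewrite mulr0.
    have [->|_] := eqVneq s s0; last by rewrite mul0r !mulr0.
    by rewrite (visits_start (Hker thstar) (Hrec uc)) !mul1r mulr1.
  under eq_bigr do rewrite E.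
  rewrite sumrB -!mulr_suml (bigD1 a)//= eqxx big1 ?addr0; last by move=> s /negPf ->.
  rewrite (bigD1 s0)//= eqxx big1 ?addr0 ?subrr//; by move=> s /negPf ->.
exists K => //; have := ae_feasible Hker Hpmeas HcOPTm HSm HPolm Hlaw Nm N0.
apply: filterS2 hK => w [C C0 hC] hf; exists C => // c a b T uc.
have := hC (c, a, b) T => /=; have /asboolP -> := uc; apply: le_trans; rewrite le_eqVlt.
apply/orP; left; apply/eqP; congr (`| _ |).
rewrite Nc_natr Jc_natr mulr_suml -sumrB.
apply: eq_bigr => t _; rewrite /phi /= start_feasible; last by case: (hf 0%N).
case: (Pol t w == c); rewrite ?andbT ?andbF /= ?mul0r ?subrr//.
by case: (_ && _); case: (X t w == s0); rewrite /= ?mulr1 ?mulr0 ?mul1r ?mul0r.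
Qed.

Lemma ae_selection : exists2 K, 0 <= K & \forall w \ae P, exists2 C, 0 <= C &
  forall c T,
   `|(Nc (X^~ w) (Pol^~ w) s0 T c)%:R - \sum_(t < T) (if isStart (X^~ w) s0 t
       then post pi p (X^~ w) (Pol^~ w) t (S c) else 0)|
   <= err K C (epochs s0 (X^~ w) T).
Proof.
have [c|K K0 hK] := @ae_err_uniform _ _ _ P (policy St Ac)
  (fun c T w => \sum_(t < T) (if isStart (X^~ w) s0 t then
      (Pol t w == c)%:R - post pi p (X^~ w) (Pol^~ w) t (S c) else 0))
  (fun c T w => epochs s0 (X^~ w) T).
  by exists (6 * 1) => //; exact: (selection_lil Hker Hpmeas HcOPTm HSm HPolm Hlaw).
exists K => //; apply: filterS hK => w [C C0 hC]; exists C => // c T.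
apply: le_trans (hC c T); rewrite le_eqVlt; apply/orP; left; apply/eqP.
congr (`| _ |); rewrite Nc_natr -sumrB; apply: eq_bigr => t _.
by case: isStart => /=; rewrite ?subrr//; case: (_ == _).
Qed.

Lemma gain_cstar_balance :
  \sum_s v cstar s * (gain ps r cstar s0 - r s (cstar s)) = 0.
Proof.
have hr := Hrec usable_cstar; have t0 := cycle_len_gt0 (Hker thstar) hr.
under eq_bigr do rewrite mulrBr.
rewrite sumrB -mulr_suml (gainE (Hker thstar) hr)// mulrC divfK ?subrr// gt_eqF//.
Qed.

Lemma ae_reward : exists2 K, 0 <= K & \forall w \ae P, exists2 C, 0 <= C &
  forall T, `|\sum_(t < T) (if Pol t w == cstar then
      gain ps r cstar s0 - r (X t w) (cstar (X t w)) else 0)|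
   <= err K C (steps (Pol^~ w) T cstar).
Proof.
apply: (cycle_lil (phi := fun s _ => gain ps r cstar s0 - r s (cstar s))
  Hker Hpmeas HcOPTm HSm HPolm Hlaw Nm N0 Hrec usable_cstar).
rewrite -[RHS]gain_cstar_balance; apply: eq_bigr => s _.
by rewrite -mulr_suml (ker_sum1 _ (Hker thstar)) mul1r.
Qed.

Lemma ae_regret : exists2 K, 0 <= K & \forall w \ae P, exists2 D, 0 <= D &
  forall T, \sum_(t < T) (gain ps r cstar s0 - r (X t w) (Pol t w (X t w))) <= err K D T.
Proof.
have [K1 K10 h1] := ae_lengths; have [K2 K20 h2] := ae_transitions.
have [K3 K30 h3] := ae_selection; have [K4 K40 h4] := ae_reward.
(* A total choice of gaps, with a dummy value at [cstar] and at unusable policies; it is made before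
   the run is fixed. *)
have hxi c : exists xi : R, usable c -> c != cstar -> 0 < xi /\
  forall th, ~ N th -> cOPT th = c ->
    xi <= cycle_KL ps cstar s0 (p th) \/ xi <= cycle_KL ps c s0 (p th).
  have [[uc ccs]|hn] := pselect (usable c /\ c != cstar).
    by have [xi h] := divergence_gap uc ccs; exists xi.
  by exists 0 => uc ccs; case: hn.
have [xi Hxi] := boolp.choice hxi.
pose K := K1 + K2 + K3 + K4.
have K0 : 0 <= K by rewrite /K !addr_ge0.
pose KR := regret_rate p thstar s0 Gam K cstar r (gain ps r cstar s0) xi.
exists `|KR| => //.
have := ae_feasible Hker Hpmeas HcOPTm HSm HPolm Hlaw Nm N0.
apply: filterS3 (filterI h1 h2) (filterI h3 h4) => w [[C1 C10 g1] [C2 C20 g2]]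
  [[C3 C30 g3] [C4 C40 g4]] hf.
pose C := C1 + C2 + C3 + C4.
have C0 : 0 <= C by rewrite /C !addr_ge0.
have eK (k : R) (c : R) (t : nat) : k <= K -> c <= C -> err k c t <= err K C t.
  exact: err_mono.
have [D D0 hD] := regret_upper Hker Hpmeas HcOPTm Gam0 Nm N0 HN Hrec hf K0 C0
  (fun c T uc => le_trans (g1 c T uc) (eK K1 C1 _ ltac:(rewrite /K; lra) ltac:(rewrite /C; lra)))
  (fun c a b T uc => le_trans (g2 c a b T uc) (eK K2 C2 _ ltac:(rewrite /K; lra) ltac:(rewrite /C; lra)))
  (fun c T => le_trans (g3 c T) (eK K3 C3 _ ltac:(rewrite /K; lra) ltac:(rewrite /C; lra)))
  usable_Cset A4_feasible HA5A
  (fun T => le_trans (g4 T) (eK K4 C4 _ ltac:(rewrite /K; lra) ltac:(rewrite /C; lra)))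
  Hxi usable_cstar.
exists D => // T; apply: (le_trans (hD T)).
by rewrite lerD2r ler_wpM2r ?lilrate_ge0// ler_norm.
Qed.

End RegretRate.

(** * From an almost sure rate to a bound with prescribed probability *)

Lemma eventually_prob {R : realType} {d : measure_display} {Omega : measurableType d}
    (P : probability Omega R) (G : nat -> set Omega) (e : R) : 0 < e ->
  (forall n, measurable (G n)) -> nondecreasing_seq G ->
  (\forall w \ae P, exists n, G n w) -> exists n, ((1 - e)%:E <= P (G n))%E.
Proof.
move=> e0 mG ndG hae; apply: contrapT => hn.
have mU : measurable (\bigcup_n G n) by exact: bigcupT_measurable.
have hU : P (\bigcup_n G n) = 1%E.
  have nU : P (~` \bigcup_n G n) = 0%E.
    apply: measure_negligible; first exact: measurableC.
    apply: negligibleS hae => w /= hw [n Gn]; apply: hw; exists n => //.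
  by have := probability_setC P (measurableC mU); rewrite setCK nU sube0.
have cv := @nondecreasing_cvg_mu _ _ _ P _ mG mU ndG.
have : (P (\bigcup_n G n) <= (1 - e)%:E)%E.
  rewrite -(cvg_lim _ cv)//; apply: lime_le; first by apply: cvgP cv.
  apply: nearW => n; rewrite leNgt; apply/negP => h; apply: hn.
  by exists n; exact: ltW.
by rewrite hU lee_fin; lra.
Qed.

(** [tau] cancels against [sqrt (6 * tau)], the 6 being that of [loglog_le_lnln]; [delta <= 1] only
    enlarges the logarithm, so one [n0] serves all [delta]. *)
Lemma lilrate_le_rate {R : realType} (K tau : R) : 0 <= K -> 0 < tau ->
  exists2 n0 : nat, (0 < n0)%N & forall delta, 0 < delta <= 1 -> forall T : nat, (n0 <= T)%N ->
    K * lilrate T%:R <=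
      K * Num.sqrt (6 * tau) * Num.sqrt (T%:R / tau * ln (ln T%:R / delta)).
Proof.
move=> K0 tau0; have [n0 [n0p hn0]] := @loglog_le_lnln R.
exists n0 => // delta /andP[d0 d1] T hT.
rewrite -mulrA -sqrtrM; last by rewrite mulr_ge0// ltW.
rewrite ler_wpM2l// ler_wsqrtr//.
have -> : 6 * tau * (T%:R / tau * ln (ln T%:R / delta)) =
   T%:R * (6 * ln (ln T%:R / delta)) by field; rewrite gt_eqF.
rewrite ler_wpM2l//; apply: (le_trans (hn0 T hT)).
have l1 := loglog_ge1 (ler0n R T); have l2 := hn0 T hT.
(* Otherwise [ln (ln T)] would be 0 by convention, against [1 <= loglog T]. *)
have lT : 0 < ln T%:R :> R.
  rewrite ltNge; apply/negP => h; rewrite (ln0 h) in l2; lra.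
by rewrite ler_pM2l// ler_ln ?posrE ?divr_gt0// ler_pdivlMr// ler_piMr// ltW.
Qed.

(** The rewards of the conclusion run from time 1 to [T], the martingale sums from 0 to [T - 1];
    only the two end terms differ. *)
Lemma sum_shift_le {R : realType} (x : nat -> R) (mu M : R) T :
  (forall t, `|mu - x t| <= M) ->
  T%:R * mu - \sum_(1 <= t < T.+1) x t <= \sum_(t < T) (mu - x t) + 2 * M.
Proof.
move=> hM.
have -> : T%:R * mu - \sum_(1 <= t < T.+1) x t =
    \sum_(t < T) (mu - x t) - (mu - x 0%N) + (mu - x T).
  have -> : T%:R * mu - \sum_(1 <= t < T.+1) x t = \sum_(1 <= t < T.+1) (mu - x t).
    by rewrite sumrB sumr_const_nat subn1 /= mulr_natl.
  rewrite -[\sum_(t < T) _](big_mkord xpredT (fun t => mu - x t)).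
  have := @big_nat_recr R 0 +%R T 0 (fun t => mu - x t) (leq0n T).
  rewrite (@big_ltn _ _ _ 0 T.+1)// => h; rewrite addrAC -[in RHS]h /=.
  by rewrite addrAC subrr add0r.
have := hM T; have := hM 0%N.
by rewrite !ler_norml => /andP[h1 h2] /andP[h3 h4]; lra.
Qed.

Lemma err_add_const {R : realType} (K D M : R) T : 0 <= M ->
  err K D T + M <= err K (D + M) T.
Proof.
move=> M0; rewrite /err mulrDl addrA lerD2l ler_peMr// lerDl.
exact: sqrtr_ge0.
Qed.

Theorem theorem2
  (R : realType) (St Ac : finType)
  (dT : measure_display) (Theta : measurableType dT) (pi : probability Theta R)
  (p : Theta -> tkernel R St Ac) (thstar : Theta)
  (r : St -> Ac -> R) (s0 : St)
  (Cset : {set policy St Ac}) (cOPT : Theta -> policy St Ac)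
  (dO : measure_display) (Omega : measurableType dO) (P : probability Omega R)
  (X : nat -> Omega -> St) (Pol : nat -> Omega -> policy St Ac)
  (* the model: transition kernels, measurable in theta *)
  (Hker : forall th, is_kernel (p th))
  (Hpmeas : forall s1 a s2, measurable_fun setT (fun th => p th s1 a s2))
  (* limits lim_t H_{t,theta,c}/t exist *)
  (Hcvg : forall th (c : policy St Ac), cvgn (avg_seq (p th) r c s0))
  (* C contains an average-reward optimal policy for each theta *)
  (HCopt : forall th, exists2 c, c \in Cset &
             forall c' : policy St Ac, gain (p th) r c' s0 <= gain (p th) r c s0)
  (* c^OPT(theta) : a maximiser of the average reward over C (fixed tie-breaking) *)
  (HcOPT : forall th, cOPT th \in Cset /\
             forall c, c \in Cset -> gain (p th) r c s0 <= gain (p th) r (cOPT th) s0)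
  (HcOPTm : forall c, measurable (cOPT @^-1` [set c]))
  (* the TSMDP run on m_{theta*}: X t = S_t, Pol t = policy in use at time t *)
  (HSm : forall t s, measurable [set w | X t w = s])
  (HPolm : forall t c, measurable [set w | Pol t w = c])
  (Hlaw : forall (n : nat) (ss : nat -> St) (cs : nat -> policy St Ac),
     P [set w | (forall t, (t <= n)%N -> X t w = ss t) /\
                (forall t, (t < n)%N -> Pol t w = cs t)]
     = (path_prob pi p thstar s0 cOPT ss cs n)%:E)
  (* (A1) *)
  (HA1 : exists N : set Theta, [/\ measurable N, pi N = 0%E &
           forall th, ~ N th -> recurrent (p thstar) (cOPT th) s0])
  (* (A2) *)
  (HA2 : exists Gam : R, exists N : set Theta, [/\ measurable N, pi N = 0%E &
           forall th, ~ N th -> forall s1 a s2,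
             ((p thstar s1 a s2 == 0) = (p th s1 a s2 == 0)) /\
             (0 < p thstar s1 a s2 ->
                `|ln (p thstar s1 a s2 / p th s1 a s2)| <= Gam)])
  (* (A3) *)
  (HA3 : forall c, c \in Cset -> c != cOPT thstar ->
           gain (p thstar) r c s0 < gain (p thstar) r (cOPT thstar) s0)
  (* (A4) *)
  (HA4 : forall e1 e2 : R, 0 <= e1 -> 0 <= e2 ->
     exists2 ps : R, 0 < ps &
     exists E : set Omega, [/\ measurable E, P E = 1%E &
       forall w, E w -> forall T : nat, isStart (X^~ w) s0 T ->
         (forall c, c \in Cset -> (0 < Nc (X^~ w) (Pol^~ w) s0 T c)%N ->
            forall s1 s2,
              `| (Jc (X^~ w) (Pol^~ w) T c s1 s2)%:R / (Nc (X^~ w) (Pol^~ w) s0 T c)%:R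
                 - mean_return (p thstar) c s0 * stat_pair (p thstar) c s0 s1 s2 |
              <= Num.sqrt (e1 * ln (e2 * ln (Nc (X^~ w) (Pol^~ w) s0 T c)%:R)
                           / (Nc (X^~ w) (Pol^~ w) s0 T c)%:R)) ->
         ps <= post pi p (X^~ w) (Pol^~ w) T (cOPT @^-1` [set cOPT thstar])])
  (* (A5)(A) *)
  (HA5A : exists a1 a2 : R, [/\ 0 < a1, 0 <= a2 &
     forall kc : policy St Ac -> nat,
       (1 <= \sum_(c in Cset) kc c)%N ->
       ((a1 * (\sum_(c in Cset) kc c)%:R `^ (- a2))%:E
          <= pi (prior_ball p thstar s0 Cset kc))%E])
  (* (A5)(B) *)
  (HA5B : exists a3 a4 : R, [/\ 0 < a3, 0 < a4 &
     forall kc : policy St Ac -> nat,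
       (1 <= \sum_(c in Cset) kc c)%N ->
       ((\sum_(c in Cset) kc c)%:R - 3 * (ln (\sum_(c in Cset) kc c)%:R) ^+ 2 : R)
          <= (kc (cOPT thstar))%:R ->
       ((a3 * (\sum_(c in Cset) kc c)%:R `^ (- a4))%:E
          <= pi (prior_ball p thstar s0 Cset kc))%E]) :
  exists C : R, 0 < C /\
  forall delta : R, 0 < delta <= 1 ->
  exists T1 : nat, (0 < T1)%N /\
  exists E : set Omega, [/\ measurable E, ((1 - 2 * delta)%:E <= P E)%E &
    forall w, E w -> forall T : nat, (T1 <= T)%N ->
      T%:R * gain (p thstar) r (cOPT thstar) s0
        - \sum_(1 <= t < T.+1) r (X t w) (Pol t w (X t w))
      <= C * Num.sqrt (T%:R / mean_return (p thstar) (cOPT thstar) s0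
                       * ln (ln T%:R / delta))].
Proof.
have [N1 [N1m N10 hN1]] := HA1; have [Gam [N [Nm N0 hN]]] := HA2.
have Hrec (c : policy St Ac) : usable pi cOPT c -> recurrent (p thstar) c s0.
  move=> /(usable_good HcOPTm N1m N10)[th <- nN]; exact: hN1.
(* (A2) gives no sign for [Gam]; its absolute value is a bound as well. *)
have hN' th : ~ N th -> forall s1 a s2,
    ((p thstar s1 a s2 == 0) = (p th s1 a s2 == 0)) /\
    (0 < p thstar s1 a s2 -> `|ln (p thstar s1 a s2 / p th s1 a s2)| <= `|Gam|).
  move=> nN s1 a s2; have [h1 h2] := hN th nN s1 a s2; split=> // h.
  exact: le_trans (h2 h) (ler_norm _).
have [K K0 hK] := ae_regret Hker Hpmeas Hcvg HcOPT HcOPTm HSm HPolm Hlaw (normr_ge0 Gam)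
  Nm N0 hN' Hrec HA3 HA4 HA5A.
have ucs := usable_cstar Hker Hpmeas HcOPTm HSm HPolm Hlaw (normr_ge0 Gam) Nm N0 hN' HA4.
have tau0 := cycle_len_gt0 (Hker thstar) (Hrec _ ucs).
rewrite (mean_returnE (Hker thstar) (Hrec _ ucs)).
set tau := cycle_len _ _ _ in tau0 *; set mu := gain _ _ _ _ in hK *.
have K1 : 0 < K + 1 by exact: ltr_wpDl.
have [n0 n0p hn0] := lilrate_le_rate (ltW K1) tau0.
(* Fixed before [delta]; the unit added to [K] pays for the random coefficient of each run. *)
exists ((K + 1) * Num.sqrt (6 * tau)); split.
  by rewrite mulr_gt0// sqrtr_gt0 mulr_gt0.
move=> delta hd; have d0 : 0 < delta by case/andP: hd.
pose bnd (T : nat) :=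
  (K + 1) * Num.sqrt (6 * tau) * Num.sqrt (T%:R / tau * ln (ln T%:R / delta)).
pose reg (T : nat) (ss : nat -> St) (cs : nat -> policy St Ac) :=
  T%:R * mu - \sum_(1 <= t < T.+1) r (ss t) (cs t (ss t)).
have rm0 : 0 <= rmax r mu by apply: le_trans (rmaxP r mu s0 (cOPT thstar s0)).
(* These events increase with [n], and almost every run lies in one of them, since its random
   coefficient is absorbed after finitely many steps. *)
pose G n := [set w | forall T, (n0 + n <= T)%N -> reg T (X^~ w) (Pol^~ w) <= bnd T].
have mG n : measurable (G n).
  rewrite (_ : G n = \bigcap_T [set w | (n0 + n <= T)%N -> reg T (X^~ w) (Pol^~ w) <= bnd T]).
    apply: bigcapT_measurable => T.
    (* The horizon is [T.+1] because the sum involves the policy at time [T]. *)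
    apply: (@history_measurable _ _ _ _ X Pol HSm HPolm T.+1
      (fun ss cs => (n0 + n <= T)%N -> reg T ss cs <= bnd T)) => x y x' y' [h1 h2].
    rewrite /reg (_ : \sum_(1 <= t < T.+1) r (x t) (y t (x t)) =
      \sum_(1 <= t < T.+1) r (x' t) (y' t (x' t)))//.
    apply: eq_big_nat => t /andP[_ tT]; rewrite h1 ?h2//.
    exact: leqW.
  by apply/seteqP; split=> w /= hw T; [move=> _; exact: hw|exact: hw].
have ndG : nondecreasing_seq G.
  apply/nondecreasing_seqP => n; apply/subsetPset => w hw T hT; apply: hw.
  by apply: leq_trans hT; rewrite leq_add2l.
have aeG : \forall w \ae P, exists n, G n w.
  apply: filterS hK => w [D D0 hD].
  have D'0 : 0 <= D + 2 * rmax r mu by rewrite addr_ge0// mulr_ge0.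
  have [n1 [n1p hn1]] := @err_le_lilrate R K _ D'0.
  exists n1 => T hT.
  have hT0 : (n0 <= T)%N by apply: leq_trans hT; rewrite leq_addr.
  have hT1 : (n1 <= T)%N by apply: leq_trans hT; rewrite leq_addl.
  apply: le_trans (hn0 delta hd T hT0); apply: le_trans (hn1 T hT1).
  apply: le_trans (err_add_const K D T (mulr_ge0 (ler0n R 2) rm0)).
  apply: le_trans (lerD (hD T) (lexx _)).
  by apply: sum_shift_le => t; exact: rmaxP.
have e0 : 0 < 2 * delta by rewrite mulr_gt0.
have [n hn] := eventually_prob e0 mG ndG aeG.
exists (n0 + n)%N; split; first by rewrite addn_gt0 n0p.
by exists (G n); split=> // w hw T hT; exact: hw.
Qed.
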